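(* Fix a finite relational schema $\sigma$ and an integer $d\geq 2$, and let $\mathbf{C}$ be a class of $\sigma$-databases of degree at most $d$ that is closed under removing tuples. Let $\mathbf{P}\subseteq\mathbf{C}$ be a property that is hyperfinite on $\mathbf{C}$. If for each $r\in\mathbb{N}$ the set $\operatorname{h}_r(\mathbf{P})$ is semilinear, then $\mathbf{P}$ is uniformly testable on $\mathbf{C}$ in constant time in the $\operatorname{BDRD}_{+/-}$ model.
   Context: A schema $\sigma$ is a finite set of relation names with arities in $\mathbb{N}_{\geq 1}$. A $\sigma$-database $\mathcal{D}$ has a finite domain $D$ (identified with $[n]$, linearly ordered) and a relation $R^{\mathcal{D}}\subseteq D^{\operatorname{ar}(R)}$ for each $R\in\sigma$. The Gaifman graph of $\mathcal{D}$ has vertex set $D$ and an edge between distinct $a,b$ whenever some tuple contains both; distances $\operatorname{dist}_{\mathcal{D}}(a,b)$ and connected components refer to this graph. The degree of an element is the number of tuples (over all relations) containing it; the degree of $\mathcal{D}$ is the maximum over its elements. Classes are closed under isomorphism; a property is an isomorphism-closed class. Hyperfinite: an $(\epsilon,k)$-partition of a database $\mathcal{D}$ on $n$ elements is a database obtained from $\mathcal{D}$ by removing at most $\epsilon n$ tuples such that every connected component has at most $k$ elements. A class $\mathbf{P}\subseteq\mathbf{C}$ is $\rho$-hyperfinite on $\mathbf{C}$ if for every $\epsilon\in(0,1]$ and $\mathcal{D}\in\mathbf{P}$ there is an $(\epsilon,\rho(\epsilon))$-partition of $\mathcal{D}$ lying in $\mathbf{C}$; it is hyperfinite on $\mathbf{C}$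 if it is $\rho$-hyperfinite for some function $\rho$. Neighbourhoods: for $a\in D$, $N_r(a)$ is the set of elements at distance at most $r$ from $a$, and the $r$-neighbourhood of $a$ is $(\mathcal{D}[N_r(a)],a)$ (induced sub-database with distinguished centre $a$). An $r$-type is an isomorphism class (centre-preserving) of $r$-neighbourhoods; there are finitely many, $\operatorname{c}(r)$, $r$-types of degree at most $d$ over $\sigma$. The $r$-histogram $\operatorname{h}_r(\mathcal{D})\in\mathbb{N}^{\operatorname{c}(r)}$ counts, for each $r$-type, the number of elements of that type; $\operatorname{h}_r(\mathbf{P})=\{\operatorname{h}_r(\mathcal{D})\mid\mathcal{D}\in\mathbf{P}\}$. A set $M\subseteq\mathbb{N}^c$ is linear if $M=\{\bar v_0+a_1\bar v_1+\dots+a_k\bar v_k\mid a_i\in\mathbb{N}\}$ for some $\bar v_0,\dots,\bar v_k\in\mathbb{N}^c$, and semilinear if it is a finite union of linear sets. $\operatorname{BDRD}_{+/-}$ distance: $\operatorname{dist}_{+/-}(\mathcal{D},\mathcal{D}')$ is the minimum number of modifications applied to $\mathcal{D}$ and $\mathcal{D}'$ to make them isomorphic, a modification being inserting a new element, deleting an element (with all tuples containing it), inserting a tuple, or deleting a tuple. $\mathcal{D},\mathcal{D}'$ are $\epsilon$-close if $\operatorname{dist}_{+/-}\leq\epsilon d\min\{|D|,|D'|\}$, else $\epsilon$-far; $\mathcal{D}$ is $\epsilon$-far from $\mathbf{P}$ if it is $\epsilon$-far from every member of $\mathbf{P}$. Testing: a tester receives $n=|D|$ and may ask oracle queries $(R,i,j)$,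 answered in constant time by the $j$-th tuple of $R^{\mathcal{D}}$ containing the $i$-th element (or $\bot$). An $\epsilon$-tester for $\mathbf{P}$ on $\mathbf{C}$ is a probabilistic algorithm which on input $\mathcal{D}\in\mathbf{C}$ accepts with probability $\geq 2/3$ if $\mathcal{D}\in\mathbf{P}$ and rejects with probability $\geq 2/3$ if $\mathcal{D}$ is $\epsilon$-far from $\mathbf{P}$. $\mathbf{P}$ is uniformly testable on $\mathbf{C}$ in time $f(n)$ if for every $\epsilon\in(0,1]$ there is such an $\epsilon$-tester, working for all $n$, whose number of oracle queries is bounded independently of $n$ and whose running time on $n$-element inputs is $f(n)$; constant time means $f$ constant. Running time is measured on a RAM with uniform cost. *)

(* Defs.v *)
From HB Require Import structures.
From mathcomp Require Import all_boot all_order all_algebra.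
From mathcomp Require Import reals.

Set Implicit Arguments.
Unset Strict Implicit.
Unset Printing Implicit Defensive.

Import Order.TTheory GRing.Theory Num.Theory.

Section Databases.
Variables (k : nat) (ar : 'I_k -> nat).

Record db := DB {
  dn : nat;
  drel : forall R : 'I_k, {set {ffun 'I_(ar R) -> 'I_dn}}
}.

Definition tmap {m n n' : nat} (f : 'I_n -> 'I_n') (t : {ffun 'I_m -> 'I_n})
  : {ffun 'I_m -> 'I_n'} := [ffun i => f (t i)].

Definition tseq {m n : nat} (t : {ffun 'I_m -> 'I_n}) : seq nat :=
  [seq val (t i) | i <- enum 'I_m].

Definition db_iso (D D' : db) : Prop :=
  exists f : 'I_(dn D) -> 'I_(dn D'), bijective f /\
    forall (R : 'I_k) (t : {ffun 'I_(ar R) -> 'I_(dn D)}),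
      (t \in drel D R) = (tmap f t \in drel D' R).

Definition iso_closed (P : db -> Prop) : Prop :=
  forall D D', db_iso D D' -> P D -> P D'.

Definition elem_deg (D : db) (a : 'I_(dn D)) : nat :=
  \sum_(R < k) #|[set t in drel D R | a \in codom t]|.

Definition degree_le (D : db) (d : nat) : Prop :=
  forall a : 'I_(dn D), elem_deg a <= d.

Definition closed_under_tuple_removal (C : db -> Prop) : Prop :=
  forall (D : db) (S : forall R : 'I_k, {set {ffun 'I_(ar R) -> 'I_(dn D)}}),
    (forall R, S R \subset drel D R) -> C D -> C (@DB (dn D) S).

Definition gadj (D : db) : rel 'I_(dn D) := fun a b =>
  (a != b) && [exists R : 'I_k, exists t in drel D R,
                 (a \in codom t) && (b \in codom t)].

Fixpoint ball (D : db) (r : nat) (a : 'I_(dn D)) : {set 'I_(dn D)} :=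
  match r with
  | 0 => [set a]
  | r'.+1 => ball r' a :|: [set b | [exists c in ball r' a, gadj c b]]
  end.

Definition component (D : db) (a : 'I_(dn D)) : {set 'I_(dn D)} :=
  [set b | connect (@gadj D) a b].

Definition is_partition {R : realType} (D : db)
    (S : forall R : 'I_k, {set {ffun 'I_(ar R) -> 'I_(dn D)}})
    (eps : R) (m : nat) : Prop :=
  (forall Q, S Q \subset drel D Q) /\
  (((\sum_(Q < k) #|drel D Q :\: S Q|)%N)%:R <= eps * (dn D)%:R)%R /\
  (forall a : 'I_(dn D), #|@component (@DB (dn D) S) a| <= m).

Definition hyperfinite_on {R : realType} (C P : db -> Prop) : Prop :=
  exists rho : R -> nat,
    forall eps : R, (0 < eps <= 1)%R ->
      forall D, P D ->
        exists S : forall Q : 'I_k, {set {ffun 'I_(ar Q) -> 'I_(dn D)}},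
          is_partition S eps (rho eps) /\ C (@DB (dn D) S).

(* A rooted database (X, c) represents the r-type of a iff the         *)
(* r-neighbourhood (D[N_r(a)], a) is isomorphic to (X, c) with centre  *)
(* preserved.  Histograms are vectors indexed by rooted databases      *)
(* (coordinate-free version of N^{c(r)}).               *)

Definition rdb := {X : db & 'I_(dn X)}.

Definition nbhd_is (r : nat) (D : db) (a : 'I_(dn D)) (Xc : rdb) : bool :=
  let X := projT1 Xc in
  [exists f : {ffun 'I_(dn X) -> 'I_(dn D)},
    [&& injectiveb f,
        [forall b, (b \in ball r a) == (b \in codom f)],
        f (projT2 Xc) == a &
        [forall Q : 'I_k, forall t : {ffun 'I_(ar Q) -> 'I_(dn X)},
            (t \in drel X Q) == (tmap f t \in drel D Q)]]].

Definition hist (r : nat) (D : db) : rdb -> nat :=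
  fun Xc => #|[set a : 'I_(dn D) | nbhd_is r a Xc]|.

Definition hist_set (r : nat) (P : db -> Prop) : (rdb -> nat) -> Prop :=
  fun h => exists D, P D /\ forall Xc, h Xc = hist r D Xc.

End Databases.

Definition lin_comb {I : Type} (v0 : I -> nat) (vs : seq (I -> nat))
    (coefs : seq nat) : I -> nat :=
  fun x => v0 x + \sum_(p <- zip coefs vs) p.1 * p.2 x.

Definition lin_set {I : Type} (v0 : I -> nat) (vs : seq (I -> nat))
    : (I -> nat) -> Prop :=
  fun h => exists coefs : seq nat, size coefs = size vs /\
                                   forall x, h x = lin_comb v0 vs coefs x.

Definition semilinear_set {I : Type} (M : (I -> nat) -> Prop) : Prop :=
  exists L : seq ((I -> nat) * seq (I -> nat)),
    forall h, M h <-> exists i, i < size L /\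
      let p := nth (fun _ => 0, [::]) L i in lin_set p.1 p.2 h.

Section Distance.
Variables (k : nat) (ar : 'I_k -> nat).

Definition del_elem (D D' : db ar) : Prop :=
  dn D = (dn D').+1 /\
  exists g : 'I_(dn D') -> 'I_(dn D), injective g /\
    forall (R : 'I_k) (t : {ffun 'I_(ar R) -> 'I_(dn D')}),
      (t \in drel D' R) = (tmap g t \in drel D R).

(* deleting one tuple (f is a renaming of the domain, harmless since    *)
(* distance is measured up to isomorphism)                              *)
Definition del_tuple (D D' : db ar) : Prop :=
  exists f : 'I_(dn D) -> 'I_(dn D'), bijective f /\
  exists (R0 : 'I_k) (t0 : {ffun 'I_(ar R0) -> 'I_(dn D)}),
    t0 \in drel D R0 /\
    forall (R : 'I_k) (t : {ffun 'I_(ar R) -> 'I_(dn D)}),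
      (tmap f t \in drel D' R) =
      (t \in drel D R) && ~~ ((R == R0) && (tseq t == tseq t0)).

Definition modif (D D' : db ar) : Prop :=
  del_elem D D' \/ del_tuple D D' \/ del_elem D' D \/ del_tuple D' D.

Fixpoint modifs (m : nat) (D D' : db ar) : Prop :=
  match m with
  | 0 => D = D'
  | m'.+1 => exists D1, modif D D1 /\ modifs m' D1 D'
  end.

Definition dist_le (m : nat) (D D' : db ar) : Prop :=
  exists m1 m2 (D1 D2 : db ar),
    m1 + m2 <= m /\ modifs m1 D D1 /\ modifs m2 D' D2 /\ db_iso D1 D2.

Definition eps_close {R : realType} (eps : R) (d : nat) (D D' : db ar) : Prop :=
  exists m, dist_le m D D' /\
    (m%:R <= eps * d%:R * (minn (dn D) (dn D'))%:R)%R.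

Definition eps_far_from {R : realType} (eps : R) (d : nat) (D : db ar)
    (P : db ar -> Prop) : Prop :=
  forall D', P D' -> ~ eps_close eps d D D'.

End Distance.

(* Testers: probabilistic RAM programs (uniform cost) with oracle       *)

(* Registers are indexed by nat and hold nats.  Register 0 initially   *)
(* holds n, all others 0.                                              *)
Inductive instr :=
| IConst  (dst c : nat)
| IAdd    (dst a b : nat)
| ISub    (dst a b : nat)          (* truncated subtraction *)
| IMul    (dst a b : nat)
| IDiv    (dst a b : nat)          (* x %/ 0 = 0 *)
| ILoad   (dst a : nat)            (* dst := reg[reg a] *)
| IStore  (a src : nat)            (* reg[reg a] := reg src *)
| IJle    (a b target : nat)       (* if reg a <= reg b goto target *)
| IRand   (dst a : nat)            (* dst := uniform in [0, reg a) (0 if reg a = 0) *)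
| IQuery  (rl i j dst : nat)       (* oracle query (reg rl, reg i, reg j); *)
                                   (* dst := 1 and dst+1+l := l-th entry, or dst := 0 for bottom *)
| IAccept
| IReject.

Definition upd (regs : nat -> nat) (r v : nat) : nat -> nat :=
  fun x => if x == r then v else regs x.

Fixpoint write_seq (s : seq nat) (base : nat) (regs : nat -> nat) : nat -> nat :=
  match s with
  | [::] => regs
  | v :: s' => write_seq s' base.+1 (upd regs base v)
  end.

Section RAM.
Variables (k : nat) (ar : 'I_k -> nat).

(* An adjacency-list representation of D: for each relation R and      *)
(* element a, the list of the tuples of R containing a (in some order). *)
Definition reprT (D : db ar) :=
  forall R : 'I_k, 'I_(dn D) -> seq {ffun 'I_(ar R) -> 'I_(dn D)}.

Definition valid_repr (D : db ar) (rep : reprT D) : Prop :=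
  forall (R : 'I_k) (a : 'I_(dn D)),
    uniq (rep R a) /\
    forall t, (t \in rep R a) = (t \in drel D R) && (a \in codom t).

(* answer to oracle query (rl, i, j): the j-th tuple (0-based) of       *)
(* relation rl containing the i-th element (0-based), or None (bottom)  *)
Definition oracle (D : db ar) (rep : reprT D) (rl i j : nat) : option (seq nat) :=
  match @insub _ (fun x => x < k) 'I_k rl with
  | Some R =>
      match @insub _ (fun x => x < dn D) 'I_(dn D) i with
      | Some a => omap (@tseq _ _) (ohead (drop j (rep R a)))
      | None => None
      end
  | None => None
  end.

Definition write_answer (ans : option (seq nat)) (dst : nat) (regs : nat -> nat) :=
  match ans with
  | Some s => upd (write_seq s dst.+1 regs) dst 1
  | None => upd regs dst 0
  end.

Variables (prog : seq instr) (D : db ar) (rep : reprT D).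

Fixpoint acc_prob {R : realType} (fuel pc : nat) (regs : nat -> nat) : R :=
  match fuel with
  | 0 => 0%R
  | f.+1 =>
    match nth IReject prog pc with
    | IConst dst c => acc_prob f pc.+1 (upd regs dst c)
    | IAdd dst a b => acc_prob f pc.+1 (upd regs dst (regs a + regs b))
    | ISub dst a b => acc_prob f pc.+1 (upd regs dst (regs a - regs b))
    | IMul dst a b => acc_prob f pc.+1 (upd regs dst (regs a * regs b))
    | IDiv dst a b => acc_prob f pc.+1 (upd regs dst (regs a %/ regs b))
    | ILoad dst a => acc_prob f pc.+1 (upd regs dst (regs (regs a)))
    | IStore a src => acc_prob f pc.+1 (upd regs (regs a) (regs src))
    | IJle a b tg => acc_prob f (if regs a <= regs b then tg else pc.+1) regs
    | IRand dst a =>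
        if regs a is 0 then acc_prob f pc.+1 (upd regs dst 0)
        else ((\sum_(x < regs a) acc_prob f pc.+1 (upd regs dst x)) / (regs a)%:R)%R
    | IQuery rl i j dst =>
        acc_prob f pc.+1 (write_answer (oracle rep (regs rl) (regs i) (regs j)) dst regs)
    | IAccept => 1%R
    | IReject => 0%R
    end
  end.

(* every run halts (reaches IAccept / IReject, or leaves the program)   *)
(* within fuel steps, whatever the random choices                      *)
Fixpoint halts (fuel pc : nat) (regs : nat -> nat) : bool :=
  match fuel with
  | 0 => false
  | f.+1 =>
    match nth IReject prog pc with
    | IConst dst c => halts f pc.+1 (upd regs dst c)
    | IAdd dst a b => halts f pc.+1 (upd regs dst (regs a + regs b))
    | ISub dst a b => halts f pc.+1 (upd regs dst (regs a - regs b))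
    | IMul dst a b => halts f pc.+1 (upd regs dst (regs a * regs b))
    | IDiv dst a b => halts f pc.+1 (upd regs dst (regs a %/ regs b))
    | ILoad dst a => halts f pc.+1 (upd regs dst (regs (regs a)))
    | IStore a src => halts f pc.+1 (upd regs (regs a) (regs src))
    | IJle a b tg => halts f (if regs a <= regs b then tg else pc.+1) regs
    | IRand dst a =>
        if regs a is 0 then halts f pc.+1 (upd regs dst 0)
        else [forall x : 'I_(regs a), halts f pc.+1 (upd regs dst x)]
    | IQuery rl i j dst =>
        halts f pc.+1 (write_answer (oracle rep (regs rl) (regs i) (regs j)) dst regs)
    | IAccept => true
    | IReject => true
    end
  end.

Definition init_regs : nat -> nat := fun x => if x == 0 then dn D else 0.

End RAM.

Definition const_time_tester {R : realType} (k : nat) (ar : 'I_k -> nat)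
    (d : nat) (C P : db ar -> Prop) (eps : R) (prog : seq instr) (T : nat) : Prop :=
  forall (D : db ar) (rep : reprT D), C D -> valid_repr rep ->
    halts prog rep T 0 (init_regs D) /\
    (P D -> (2 / 3 <= acc_prob (R := R) prog rep T 0 (init_regs D))%R) /\
    (eps_far_from eps d D P -> (acc_prob (R := R) prog rep T 0 (init_regs D) <= 1 / 3)%R).

Definition uniformly_testable_const_time {R : realType} (k : nat)
    (ar : 'I_k -> nat) (d : nat) (C P : db ar -> Prop) : Prop :=
  forall eps : R, (0 < eps <= 1)%R ->
    exists (prog : seq instr) (T : nat), const_time_tester d C P eps prog T.

(* Main.v *)
Require Import Defs.
From HB Require Import structures.
From mathcomp Require Import all_boot all_order all_algebra.
From mathcomp Require Import boolp reals.
From mathcomp Require Import zify ring lra.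

Set Implicit Arguments.
Unset Strict Implicit.
Unset Printing Implicit Defensive.
Import Order.TTheory GRing.Theory Num.Theory.

(* Key point (locality): if D is in P, D' has degree at most d and is large, and the r-histograms of
   D and D' are proportionally close for suitable r, then D' is close to D. Hyperfiniteness gives a
   partition of D into small components cutting few tuples. Replacing it by the proportion of
   components among the small sets with the same R-neighbourhood gives weights that depend on local
   data only; increasing R increases an energy bounded by the size of D, so for some bounded R the
   weights almost cover every element exactly once, and then they do so on D' as well. Rounding
   greedily by a potential argument yields a partition of D' into small pieces cutting few tuples. A
   second, finer fractional partition, with components large compared to these pieces, tells how to
   cut components of D into copies of the pieces of D', so that almost all the pieces of D' are
   matched and D can be edited into D' cheaply.

   The tester samples elements and looks at their r-types. If the sampled frequencies fit a member
   of P of some size at least N then, by rounding down the scaled coefficients of a linear set, they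
   fit a member of P of every size at least N; so the decision depends only on the sampled types and
   not on n. Databases with fewer than N elements are read completely. The program records the
   answers to all queries up to a bounded depth, and the outcome of all comparisons between the
   registers determines the decision. *)

(** * Neighbourhoods and their codes *)

(** The partition of [D] given by hyperfiniteness is not a function of local data, whereas [D'] is
    known only through its histogram; averaging over codes makes the two comparable. The rounding on
    [D'] is greedy and hence not local: nothing is known about how often each kind of piece occurs
    in [D'], so its pieces cannot be matched with the components of the first partition of [D]. The
    weights of the second partition repair this. Their sets in [D'] have so little boundary that
    almost every piece lies whole in sets of total weight close to 1; the numbers of pieces
    contained are attached to these sets as colours and carried back to [D]. This fixes the order of
    the constants: the piece size [B1], then the second cutting rate [e2], because an unmatched
    piece costs about [(d + 1) * B1] edits on each side, then the component size [K2], the constant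
    [L] and the accuracy [h2]. On the algorithmic side the decision is defined classically: only
    finitely many comparison patterns exist, so the verdicts can be hard-wired into the program. *)

Section Db.
Variables (k : nat) (ar : 'I_k -> nat).

Definition tupT n := {Q : 'I_k & {ffun 'I_(ar Q) -> 'I_n}}.
Definition tups (D : db ar) : {set tupT (dn D)} :=
  [set t | tagged t \in drel D (tag t)].
Definition ent n (t : tupT n) : {set 'I_n} := [set x | x \in codom (tagged t)].
Definition tmapT n n' (f : 'I_n -> 'I_n') (t : tupT n) : tupT n' :=
  Tagged (fun Q => {ffun 'I_(ar Q) -> 'I_n'}) (tmap f (tagged t)).

Lemma entP n (t : tupT n) x : reflect (exists i, x = tagged t i) (x \in ent t).
Proof. by rewrite inE; exact: codomP. Qed.

Lemma ent_map n n' (f : 'I_n -> 'I_n') (t : tupT n) :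
  ent (tmapT f t) = f @: ent t.
Proof.
apply/setP=> y; apply/entP/imsetP => [[i ->]|[x /entP[i ->] ->]].
  by exists (tagged t i); [apply/entP; exists i | rewrite /= ffunE].
by exists i; rewrite /= ffunE.
Qed.

Lemma tmapT_id n n' (f : 'I_n -> 'I_n') (g : 'I_n' -> 'I_n) (t : tupT n) :
  {in ent t, cancel f g} -> tmapT g (tmapT f t) = t.
Proof.
case: t => Q t H; rewrite /tmapT /=; congr existT.
by apply/ffunP=> i; rewrite !ffunE H //; apply/entP; exists i.
Qed.

Lemma tmapT_eq n n' (f g : 'I_n -> 'I_n') (t : tupT n) :
  {in ent t, f =1 g} -> tmapT f t = tmapT g t.
Proof.
case: t => Q t H; rewrite /tmapT /=; congr existT.
by apply/ffunP=> i; rewrite !ffunE H //; apply/entP; exists i.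
Qed.

Lemma tmapT_comp n n' n'' (f : 'I_n -> 'I_n') (g : 'I_n' -> 'I_n'') (t : tupT n) :
  tmapT g (tmapT f t) = tmapT (g \o f) t.
Proof.
case: t => Q t; rewrite /tmapT /=; congr existT.
by apply/ffunP=> i; rewrite !ffunE.
Qed.

Lemma gadjE (D : db ar) (a b : 'I_(dn D)) :
  gadj a b = (a != b) && [exists t in tups D, (a \in ent t) && (b \in ent t)].
Proof.
rewrite /gadj; congr (_ && _); apply/existsP/existsP.
  case=> Q /existsP[t /and3P[H1 H2 H3]].
  by exists (Tagged (fun Q => {ffun 'I_(ar Q) -> _}) t); rewrite !inE /= H1 H2.
case=> [[Q t]]; rewrite !inE /= => /and3P[H1 H2 H3].
by exists Q; apply/existsP; exists t; rewrite H1 H2.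
Qed.

Lemma gadjP (D : db ar) (a b : 'I_(dn D)) :
  reflect (a <> b /\ exists t, [/\ t \in tups D, a \in ent t & b \in ent t]) (gadj a b).
Proof.
rewrite gadjE; apply: (iffP andP).
  by case=> /eqP H /existsP[t /and3P[? ? ?]]; split=> //; exists t.
by case=> /eqP H [t [? ? ?]]; split=> //; apply/existsP; exists t; apply/and3P.
Qed.

Lemma gadj_sym (D : db ar) : symmetric (@gadj k ar D).
Proof.
move=> a b; apply/gadjP/gadjP; case=> H [t [? ? ?]];
by split; [exact: nesym | exists t].
Qed.

Lemma elem_degE (D : db ar) (a : 'I_(dn D)) :
  elem_deg a = #|[set t in tups D | a \in ent t]|.
Proof.
rewrite /elem_deg -sum1_card.
under [LHS]eq_bigr do rewrite -sum1_card.
rewrite (sig_big_dep _ _ (fun=> fun=> 1%N)) /=.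
by apply: eq_bigl => -[Q t]; rewrite !inE.
Qed.

Lemma card_tups (D : db ar) : #|tups D| = (\sum_(Q < k) #|drel D Q|)%N.
Proof.
rewrite -sum1_card; under [RHS]eq_bigr => Q _ do rewrite -sum1_card.
rewrite (sig_big_dep _ _ (fun=> fun=> 1%N)) /=.
by apply: eq_bigl => -[Q t]; rewrite !inE.
Qed.

Definition nb (D : db ar) r (S : {set 'I_(dn D)}) : {set 'I_(dn D)} :=
  \bigcup_(x in S) ball r x.

Section Balls.
Variable (D : db ar).
Implicit Types (x y z : 'I_(dn D)) (S T : {set 'I_(dn D)}).

Lemma ballSP r x y :
  reflect (y \in ball r x \/ exists2 c, c \in ball r x & gadj c y) (y \in ball r.+1 x).
Proof.
rewrite /= !inE; apply: (iffP orP); case=> H; [by left| |by left|].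
  by move: H => /existsP[c /andP[H1 H2]]; right; exists c.
by case: H => c H1 H2; right; apply/existsP; exists c; rewrite H1.
Qed.

Lemma ball_id r x : x \in ball r x.
Proof. by elim: r => [|r IH]; [rewrite inE | apply/ballSP; left]. Qed.

Lemma ball_trans r s x y z : y \in ball r x -> z \in ball s y -> z \in ball (r + s) x.
Proof.
move=> Hy; elim: s z => [|s IH] z; first by rewrite inE addn0 => /eqP ->.
rewrite addnS; case/ballSP => [/IH H|[c /IH H1 H2]]; apply/ballSP; first by left.
by right; exists c.
Qed.

Lemma ball_mono r s x : r <= s -> ball r x \subset ball s x.
Proof.
move=> /subnKC <-; apply/subsetP=> y Hy; apply: ball_trans Hy _; exact: ball_id.
Qed.

Lemma ball_adj r x y : gadj x y -> y \in ball r.+1 x.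
Proof. by move=> H; apply/ballSP; right; exists x; rewrite ?ball_id. Qed.

Lemma ball_tup r x y z t :
  y \in ball r x -> t \in tups D -> y \in ent t -> z \in ent t -> z \in ball r.+1 x.
Proof.
move=> H1 H2 H3 H4; case: (y =P z) => [<-|E]; apply/ballSP; first by left.
by right; exists y => //; apply/gadjP; split=> //; exists t.
Qed.

Lemma nbP r S y : reflect (exists2 x, x \in S & y \in ball r x) (y \in nb r S).
Proof. exact: bigcupP. Qed.

Lemma nb0 S : nb 0 S = S.
Proof.
apply/setP=> y; apply/nbP/idP => [[x H]|H]; first by rewrite inE => /eqP->.
by exists y; rewrite ?ball_id.
Qed.

Lemma nb1 r x : nb r [set x] = ball r x.
Proof. by rewrite /nb big_set1. Qed.

Lemma nb_mono r s S : r <= s -> nb r S \subset nb s S.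
Proof.
move=> H; apply/subsetP => y /nbP[x Hx Hy]; apply/nbP; exists x => //.
exact: (subsetP (ball_mono _ H)).
Qed.

Lemma nb_ball r s S x y : x \in nb s S -> y \in ball r x -> y \in nb (s + r) S.
Proof.
by move=> /nbP[z Hz Hx] Hy; apply/nbP; exists z => //; apply: ball_trans Hy.
Qed.

Lemma nb_tup r S y z t :
  y \in nb r S -> t \in tups D -> y \in ent t -> z \in ent t -> z \in nb r.+1 S.
Proof.
by move=> /nbP[x Hx Hy] H1 H2 H3; apply/nbP; exists x => //; apply: (ball_tup Hy H1 H2).
Qed.

Lemma nbS r S y : y \in nb r.+1 S -> y \in nb r S \/ exists2 c, c \in nb r S & gadj c y.
Proof.
move=> /nbP[x Hx /ballSP[H|[c H1 H2]]]; first by left; apply/nbP; exists x.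
by right; exists c => //; apply/nbP; exists x.
Qed.

Lemma sub_nb r S : S \subset nb r S.
Proof. by rewrite -{1}(nb0 S); apply: nb_mono. Qed.

Lemma nb_sub r s S T : T \subset nb s S -> nb r T \subset nb (s + r) S.
Proof.
move=> /subsetP H; apply/subsetP=> y /nbP[x /H Hx Hy]; exact: nb_ball Hx Hy.
Qed.
End Balls.

(* The two maps are only meaningful on the neighbourhoods; they are total so that
   inverses and restrictions need no partial functions. *)
Record nbhd_iso r (D D' : db ar) (S : {set 'I_(dn D)}) (S' : {set 'I_(dn D')})
    (f : 'I_(dn D) -> 'I_(dn D')) (g : 'I_(dn D') -> 'I_(dn D)) : Prop := NbhdIso {
  nbhd_iso_fwd : {in nb r S, forall x, f x \in nb r S' /\ g (f x) = x};
  nbhd_iso_bwd : {in nb r S', forall y, g y \in nb r S /\ f (g y) = y};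
  nbhd_iso_set : {in nb r S, forall x, (f x \in S') = (x \in S)};
  nbhd_iso_tup : forall t : tupT (dn D), ent t \subset nb r S ->
             (t \in tups D) = (tmapT f t \in tups D')
}.

Lemma nbhd_iso_sym r D D' S S' f g : @nbhd_iso r D D' S S' f g -> nbhd_iso r S' S g f.
Proof.
case=> F B E T; split=> //.
- by move=> y /B[H1 H2]; rewrite -(E _ H1) H2.
- move=> t Ht.
  have H : {in ent t, cancel g f} by move=> y /(subsetP Ht)/B[].
  rewrite T ?tmapT_id // ent_map; apply/subsetP=> x /imsetP[y /(subsetP Ht)/B[? _] ->] //.
Qed.

(** The strict inequality leaves one unit of radius: a tuple through a point of [nb m S] stays in
    [nb m.+1 S], so the isomorphism sees all of it. *)
Lemma nbhd_iso_adj r D D' S S' f g m x y : @nbhd_iso r D D' S S' f g ->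
  m < r -> x \in nb m S -> gadj x y -> gadj (f x) (f y).
Proof.
case=> F B E T mr Hx /gadjP[xy [t [H1 H2 H3]]].
have Ht : ent t \subset nb r S.
  apply/subsetP=> z Hz; apply: (subsetP (nb_mono _ mr)).
  exact: nb_tup Hx H1 H2 Hz.
apply/gadjP; split.
  move=> fxy; case: (F x (subsetP Ht _ H2)) => _ Ex.
  by case: (F y (subsetP Ht _ H3)) => _ Ey; apply: xy; rewrite -Ex fxy.
exists (tmapT f t); split; first by rewrite -T.
  by rewrite ent_map imset_f.
by rewrite ent_map imset_f.
Qed.

Lemma nbhd_iso_nb r D D' S S' f g m x : @nbhd_iso r D D' S S' f g ->
  m <= r -> x \in nb m S -> f x \in nb m S'.
Proof.
move=> L; elim: m x => [|m IH] x mr.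
  by rewrite !nb0 => Hx; rewrite (nbhd_iso_set L) // (subsetP (sub_nb r S)).
move/nbS => [H|[c H1 H2]].
  apply: (subsetP (nb_mono _ (leqnSn m))); apply: IH => //; exact: ltnW.
rewrite -addn1; apply: (nb_ball (x := f c)); first exact: IH (ltnW mr) H1.
exact: ball_adj (nbhd_iso_adj L mr H1 H2).
Qed.

Lemma nbhd_iso_ball r D D' S S' f g s m x y : @nbhd_iso r D D' S S' f g ->
  s + m <= r -> x \in nb s S -> y \in ball m x -> f y \in ball m (f x).
Proof.
move=> L; elim: m y => [|m IH] y mr Hx; first by rewrite !inE => /eqP->.
have mr' : s + m < r by rewrite -addnS.
case/ballSP => [H|[c H1 H2]]; apply/ballSP; first by left; apply: IH (ltnW mr') Hx H.
right; exists (f c); first exact: IH (ltnW mr') Hx H1.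
exact: nbhd_iso_adj L mr' (nb_ball Hx H1) H2.
Qed.

(** Reaching [T] from [S] uses up radius [s]; the remaining [r] is available around [T]. *)
Lemma nbhd_iso_sub r s D D' S S' f g (T : {set 'I_(dn D)}) : @nbhd_iso (s + r) D D' S S' f g ->
  T \subset nb s S -> nbhd_iso r T (f @: T) f g.
Proof.
move=> L TS; have L' := nbhd_iso_sym L.
have sr : s <= s + r by exact: leq_addr.
have sub : nb r T \subset nb (s + r) S := nb_sub r TS.
have TS' : f @: T \subset nb s S'.
  by apply/subsetP=> y /imsetP[x Hx ->]; apply: nbhd_iso_nb L sr _; apply: (subsetP TS).
have sub' : nb r (f @: T) \subset nb (s + r) S' := nb_sub r TS'.
have key x : x \in T -> x \in nb s S by move/(subsetP TS).
split.
- move=> x Hx; have [_ E] := nbhd_iso_fwd L (subsetP sub _ Hx); split=> //.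
  case/nbP: Hx => z Hz Hx; apply/nbP; exists (f z); first exact: imset_f.
  exact: nbhd_iso_ball L (leqnn _) (key _ Hz) Hx.
- move=> y Hy; have [_ E] := nbhd_iso_bwd L (subsetP sub' _ Hy); split=> //.
  case/nbP: Hy => z' /imsetP[z Hz ->] Hy; apply/nbP; exists z => //.
  have Hfz : f z \in nb s S' by apply: (subsetP TS'); exact: imset_f.
  have := nbhd_iso_ball L' (leqnn _) Hfz Hy.
  by have [_ ->] := nbhd_iso_fwd L (subsetP (nb_mono _ sr) _ (key _ Hz)).
- move=> x Hx; apply/imsetP/idP => [[z Hz E]|H]; last by exists x.
  have [_ Ex] := nbhd_iso_fwd L (subsetP sub _ Hx).
  have [_ Ez] := nbhd_iso_fwd L (subsetP (nb_mono _ sr) _ (key _ Hz)).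
  by rewrite -Ex E Ez.
- by move=> t Ht; apply: (nbhd_iso_tup L); apply: subset_trans sub.
Qed.

Lemma nbhd_iso_image r D D' S S' f g : @nbhd_iso r D D' S S' f g -> f @: S = S'.
Proof.
move=> L; apply/setP=> y; apply/imsetP/idP => [[x Hx ->]|Hy].
  by rewrite (nbhd_iso_set L) // (subsetP (sub_nb _ _)).
have [H1 H2] := nbhd_iso_bwd L (subsetP (sub_nb _ _) _ Hy).
by exists (g y); rewrite // -(nbhd_iso_set L) ?H2.
Qed.

Lemma nbhd_iso_le r r' D D' S S' f g : @nbhd_iso r' D D' S S' f g -> r <= r' -> nbhd_iso r S S' f g.
Proof.
move=> L rr; rewrite -(nbhd_iso_image L); apply: (@nbhd_iso_sub r (r' - r) _ _ S S').
  by rewrite subnK.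
exact: sub_nb.
Qed.

(* A code is a neighbourhood with a marked subset, laid out on an initial segment. As [xchoose]
   depends only on the extension of its predicate, [canon] takes equal values on isomorphic
   neighbourhoods. *)
Definition Code := {m : nat & ({set tupT m} * {set 'I_m})%type}.
Definition code_tups (c : Code) : {set tupT (tag c)} := fst (projT2 c).
Definition code_set (c : Code) : {set 'I_(tag c)} := snd (projT2 c).

Definition is_code r (D : db ar) (S : {set 'I_(dn D)}) (c : Code) : bool :=
  [exists f : {ffun 'I_(tag c) -> 'I_(dn D)},
    [&& injectiveb f, [forall x, (x \in nb r S) == (x \in codom f)],
        [forall i, (f i \in S) == (i \in code_set c)] &
        [forall t, (t \in code_tups c) == (tmapT f t \in tups D)]]].

Lemma is_codeP r D S c : reflect (exists f : 'I_(tag c) -> 'I_(dn D),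
  [/\ injective f, forall x, (x \in nb r S) = (x \in codom f),
      forall i, (f i \in S) = (i \in code_set c) &
      forall t, (t \in code_tups c) = (tmapT f t \in tups D)]) (@is_code r D S c).
Proof.
apply: (iffP existsP).
  case=> f /and4P[/injectiveP H1 /forallP H2 /forallP H3 /forallP H4].
  by exists f; split=> // [x|i|t]; apply/eqP.
case=> f [H1 H2 H3 H4]; exists (finfun f); apply/and4P; split.
- by apply/injectiveP=> x y; rewrite !ffunE; apply: H1.
- apply/forallP=> x; rewrite H2; apply/eqP; apply/idP/idP => /codomP[i ->];
  by apply/codomP; exists i; rewrite ffunE.
- by apply/forallP=> i; rewrite ffunE H3.
- apply/forallP=> t; rewrite H4; apply/eqP; suff -> : tmapT (finfun f) t = tmapT f t by [].
  by apply: tmapT_eq => x _; rewrite ffunE.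
Qed.

Lemma is_code_ex r D S : exists c, @is_code r D S c.
Proof.
pose f (i : 'I_#|nb r S|) := enum_val i.
exists (Tagged (fun m => ({set tupT m} * {set 'I_m})%type)
   ([set t | tmapT f t \in tups D], [set i | f i \in S])).
apply/is_codeP; exists f; split=> [|x|i|t]; rewrite ?inE //.
- exact: enum_val_inj.
- apply/idP/codomP => [Hx|[i ->]]; last exact: enum_valP.
  by exists (enum_rank_in Hx x); rewrite /f enum_rankK_in.
Qed.

Definition canon r D S : Code := xchoose (@is_code_ex r D S).

Lemma canonP r D S : @is_code r D S (canon r S).
Proof. exact: xchooseP. Qed.

Lemma nbhd_iso_is_code r D D' S S' f g c : @nbhd_iso r D D' S S' f g ->
  is_code r S c -> is_code r S' c.
Proof.
move=> L /is_codeP[e [H1 H2 H3 H4]]; apply/is_codeP; exists (f \o e).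
have He i : e i \in nb r S by rewrite H2 codom_f.
split.
- by move=> i j /= E; apply: H1; case: (nbhd_iso_fwd L (He i)) => _ <-;
   case: (nbhd_iso_fwd L (He j)) => _ <-; rewrite E.
- move=> y; apply/idP/codomP => [Hy|[i ->]]; last by case: (nbhd_iso_fwd L (He i)).
  case: (nbhd_iso_bwd L Hy) => H E; move: H; rewrite H2 => /codomP[i Ei].
  by exists i; rewrite /= -Ei E.
- by move=> i /=; rewrite (nbhd_iso_set L).
- move=> t; rewrite H4 (nbhd_iso_tup L) ?tmapT_comp //.
  by rewrite ent_map; apply/subsetP=> x /imsetP[i _ ->].
Qed.

Lemma nbhd_iso_canon r D D' S S' f g : @nbhd_iso r D D' S S' f g -> canon r S = canon r S'.
Proof.
move=> L; apply: eq_xchoose => c; apply/idP/idP; first exact: nbhd_iso_is_code L.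
exact: nbhd_iso_is_code (nbhd_iso_sym L).
Qed.

Lemma is_code_nbhd_iso r D D' S S' c : @is_code r D S c -> @is_code r D' S' c -> S != set0 ->
  exists f g, nbhd_iso r S S' f g.
Proof.
move=> /is_codeP[e [H1 H2 H3 H4]] /is_codeP[e' [H1' H2' H3' H4']] /set0Pn[x0 Hx0].
have : x0 \in nb r S by rewrite (subsetP (sub_nb _ _)).
rewrite H2 => /codomP[i0 _].
(* [i0] only makes the inverses of [e] and [e'] total; it exists because [S] is non-empty. *)
pose f x := e' (odflt i0 [pick i | e i == x]).
pose g y := e (odflt i0 [pick i | e' i == y]).
have fe i : f (e i) = e' i.
  by rewrite /f; case: pickP => [j /eqP/H1 -> //|/(_ i)]; rewrite eqxx.
have ge i : g (e' i) = e i.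
  by rewrite /g; case: pickP => [j /eqP/H1' -> //|/(_ i)]; rewrite eqxx.
exists f, g; split.
- by move=> x; rewrite H2 => /codomP[i ->]; rewrite fe ge H2' codom_f.
- by move=> x; rewrite H2' => /codomP[i ->]; rewrite ge fe H2 codom_f.
- by move=> x; rewrite H2 => /codomP[i ->]; rewrite fe H3 H3'.
- move=> t Ht.
  pose u := tmapT (fun x => odflt i0 [pick i | e i == x]) t.
  have Eu : tmapT e u = t.
    rewrite /u; apply: tmapT_id => x /(subsetP Ht); rewrite H2 => /codomP[i ->].
    by case: pickP => [j /eqP/= ->//|/(_ i)]; rewrite eqxx.
  rewrite -Eu -H4 H4'; suff -> : tmapT e' u = tmapT f (tmapT e u) by [].
  by rewrite tmapT_comp; apply: tmapT_eq => i _ /=; rewrite fe.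
Qed.

Lemma canon_nbhd_iso r D D' S S' : canon r S = @canon r D' S' -> S != set0 ->
  exists f g, @nbhd_iso r D D' S S' f g.
Proof.
by move=> E; apply: is_code_nbhd_iso (canonP r S) _; rewrite E; exact: canonP.
Qed.

Lemma canon_le r r' D D' S S' : r <= r' -> S != set0 ->
  canon r' S = @canon r' D' S' -> @canon r D S = canon r S'.
Proof.
by move=> rr H /canon_nbhd_iso/(_ H)[f [g L]]; apply: nbhd_iso_canon (nbhd_iso_le L rr).
Qed.

End Db.

Local Open Scope ring_scope.

(** * Averaging and rounding *)

Section Averages.
Variables (F : realFieldType) (X : finType) (A : {set X}) (f : X -> F).

(** Conditional expectation of [f] given [c], for the counting measure on [A]. On a value that [c]
    does not take in [A] it is [0 / 0], that is 0. *)
Definition avg (T : eqType) (c : X -> T) (y : T) : F :=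
  (\sum_(x in A | c x == y) f x) / #|[set x in A | c x == y]|%:R.

(** Self-adjointness of the conditional expectation: each fibre of [c] contributes its size times
    its mean times the common value of [h]. *)
Lemma avg_mul (T : eqType) (c : X -> T) (h : X -> F) :
  {in A &, forall x y, c x = c y -> h x = h y} ->
  \sum_(x in A) avg c (c x) * h x = \sum_(x in A) f x * h x.
Proof.
move=> H; rewrite /avg.
under eq_bigr => x _ do rewrite mulrAC mulr_suml mulr_suml.
rewrite (exchange_big_dep (mem A)) /=; last by move=> x y _ /andP[].
apply: eq_bigr => y yA.
rewrite (eq_bigr (fun=> f y * h y / #|[set x in A | c x == c y]|%:R)); last first.
  move=> x /andP[xA /andP[_ /eqP E]]; rewrite (H _ _ yA xA E).
  by rewrite E.
rewrite (eq_bigl (mem [set x in A | c x == c y])); last first.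
  by move=> x; rewrite !inE yA eq_sym.
rewrite sumr_const -[X in X = _]mulr_natr divfK // pnatr_eq0 -lt0n.
by apply/card_gt0P; exists y; rewrite inE yA eqxx.
Qed.

Hypothesis f01 : forall x, 0 <= f x <= 1.

Lemma avg_ge0 (T : eqType) (c : X -> T) y : 0 <= avg c y.
Proof.
by rewrite divr_ge0 // sumr_ge0 // => x _; case/andP: (f01 x).
Qed.

Lemma avg_le1 (T : eqType) (c : X -> T) y : avg c y <= 1.
Proof.
rewrite /avg; case: (posnP #|[set x in A | c x == y]|) => [->|H].
  by rewrite invr0 mulr0.
rewrite ler_pdivrMr ?ltr0n // mul1r -sumr_const.
rewrite [X in _ <= X](eq_bigl (fun x => (x \in A) && (c x == y))); last by move=> x; rewrite inE.
by apply: ler_sum => x _; case/andP: (f01 x).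
Qed.

(* Refining the partition increases the energy [\sum b ^+ 2], which stays below [\sum f]. *)
Lemma avg_energy (T : eqType) (c : nat -> X -> T) (J : nat) :
  (forall i, {in A &, forall x y, c i.+1 x = c i.+1 y -> c i x = c i y}) ->
  (0 < J)%N ->
  exists2 i, (i < J)%N &
   J%:R * \sum_(x in A) (avg (c i.+1) (c i.+1 x) - avg (c i) (c i x)) ^+ 2 <= \sum_(x in A) f x.
Proof.
move=> Href J0; pose b i x := avg (c i) (c i x).
pose e i := \sum_(x in A) b i x ^+ 2.
(* Pythagoras: [H1] and [H2] turn the cross term into the energy at stage [i], so the squared
   increments sum to the gain in energy. *)
have step i : \sum_(x in A) (b i.+1 x - b i x) ^+ 2 = e i.+1 - e i.
  have H1 : \sum_(x in A) b i.+1 x * b i x = \sum_(x in A) f x * b i x.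
    by apply: avg_mul => x y xA yA E; rewrite /b (Href _ x y).
  have H2 : \sum_(x in A) b i x * b i x = \sum_(x in A) f x * b i x.
    by apply: avg_mul => x y xA yA E; rewrite /b E.
  rewrite (eq_bigr (fun x => b i.+1 x ^+ 2 - (b i.+1 x * b i x) *+ 2 + b i x ^+ 2)); last first.
    by move=> x _; rewrite sqrrB.
  rewrite big_split sumrB /= -/(e i.+1) -/(e i) sumrMnl H1 -H2.
  have -> : \sum_(x in A) b i x * b i x = e i by apply: eq_bigr => x _; rewrite expr2.
  ring.
have eJ : e J <= \sum_(x in A) f x.
  have -> : e J = \sum_(x in A) f x * b J x.
    rewrite -(avg_mul (c := c J)); last by move=> x y xA yA E; rewrite /b E.
    by apply: eq_bigr => x _; rewrite expr2.
  apply: ler_sum => x _; rewrite ler_piMr ?avg_le1 //; by case/andP: (f01 x).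
have e0 : 0 <= e 0 by apply: sumr_ge0 => x _; rewrite sqr_ge0.
have tel : \sum_(i < J) (e i.+1 - e i) = e J - e 0.
  by rewrite -(big_mkord xpredT (fun i => e i.+1 - e i)) telescope_sumr.
(* If all [J] gains were too large, their telescoping sum would exceed the bound on the energy. *)
apply/exists2P; apply: contrapT => Hn.
have Hlt (i : 'I_J) : (\sum_(x in A) f x) / J%:R < e i.+1 - e i.
  rewrite ltNge; apply/negP=> Hi; apply: Hn; exists i; split=> //.
  by rewrite step mulrC -ler_pdivlMr ?ltr0n.
have : \sum_(i < J) ((\sum_(x in A) f x) / J%:R) < e J - e 0.
  rewrite -tel; apply: ltr_sum; last by move=> i _; apply: Hlt.
  by apply/hasP; exists (Ordinal J0); rewrite ?mem_index_enum.
rewrite sumr_const card_ord -[X in X < _]mulr_natr divfK ?pnatr_eq0 -?lt0n //.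
by move: eJ e0; lra.
Qed.
End Averages.

(** * Greedy rounding of a fractional cover into a partition *)

Section Rounding.
Variables (F : realFieldType) (V E : finType) (en : E -> {set V}) (ts : {set E}).

Definition crosses (S : {set V}) (t : E) :=
  (en t :&: S != set0) && ~~ (en t \subset S).

Variable w : {set V} -> F.
Hypothesis w0 : forall S, 0 <= w S.
Hypothesis wcov : forall v, 1 <= \sum_(S : {set V} | v \in S) w S.
Hypothesis en0 : forall t, en t != set0.

Let cut (S U : {set V}) : F := \sum_(t in ts | (en t \subset U) && crosses S t) 1.
(** Weighted number of cuts inside [U]: the budget from which the tuples cut by later removals are
    paid. *)
Let pot (U : {set V}) : F := \sum_S w S * cut S U.

(* If all sets were removed at once with weights [w], the decrease of the potential would pay for
   all the tuples cut; hence some single set pays for the tuples it cuts. *)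
Lemma rounding_step U : U != set0 ->
  exists S, [/\ 0 < w S, S :&: U != set0 & cut S U + pot (U :\: S) <= pot U].
Proof.
move=> /set0Pn[v vU].
pose Q S := (0 < w S) && (S :&: U != set0).
have [S0 QS0] : exists S0, Q S0.
  apply: contrapT => Hn; suff : \sum_(S : {set V} | v \in S) w S = 0.
    by move=> H; move: (wcov v); rewrite H ler10.
  apply: big1 => S vS; apply/eqP; apply: contraT => Hw; case: Hn; exists S.
  rewrite /Q lt_def Hw w0 /=; apply/set0Pn; exists v; by rewrite inE vS.
pose G S := pot U - pot (U :\: S) - cut S U.
have potE U' : pot U' = \sum_S' \sum_(t in ts | (en t \subset U') && crosses S' t) w S'.
  by apply: eq_bigr => S' _; rewrite mulr_sumr; under eq_bigr do rewrite mulr1.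
(* Removing [S] from [U] takes out of the potential exactly the tuples inside [U] that meet [S]. *)
have diff S : pot U - pot (U :\: S) = \sum_S' \sum_(t in ts | (en t \subset U) && crosses S' t)
    w S' * (en t :&: S != set0)%:R.
  rewrite !potE -sumrB; apply: eq_bigr => S' _.
  rewrite (bigID (fun t => en t :&: S != set0)) /=.
  rewrite [X in _ + X - _](eq_bigl (fun t => (t \in ts) && ((en t \subset U :\: S) && crosses S' t))).
    rewrite addrK [RHS](bigID (fun t => en t :&: S != set0)) /= [X in _ = _ + X]big1 ?addr0.
      by apply: eq_bigr => t /andP[_ ->]; rewrite mulr1.
    by move=> t /andP[_ /negbTE ->]; rewrite mulr0.
  move=> t; rewrite subsetD negbK setI_eq0.
  by case: (t \in ts); case: (_ \subset _); case: (crosses _ _); case: [disjoint _ & _].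
(* Every tuple in the potential is hit by sets of total weight at least 1, because one of its
   entries is already covered that often. *)
have tot : 0 <= \sum_S w S * G S.
  have -> : \sum_S w S * G S = \sum_S w S * (pot U - pot (U :\: S)) - pot U.
    by rewrite /pot -sumrB; apply: eq_bigr => S _; rewrite mulrBr.
  rewrite subr_ge0.
  have -> : \sum_S w S * (pot U - pot (U :\: S)) =
     \sum_S' \sum_(t in ts | (en t \subset U) && crosses S' t)
        w S' * (\sum_S w S * (en t :&: S != set0)%:R).
    under eq_bigr => S _ do rewrite diff mulr_sumr.
    rewrite exchange_big; apply: eq_bigr => S' _ /=.
    under eq_bigr => S _ do rewrite mulr_sumr.
    rewrite exchange_big; apply: eq_bigr => t _ /=.
    by rewrite mulr_sumr; apply: eq_bigr => S _; rewrite mulrCA.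
  rewrite potE; apply: ler_sum => S' _; apply: ler_sum => t _; rewrite ler_peMr //.
  case/set0Pn: (en0 t) => x xt; apply: le_trans (wcov x) _.
  rewrite big_mkcond; apply: ler_sum => S _; case: ifP => xS; last by rewrite mulr_ge0.
  suff -> : en t :&: S != set0 by rewrite mulr1.
  by apply/set0Pn; exists x; rewrite inE xt.
(* Sets that miss [U] have slack [G S = 0]; if all other sets of positive weight had negative slack,
   the sum in [tot] would be negative. *)
apply: contrapT => Hn.
have Gneg S : Q S -> w S * G S < 0.
  move=> /andP[H1 H2]; rewrite pmulr_rlt0 // ltNge; apply/negP => H; apply: Hn.
  by exists S; split=> //; move: H; rewrite /G; lra.
move: tot; apply/negP; rewrite -ltNge (bigD1 S0) //=.
have rest : \sum_(S | S != S0) w S * G S <= 0.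
  apply: sumr_le0 => S _; case QS : (Q S); first exact: ltW (Gneg _ QS).
  move/negbT: QS; rewrite negb_and => /orP[].
    by rewrite lt_def w0 andbT negbK => /eqP ->; rewrite mul0r.
  rewrite negbK => /eqP SU; suff -> : G S = 0 by rewrite mulr0.
  have -> : G S = pot U - pot (U :\: S) - cut S U by [].
  have -> : U :\: S = U by apply/setDidPl; rewrite -setI_eq0 setIC SU.
  rewrite subrr sub0r /cut big1 ?oppr0 // => t /andP[_ /andP[tU /andP[/set0Pn[x]]]].
  rewrite inE => /andP[xt xS]; have : x \in S :&: U by rewrite inE xS (subsetP tU).
  by rewrite SU inE.
by have := Gneg _ QS0; lra.
Qed.

(** Iterates [rounding_step], with [U :&: S] as a new block and [U :\: S] left over. A tuple of [U]
    that ends up in no block is either cut by [S] or lies inside [U :\: S] and is lost there. *)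
Lemma rounding U : exists Tt : {set {set V}}, [/\ partition Tt U,
   forall T, T \in Tt -> exists S, 0 < w S /\ T \subset S &
   #|[set t in ts | (en t \subset U) && ~~ [exists T in Tt, en t \subset T]]|%:R
     <= \sum_S w S * #|[set t in ts | (en t \subset U) && crosses S t]|%:R].
Proof.
have cutE S U' : cut S U' = #|[set t in ts | (en t \subset U') && crosses S t]|%:R.
  by rewrite /cut sumr_const; congr (_%:R); apply: eq_card => t; rewrite !inE.
suff : exists Tt : {set {set V}}, [/\ partition Tt U,
   forall T, T \in Tt -> exists S, 0 < w S /\ T \subset S &
   #|[set t in ts | (en t \subset U) && ~~ [exists T in Tt, en t \subset T]]|%:R <= pot U].
  by rewrite /pot; under eq_bigr do rewrite cutE.
have [n] := ubnP #|U|; elim: n U => // n IH U Un.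
have [->|U0] := eqVneq U set0.
  exists set0; split; first by rewrite partition_set0.
    by move=> T; rewrite inE.
  rewrite eq_card0; first by apply: sumr_ge0 => S _; rewrite mulr_ge0 // cutE.
  move=> t; rewrite !inE; apply/negbTE; apply/negP=> /and3P[_ H _].
  by move: (en0 t); rewrite -subset0 H.
have [S [wS SU Hpot]] := rounding_step U0.
have [] := IH (U :\: S).
  rewrite -ltnS; apply: leq_trans _ Un; rewrite ltnS; apply: proper_card.
  rewrite properE subsetDl /=; apply/negP => H.
  case/set0Pn: SU => x; rewrite inE => /andP[xS xU].
  by move: (subsetP H _ xU); rewrite inE xS.
move=> Tt [Tp Tw Tc]; exists ((U :&: S) |: Tt); split.
- rewrite -[X in partition _ X](setID U S); apply: partitionU1 => //.
    by rewrite setIC.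
  by rewrite -setI_eq0; apply/eqP/setP=> x; rewrite !inE; case: (x \in S); rewrite ?andbF.
- move=> T; rewrite in_setU1 => /orP[/eqP->|/Tw //]; exists S; split=> //; exact: subsetIr.
- apply: le_trans _ Hpot; apply: le_trans (_ : _ <= cut S U + #|[set t in ts
    | (en t \subset U :\: S) && ~~ [exists T in Tt, en t \subset T]]|%:R) _; last by rewrite lerD2l.
  rewrite cutE -natrD ler_nat.
  apply: leq_trans (leq_card_setU _ _); apply: subset_leq_card; apply/subsetP => t.
  rewrite !inE => /and3P[tts tU tn]; rewrite tts tU /=.
  rewrite subsetD tU /= /crosses setI_eq0.
  have H1 : ~~ [exists T in Tt, en t \subset T].
    apply: contra tn => /existsP[T /andP[H1 H2]]; apply/existsP; exists T.
    by rewrite in_setU1 H1 orbT.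
  have H2 : ~~ (en t \subset S).
    apply: contra tn => H2; apply/existsP; exists (U :&: S).
    by rewrite setU11 /= subsetI tU.
  by rewrite H1 H2 !andbT orNb.
Qed.
End Rounding.

(** * Maximal assignments under fractional capacities *)

Section Assignment.
Variables (F : realFieldType) (X L : finType) (T : eqType).
Variables (A : {set X}) (cX : X -> T) (cL : L -> T) (y : L -> F).
Hypothesis y0 : forall l, 0 <= y l.

(** Take a valid partial assignment of maximum size: if some type had both an unassigned element and
    a label with a whole unit of capacity left, one more element could be assigned. *)
Lemma maximal_assignment : exists a : X -> option L,
  [/\ forall x l, a x = Some l -> x \in A /\ cX x = cL l,
      forall l, #|[set x | a x == Some l]|%:R <= y l &
      forall s, (forall x, x \in A -> cX x = s -> a x != None) \/
                (forall l, cL l = s -> y l < #|[set x | a x == Some l]|%:R + 1)].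
Proof.
pose valid (a : {ffun X -> option L}) :=
  [forall x, forall l, (a x == Some l) ==> (x \in A) && (cX x == cL l)] &&
  [forall l, #|[set x | a x == Some l]|%:R <= y l].
pose a0 : {ffun X -> option L} := [ffun=> None].
have v0 : valid a0.
  apply/andP; split; apply/forallP => x.
    by apply/forallP=> l; rewrite ffunE.
  by rewrite eq_card0 // => z; rewrite !inE ffunE.
pose m (a : {ffun X -> option L}) := #|[set x | a x != None]|.
case: (arg_maxnP m v0) => a va amax.
case/andP: (va) => /forallP V1 /forallP V2.
have W x l : a x = Some l -> x \in A /\ cX x = cL l.
  by move=> E; move: (forallP (V1 x) l); rewrite E eqxx /= => /andP[-> /eqP].
exists a; split=> // s.
have [H|H] := pselect (exists x, [/\ x \in A, cX x = s & a x = None]); last first.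
  by left=> x xA xs; apply/eqP => E; apply: H; exists x.
right=> l ls; rewrite ltNge; apply/negP=> Hl.
case: H => x [xA xs xN].
pose a' := [ffun z => if z == x then Some l else a z].
have E1 : [set z | a' z != None] = x |: [set z | a z != None].
  by apply/setP=> z; rewrite !inE ffunE; case: (z =P x).
suff va' : valid a'.
  by have := amax _ va'; rewrite /m E1 cardsU1 inE xN /= ltnn.
apply/andP; split.
  apply/forallP=> z; apply/forallP => l'; rewrite ffunE; case: (z =P x) => [->|_].
    by apply/implyP=> /eqP[<-]; rewrite xA xs ls eqxx.
  exact: (forallP (V1 z) l').
apply/forallP=> l'; have [El|El] := eqVneq l' l.
  rewrite El (_ : [set _ | _] = x |: [set z | a z == Some l]).
    by rewrite cardsU1 inE xN /= natrD addrC.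
  by apply/setP=> z; rewrite !inE ffunE; case: (z =P x) => //=; rewrite ?eqxx.
suff -> : #|[set z | a' z == Some l']| = #|[set z | a z == Some l']| by exact: V2.
apply: eq_card => z; rewrite !inE ffunE; case: (z =P x) => // ->; rewrite xN.
by apply/eqP => -[E]; rewrite E eqxx in El.
Qed.
End Assignment.

Local Close Scope ring_scope.

(** * Fractional partitions *)

Section Local.
Variables (k : nat) (ar : 'I_k -> nat).
Hypothesis ar_gt0 : forall Q, 0 < ar Q.
Variable d : nat.
Implicit Types D : db ar.

Definition maxar := \max_(Q < k) ar Q.

Lemma card_ent n (t : tupT ar n) : #|ent t| <= maxar.
Proof.
apply: leq_trans (_ : ar (tag t) <= _); last exact: leq_bigmax.
have -> : ent t = [set tagged t i | i in 'I_(ar (tag t))].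
  apply/setP=> x; apply/entP/imsetP => [[i ->]|[i _ ->]]; by exists i.
by apply: leq_trans (leq_imset_card _ _) _; rewrite card_ord.
Qed.

Lemma ent_neq0 n (t : tupT ar n) : ent t != set0.
Proof.
apply/set0Pn; exists (tagged t (Ordinal (ar_gt0 (tag t)))).
by apply/entP; exists (Ordinal (ar_gt0 (tag t))).
Qed.

(** One step of a ball adds at most [d] tuples per element and [maxar] entries per tuple. *)
Definition ball_bound r := (d * maxar).+1 ^ r.

Lemma card_ball (D : db ar) r x : degree_le D d -> #|@ball k ar D r x| <= ball_bound r.
Proof.
move=> Hd; elim: r => [|r IH]; first by rewrite cards1.
pose ngh c := \bigcup_(t in [set t in tups D | c \in ent t]) ent t.
apply: leq_trans (_ : #|ball r x| + \sum_(c in ball r x) #|ngh c| <= _).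
  apply: leq_trans (leq_card_setU _ _) _; rewrite leq_add2l.
  apply: leq_trans (_ : #|\bigcup_(c in ball r x) ngh c| <= _).
    apply: subset_leq_card; apply/subsetP=> y; rewrite inE => /existsP[c /andP[H1 H2]].
    case/gadjP: H2 => _ [t [H2 H3 H4]]; apply/bigcupP; exists c => //.
    by apply/bigcupP; exists t; rewrite // inE H2.
  elim/big_rec2: _ => [|c m U _ H]; first by rewrite cards0.
  by apply: leq_trans (leq_card_setU _ _) _; rewrite leq_add2l.
rewrite /ball_bound expnS mulSn; apply: leq_add => //.
apply: leq_trans (_ : \sum_(c in ball r x) d * maxar <= _); last first.
  by rewrite sum_nat_const mulnC leq_mul2l IH orbT.
apply: leq_sum => c _; apply: leq_trans (_ : #|[set t in tups D | c \in ent t]| * maxar <= _).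
  rewrite -sum_nat_const /ngh; elim/big_rec2: _ => [|t m U _ H]; first by rewrite cards0.
  apply: leq_trans (leq_card_setU _ _) _; apply: leq_add => //; exact: card_ent.
by rewrite leq_mul2r -elem_degE Hd orbT.
Qed.

Definition Small K (D : db ar) : {set {set 'I_(dn D)}} :=
  [set S : {set 'I_(dn D)} | (S != set0) && [forall x in S, S \subset ball K x]].

Lemma SmallP K D S : reflect (S != set0 /\ {in S &, forall x y, y \in ball K x}) (S \in Small K D).
Proof.
rewrite inE; apply: (iffP andP) => -[H1 H2]; split=> //.
  by move=> x y Hx Hy; move/forall_inP: H2 => /(_ x Hx)/subsetP/(_ y Hy).
by apply/forall_inP=> x Hx; apply/subsetP=> y Hy; apply: H2.
Qed.

Lemma Small_sub K D S T : S \in Small K D -> T != set0 -> T \subset S -> T \in Small K D.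
Proof.
move=> /SmallP[H1 H2] H3 /subsetP H; apply/SmallP; split=> // x y /H Hx /H Hy; exact: H2.
Qed.

Lemma Small1 K D x : [set x] \in Small K D.
Proof.
apply/SmallP; split; first by apply/set0Pn; exists x; rewrite inE.
by move=> y z; rewrite !inE => /eqP-> /eqP->; rewrite ball_id.
Qed.

Lemma card_Small_set K D S : degree_le D d -> S \in Small K D -> #|S| <= ball_bound K.
Proof.
move=> Hd /SmallP[/set0Pn[x Hx] H]; apply: leq_trans (card_ball K x Hd).
by apply: subset_leq_card; apply/subsetP=> y; apply: H.
Qed.

Definition small_bound K := 2 ^ ball_bound K.

Lemma card_Small_at K D v : degree_le D d ->
  #|[set S in Small K D | v \in S]| <= small_bound K.
Proof.
move=> Hd; apply: leq_trans (_ : 2 ^ #|ball K v| <= _); last first.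
  by rewrite leq_exp2l // card_ball.
rewrite -card_powerset; apply: subset_leq_card; apply/subsetP=> S.
rewrite inE => /andP[/SmallP[_ H] Hv]; rewrite powersetE; apply/subsetP=> y; exact: H.
Qed.

Lemma Small_image K r r' D D' (S T : {set 'I_(dn D)}) (S' : {set 'I_(dn D')}) f g :
  nbhd_iso r S S' f g -> T \subset nb r' S -> r' + K <= r ->
  T \in Small K D -> f @: T \in Small K D'.
Proof.
move=> L Tsub rK /SmallP[T0 HT]; apply/SmallP; split.
  by case/set0Pn: T0 => x Hx; apply/set0Pn; exists (f x); apply: imset_f.
move=> x' y' /imsetP[x Hx ->] /imsetP[y Hy ->].
exact: nbhd_iso_ball L rK (subsetP Tsub _ Hx) (HT _ _ Hx Hy).
Qed.

Lemma nbhd_iso_inj r D D' (S : {set 'I_(dn D)}) (S' : {set 'I_(dn D')}) f g :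
  nbhd_iso r S S' f g -> {in nb r S &, injective f}.
Proof.
by move=> L x y Hx Hy E; rewrite -(nbhd_iso_fwd L Hx).2 E (nbhd_iso_fwd L Hy).2.
Qed.

Lemma nbhd_iso_imsetK r D D' (S T : {set 'I_(dn D)}) (S' : {set 'I_(dn D')}) f g :
  nbhd_iso r S S' f g -> T \subset nb r S -> g @: (f @: T) = T.
Proof.
move=> L Tsub; rewrite -imset_comp -[RHS]imset_id; apply: eq_in_imset => x Hx /=.
exact: (nbhd_iso_fwd L (subsetP Tsub _ Hx)).2.
Qed.

Lemma canon_card r D D' (S : {set 'I_(dn D)}) (S' : {set 'I_(dn D')}) :
  S != set0 -> canon r S = canon r S' -> #|S| = #|S'|.
Proof.
move=> S0 /canon_nbhd_iso/(_ S0)[f [g L]]; rewrite -(nbhd_iso_image L) card_in_imset //.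
by move=> x y Hx Hy; apply: (nbhd_iso_inj L); apply: (subsetP (sub_nb _ _)).
Qed.

(* Tuples meeting S are visible at radius 1. *)
Lemma sum_touching (F : nmodType) r D D' (S : {set 'I_(dn D)}) (S' : {set 'I_(dn D')})
    (phi : {set 'I_(dn D)} -> F) (phi' : {set 'I_(dn D')} -> F) f g :
  0 < r -> nbhd_iso r S S' f g ->
  (forall e : {set 'I_(dn D)}, e \subset nb r S -> phi' (f @: e) = phi e) ->
  (\sum_(t in tups D | ent t :&: S != set0) phi (ent t) =
   \sum_(t in tups D' | ent t :&: S' != set0) phi' (ent t))%R.
Proof.
move=> r0 L Hphi.
have L' := nbhd_iso_sym L.
have sub D1 (S1 : {set 'I_(dn D1)}) t : t \in tups D1 -> ent t :&: S1 != set0 ->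
   ent t \subset nb r S1.
  move=> Ht /set0Pn[x]; rewrite inE => /andP[xt xS]; apply/subsetP=> y yt.
  apply: (subsetP (nb_mono _ r0)); apply: (nb_tup (r := 0)) Ht xt yt; by rewrite nb0.
have img D1 D2 S1 S2 f1 g1 t : @nbhd_iso _ _ r D1 D2 S1 S2 f1 g1 -> t \in tups D1 ->
    ent t :&: S1 != set0 ->
   [/\ tmapT f1 t \in tups D2, ent (tmapT f1 t) :&: S2 != set0 & tmapT g1 (tmapT f1 t) = t].
  move=> L1 Ht H; have Hs := sub _ _ _ Ht H; split.
  - by rewrite -(nbhd_iso_tup L1).
  - case/set0Pn: H => x; rewrite inE => /andP[xt xS]; apply/set0Pn; exists (f1 x).
    rewrite inE ent_map imset_f //= (nbhd_iso_set L1) //; exact: (subsetP (sub_nb _ _)).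
  - by apply: tmapT_id => x xt; apply: (nbhd_iso_fwd L1 (subsetP Hs _ xt)).2.
rewrite (reindex_onto (tmapT g) (tmapT f)) /=; last first.
  by move=> t /andP[H1 H2]; case: (img _ _ _ _ _ _ _ L H1 H2).
apply: eq_big => t.
  apply/idP/idP.
    by case/andP=> /andP[H1 H2] /eqP <-; case: (img _ _ _ _ _ _ _ L H1 H2) => -> ->.
  by case/andP=> H1 H2; case: (img _ _ _ _ _ _ _ L' H1 H2) => -> -> ->; rewrite eqxx.
case/andP=> /andP[H1 H2] /eqP E; rewrite -Hphi ?sub // -ent_map E //.
Qed.

Definition bdry D (S : {set 'I_(dn D)}) := #|[set t in tups D | crosses (@ent k ar (dn D)) S t]|.

Lemma bdry_canon r D D' (S : {set 'I_(dn D)}) (S' : {set 'I_(dn D')}) :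
  0 < r -> S != set0 -> canon r S = canon r S' -> bdry S = bdry S'.
Proof.
move=> r0 S0 /canon_nbhd_iso/(_ S0)[f [g L]].
have E D1 (S1 : {set 'I_(dn D1)}) : bdry S1 =
    (\sum_(t in tups D1 | ent t :&: S1 != set0) (~~ (ent t \subset S1)))%N.
  rewrite /bdry -sum1dep_card big_mkcond [RHS]big_mkcond; apply: eq_bigr => t _.
  by rewrite /crosses; case: (t \in tups D1); case: (_ != set0); case: (_ \subset _).
rewrite !E.
apply: (@sum_touching nat r _ _ _ _ (fun e => nat_of_bool (~~ (e \subset S)))
  (fun e => nat_of_bool (~~ (e \subset S'))) f g) => // e He; congr (nat_of_bool (~~ _)).
apply/subsetP/subsetP => H x Hx.
  by rewrite -(nbhd_iso_set L) ?(subsetP He) // H // imset_f.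
by case/imsetP: Hx => y Hy ->; rewrite (nbhd_iso_set L) ?(subsetP He) // H.
Qed.

Lemma bdry_le D (S : {set 'I_(dn D)}) : degree_le D d -> bdry S <= d * #|S|.
Proof.
move=> Hd; apply: leq_trans (_ : \sum_(x in S) #|[set t in tups D | x \in ent t]| <= _).
  apply: leq_trans (_ : #|\bigcup_(x in S) [set t in tups D | x \in ent t]| <= _).
    apply: subset_leq_card; apply/subsetP=> t; rewrite inE => /andP[H1 /andP[/set0Pn[x]]].
    by rewrite inE => /andP[xt xS] _; apply/bigcupP; exists x; rewrite // inE H1.
  elim/big_rec2: _ => [|c m U _ H]; first by rewrite cards0.
  by apply: leq_trans (leq_card_setU _ _) _; rewrite leq_add2l.
by rewrite mulnC -sum_nat_const; apply: leq_sum => x _; rewrite -elem_degE Hd.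
Qed.

Variable F : realFieldType.
Local Open Scope ring_scope.

(** A small set through [v1] lies in the [K]-ball of [v1], so an isomorphism of radius [K + R]
    carries it along with its [R]-neighbourhood. This gives a bijection between the sets summed on
    both sides. *)
Lemma local_sum K R D1 D2 (X1 : {set 'I_(dn D1)} -> F) (X2 : {set 'I_(dn D2)} -> F) v1 v2 :
  (K <= R)%N ->
  (forall S1 S2, S1 \in Small K D1 -> S2 \in Small K D2 -> canon R S1 = canon R S2 -> X1 S1 = X2 S2) ->
  canon (K + R) [set v1] = canon (K + R) [set v2] ->
  \sum_(S in Small K D1 | v1 \in S) X1 S = \sum_(S in Small K D2 | v2 \in S) X2 S.
Proof.
move=> KR HX E.
have [|f [g L]] := canon_nbhd_iso E; first by apply/set0Pn; exists v1; rewrite inE.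
have L' := nbhd_iso_sym L.
have key Da Db va vb fa ga Sa : @nbhd_iso _ _ (K + R) Da Db [set va] [set vb] fa ga ->
    Sa \in Small K Da -> va \in Sa ->
    [/\ fa @: Sa \in Small K Db, vb \in fa @: Sa, ga @: (fa @: Sa) = Sa &
        canon R Sa = canon R (fa @: Sa)].
  move=> La HF Hv.
  have sub : Sa \subset nb K [set va].
    by rewrite nb1; case/SmallP: HF => _ H; apply/subsetP=> y; apply: H.
  split.
  - by apply: Small_image La sub _ HF; rewrite leq_add2l.
  - suff -> : vb = fa va by rewrite imset_f.
    by have := nbhd_iso_set La (subsetP (sub_nb _ _) _ (set11 va)); rewrite !inE eqxx => /eqP.
  - apply: nbhd_iso_imsetK La _; apply: subset_trans sub _; exact/nb_mono/leq_addr.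
  - exact: nbhd_iso_canon (nbhd_iso_sub La sub).
rewrite (reindex_onto (fun S : {set 'I_(dn D2)} => g @: S) (fun S : {set 'I_(dn D1)} => f @: S)) /=; last first.
  by move=> S /andP[H1 H2]; case: (key _ _ _ _ _ _ _ L H1 H2).
apply: eq_big => S.
  apply/idP/idP.
    by case/andP=> /andP[H1 H2] /eqP <-; case: (key _ _ _ _ _ _ _ L H1 H2) => -> ->.
  by case/andP=> H1 H2; case: (key _ _ _ _ _ _ _ L' H1 H2) => -> -> ->; rewrite eqxx.
case/andP=> /andP[H1 H2] /eqP ES; case: (key _ _ _ _ _ _ _ L H1 H2).
by rewrite ES => H3 _ _ H4; apply: HX.
Qed.

Definition hcount r (D : db ar) (c : Code ar) : nat := #|[set v | @canon _ _ r D [set v] == c]|.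

(* [tl] is any list containing the types that occur: the set of all types is infinite, as no degree
   bound is built into [Code]. *)
Definition hclose r (m : F) (D1 D2 : db ar) := exists tl : seq (Code ar),
  [/\ uniq tl, forall v, @canon _ _ r D1 [set v] \in tl, forall v, @canon _ _ r D2 [set v] \in tl &
      \sum_(c <- tl) `|(hcount r D1 c)%:R - (hcount r D2 c)%:R| <= m].

Lemma sum_by_type (T : eqType) (V : finType) (c : V -> T) (tl : seq T) (G : V -> F) :
  uniq tl -> (forall v, c v \in tl) ->
  \sum_v G v = \sum_(y <- tl) \sum_(v | c v == y) G v.
Proof.
move=> U H; under [RHS]eq_bigr do rewrite big_mkcond.
rewrite exchange_big; apply: eq_bigr => v _ /=.
rewrite (bigD1_seq (c v)) //= eqxx big1 ?addr0 // => y /negbTE.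
by rewrite eq_sym => ->.
Qed.

(** Grouped by types, both sums are one linear functional applied to two histograms, with
    coefficients at most [B] in absolute value. *)
Lemma transfer r D1 D2 (G1 : 'I_(dn D1) -> F) (G2 : 'I_(dn D2) -> F) (B m : F) :
  (forall v1 v2, canon r [set v1] = canon r [set v2] -> G1 v1 = G2 v2) ->
  (forall v, `|G1 v| <= B) -> (forall v, `|G2 v| <= B) -> 0 <= B ->
  hclose r m D1 D2 -> `|\sum_v G1 v - \sum_v G2 v| <= B * m.
Proof.
move=> HG B1 B2 B0 [tl [U T1 T2 Hm]].
rewrite (sum_by_type G1 U T1) (sum_by_type G2 U T2) -sumrB.
apply: le_trans (ler_norm_sum _ _ _) _.
apply: le_trans (_ : \sum_(c <- tl) B * `|(hcount r D1 c)%:R - (hcount r D2 c)%:R| <= _).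
  2: by rewrite -mulr_sumr ler_wpM2l.
apply: ler_sum => c _.
have cst D (G : 'I_(dn D) -> F) x : (forall v, canon r [set v] = c -> G v = x) ->
   \sum_(v | canon r [set v] == c) G v = x * (hcount r D c)%:R.
  move=> H; rewrite mulr_natr -sumr_const [RHS](eq_bigl (fun v => canon r [set v] == c)).
    by apply: eq_bigr => v /eqP/H.
  by move=> v; rewrite inE.
have bnd D (G : 'I_(dn D) -> F) : (forall v, `|G v| <= B) ->
   `|\sum_(v | canon r [set v] == c) G v| <= B * (hcount r D c)%:R.
  move=> H; rewrite -(cst _ (fun=> B)) //; apply: le_trans (ler_norm_sum _ _ _) _.
  exact: ler_sum.
(* A type absent from one side gives no common value of [G1] and [G2]; there the bound [B] on each
   term suffices. *)
case: (set_0Vmem [set v | @canon _ _ r D1 [set v] == c]) => [E|[v1]].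
  have h0 : hcount r D1 c = 0%N by rewrite /hcount E cards0.
  rewrite h0 sub0r normrN normr_nat.
  have := bnd _ _ B1; rewrite h0 mulr0 normr_le0 => /eqP ->.
  by rewrite sub0r normrN; apply: bnd.
rewrite inE => /eqP E1.
case: (set_0Vmem [set v | @canon _ _ r D2 [set v] == c]) => [E|[v2]].
  have h0 : hcount r D2 c = 0%N by rewrite /hcount E cards0.
  rewrite h0 subr0 normr_nat.
  have := bnd _ _ B2; rewrite h0 mulr0 normr_le0 => /eqP ->.
  by rewrite subr0; apply: bnd.
rewrite inE => /eqP E2.
rewrite (cst _ _ (G1 v1)); last by move=> v Ev; rewrite (HG v1 v2) ?(HG v v2) ?Ev // E1 E2.
rewrite (cst _ _ (G1 v1)); last by move=> v Ev; rewrite (HG v1 v) ?Ev.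
by rewrite -mulrBr normrM; apply: ler_wpM2r.
Qed.

Lemma hclose_size r D1 D2 m : hclose r m D1 D2 -> `|(dn D1)%:R - (dn D2)%:R| <= m.
Proof.
move=> H; have := @transfer r D1 D2 (fun=> 1) (fun=> 1) 1 m.
rewrite mul1r !sumr_const !card_ord normr1; exact.
Qed.

End Local.

Local Open Scope ring_scope.

Section Fractional.
Variables (k : nat) (ar : 'I_k -> nat).
Hypothesis ar_gt0 : forall Q, (0 < ar Q)%N.
Variable d : nat.
Implicit Types D : db ar.
Variable F : archiRealFieldType.

(* The proportion of members of [SS] among the small sets of [D] with a given code. It depends on
   the code only, so it can be evaluated at the small sets of another database. *)
Definition pweight D (SS : {set {set 'I_(dn D)}}) K R (y : Code ar) : F :=
  avg (Small K D) (fun S => (S \in SS)%:R) (@canon _ _ R D) y.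

(** [SS] lives in [D] and [v] in [D']: this is how often the weights learnt from [D] cover an
    element of another database. A true partition would give 1. *)
Definition coverage D (SS : {set {set 'I_(dn D)}}) K R D' (v : 'I_(dn D')) : F :=
  \sum_(S in Small K D' | v \in S) pweight SS K R (canon R S).

Lemma ind01 (b : bool) : 0 <= (b%:R : F) <= 1.
Proof. by case: b; rewrite ?ler01 lexx. Qed.

Lemma pweight_ge0 D (SS : {set {set 'I_(dn D)}}) K R y : 0 <= pweight SS K R y.
Proof. by apply: avg_ge0 => S; exact: ind01. Qed.

Lemma pweight_le1 D (SS : {set {set 'I_(dn D)}}) K R y : pweight SS K R y <= 1.
Proof. by apply: avg_le1 => S; exact: ind01. Qed.

Lemma pweight_sum D (SS : {set {set 'I_(dn D)}}) K R (h : {set 'I_(dn D)} -> F) :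
  SS \subset Small K D ->
  {in Small K D &, forall S T, canon R S = canon R T -> h S = h T} ->
  \sum_(S in Small K D) pweight SS K R (canon R S) * h S = \sum_(S in SS) h S.
Proof.
move=> sub H; rewrite avg_mul // [RHS]big_mkcond [LHS]big_mkcond; apply: eq_bigr => S _.
case: ifP => H1; case: ifP => H2; rewrite ?mul1r ?mul0r //.
by rewrite (subsetP sub _ H2) in H1.
Qed.

Lemma coverage_le D (SS : {set {set 'I_(dn D)}}) K R D' (v : 'I_(dn D')) :
  degree_le D' d -> 0 <= coverage SS K R v <= (small_bound ar d K)%:R.
Proof.
move=> Hd; rewrite /coverage sumr_ge0 /=; last by move=> S _; exact: pweight_ge0.
apply: le_trans (_ : \sum_(S in [set S in Small K D' | v \in S]) 1 <= _).
  rewrite [X in _ <= X](eq_bigl (fun S => (S \in Small K D') && (v \in S))).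
    by apply: ler_sum => S _; exact: pweight_le1.
  by move=> S; rewrite inE.
by rewrite sumr_const ler_nat card_Small_at.
Qed.

Lemma sum_partition (T : finType) (SS : {set {set T}}) (h : T -> F) :
  partition SS setT -> \sum_(S in SS) \sum_(v in S) h v = \sum_v h v.
Proof.
move=> P; rewrite -(set_partition_big _ P) /=; apply: eq_bigl => v; by rewrite inE.
Qed.

Lemma exchange_sets (T : finType) (A : {set {set T}}) (b : {set T} -> F) (h : T -> F) :
  \sum_v h v * (\sum_(S in A | v \in S) b S) = \sum_(S in A) b S * (\sum_(v in S) h v).
Proof.
under eq_bigr do rewrite mulr_sumr.
rewrite (exchange_big_dep (mem A)) /=; last by move=> v S _ /andP[].
apply: eq_bigr => S SA; rewrite mulr_sumr; apply: eq_big => v; rewrite ?SA //.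
by rewrite mulrC.
Qed.

(* With [h := sgn (coverage R - 1)], which is invariant at radius [K + R], self-adjointness of the
   averages gives [\sum h * (coverage (K + R) - 1) = 0]; so only the change of the weights from
   radius [R] to radius [K + R] contributes. *)
Lemma coverage_L1 D (SS : {set {set 'I_(dn D)}}) K R :
  degree_le D d -> partition SS setT -> SS \subset Small K D -> (K <= R)%N ->
  \sum_(v : 'I_(dn D)) `|coverage SS K R v - 1| <= (ball_bound ar d K)%:R *
     \sum_(S in Small K D) `|pweight SS K (K + R) (canon (K + R) S) - pweight SS K R (canon R S)|.
Proof.
move=> Hd HP HS KR; pose h (v : 'I_(dn D)) := Num.sg (coverage SS K R v - 1).
have h1 v : `|h v| <= 1 by rewrite /h normr_sg; exact: (andP (ind01 _)).2.
have hinv v1 v2 : @canon _ _ (K + R) D [set v1] = @canon _ _ (K + R) D [set v2] -> h v1 = h v2.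
  move=> E; congr (Num.sg (_ - 1)); apply: (local_sum KR _ E) => S1 S2 _ _ -> //.
have zero : \sum_v h v * (coverage SS K (K + R) v - 1) = 0.
  under eq_bigr do rewrite mulrBr mulr1.
  rewrite sumrB /coverage exchange_sets pweight_sum //; first by rewrite sum_partition // subrr.
  move=> S T /SmallP[S0 _] _ /canon_nbhd_iso/(_ S0)[f [g L]].
  rewrite -(nbhd_iso_image L) big_imset /=; last first.
    by move=> x y Hx Hy; apply: (nbhd_iso_inj L); apply: (subsetP (sub_nb _ _)).
  apply: eq_bigr => v vS; apply: hinv.
  rewrite (nbhd_iso_canon (@nbhd_iso_sub _ _ (K + R) 0 _ _ _ _ _ _ [set v] L _)) ?imset_set1 //.
  by rewrite nb0 sub1set.
have -> : \sum_(v : 'I_(dn D)) `|coverage SS K R v - 1| = \sum_v h v * (coverage SS K R v - coverage SS K (K + R) v).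
  suff : \sum_(v : 'I_(dn D)) `|coverage SS K R v - 1| - \sum_v h v * (coverage SS K (K + R) v - 1) =
    \sum_v h v * (coverage SS K R v - coverage SS K (K + R) v) by rewrite zero subr0.
  rewrite -sumrB; apply: eq_bigr => v _.
  rewrite normrEsg -/(h v).
  by move: (h v) (coverage SS K R v) (coverage SS K (K + R) v) => x y z; ring.
pose De (S : {set 'I_(dn D)}) := pweight SS K R (canon R S) - pweight SS K (K + R) (canon (K + R) S).
have -> : \sum_v h v * (coverage SS K R v - coverage SS K (K + R) v) =
   \sum_v h v * (\sum_(S in Small K D | v \in S) De S).
  by apply: eq_bigr => v _; rewrite /coverage -sumrB.
rewrite exchange_sets mulr_sumr; apply: ler_sum => S SF.
apply: le_trans (ler_norm _) _; rewrite normrM mulrC [X in _ <= _ * X]distrC -/(De S).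
move: (De S) => z; apply: ler_wpM2r; first exact: normr_ge0.
apply: le_trans (ler_norm_sum _ _ _) _.
apply: le_trans (_ : \sum_(v in S) 1 <= _); first exact: ler_sum.
by rewrite sumr_const ler_nat card_Small_set.
Qed.

Lemma card_Small K D : degree_le D d -> (#|Small K D| <= dn D * small_bound ar d K)%N.
Proof.
move=> Hd; apply: leq_trans (_ : \sum_(v : 'I_(dn D)) #|[set S in Small K D | v \in S]| <= _)%N.
  apply: leq_trans (_ : #|\bigcup_(v : 'I_(dn D)) [set S in Small K D | v \in S]| <= _)%N.
    apply: subset_leq_card; apply/subsetP=> S SF; case/SmallP: (SF) => /set0Pn[v vS] _.
    by apply/bigcupP; exists v; rewrite // inE SF.
  elim/big_rec2: _ => [|c m U _ H]; first by rewrite cards0.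
  by apply: leq_trans (leq_card_setU _ _) _; rewrite leq_add2l.
rewrite -[X in (_ <= X * _)%N](card_ord (dn D)) -sum_nat_const; apply: leq_sum => v _.
exact: card_Small_at.
Qed.

Lemma partition_card (T : finType) (SS : {set {set T}}) : partition SS setT ->
  (#|SS| <= #|T|)%N.
Proof.
move=> P; rewrite -cardsT (card_partition P) -sum1_card; apply: leq_sum => S SS0.
rewrite lt0n cards_eq0; apply: contraTneq SS0 => ->; by case/and3P: P.
Qed.

(** The step [K] is the radius lost in [local_sum]: a coverage computed at one radius is invariant
    at the next. Starting at [K.+1] keeps statistics of radius [K.+1] visible to all codes in
    use. *)
Definition radius K i := (i * K + K.+1)%N.

Lemma radS K i : radius K i.+1 = (K + radius K i)%N.
Proof. by rewrite /radius mulSn addnA. Qed.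

Lemma rad_gt K i : (K < radius K i)%N.
Proof. exact: leq_addl. Qed.

Lemma rad_le K i J : (i <= J)%N -> (radius K i <= radius K J)%N.
Proof. by move=> H; rewrite /radius leq_add2r leq_mul2r H orbT. Qed.

(** [avg_energy] bounds a sum of squares while [coverage_L1] needs absolute values; the passage is
    [|x| <= a + x ^+ 2 / a], summed over the small sets, whose number is linear in [dn D]. *)
Lemma coverage_small K (eta : F) : 0 < eta -> exists J, forall D (SS : {set {set 'I_(dn D)}}),
  degree_le D d -> partition SS setT -> SS \subset Small K D ->
  exists2 i, (i < J)%N & \sum_(v : 'I_(dn D)) `|coverage SS K (radius K i) v - 1| <= eta * (dn D)%:R.
Proof.
move=> eta0.
pose Bd : F := (ball_bound ar d K)%:R; pose M : F := (small_bound ar d K)%:R.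
have Bd0 : 0 < Bd by rewrite ltr0n expn_gt0.
have M0 : 0 < M by rewrite ltr0n expn_gt0.
(* [a] makes the linear part cost [eta / 2]; then [J] is taken so large that the quadratic part
   costs no more. *)
pose a := eta / (2 * Bd * M).
have a0 : 0 < a by rewrite divr_gt0 // !mulr_gt0.
have aE : Bd * (a * M) = eta / 2 by rewrite /a; field; rewrite !gt_eqF.
clearbody a.
pose J := Num.bound (2 * Bd / (a * eta)).
have HJ : 2 * Bd / (a * eta) < J%:R.
  by apply: archi_boundP; rewrite divr_ge0 // mulr_ge0 // ltW.
have J0 : (0 < J)%N.
  rewrite lt0n; apply: contraTneq HJ => ->; rewrite -leNgt mulr0n.
  by rewrite divr_ge0 // mulr_ge0 // ltW.
exists J => D SS Hd HP HS.
have href i : {in Small K D &, forall S T, canon (radius K i.+1) S = canon (radius K i.+1) T ->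
    canon (radius K i) S = canon (radius K i) T}.
  move=> S T /SmallP[S0 _] _; apply: canon_le => //; exact: rad_le.
have [i iJ Hi] := avg_energy (fun S => ind01 (S \in SS)) href J0.
exists i => //.
have KR : (K <= radius K i)%N by exact/ltnW/rad_gt.
apply: le_trans (coverage_L1 Hd HP HS KR) _.
rewrite -radS.
set n := (dn D)%:R.
have n0 : 0 <= n :> F by rewrite ler0n.
pose De (S : {set 'I_(dn D)}) := pweight SS K (radius K i.+1) (canon (radius K i.+1) S)
               - pweight SS K (radius K i) (canon (radius K i) S).
have HE : \sum_(S in Small K D) De S ^+ 2 <= n / J%:R.
  rewrite ler_pdivlMr ?ltr0n // mulrC; apply: le_trans Hi _.
  rewrite -natr_sum ler_nat -big_mkcondr sum1_card.
  apply: leq_trans (_ : #|SS| <= _)%N; last by have := partition_card HP; rewrite card_ord.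
  by apply: subset_leq_card; apply/subsetP=> S; rewrite unfold_in /= => /andP[].
have H1 S : `|De S| <= a + De S ^+ 2 / a.
  have [h|h] := lerP `|De S| a.
    by apply: le_trans h _; rewrite lerDl divr_ge0 ?sqr_ge0 // ltW.
  apply: le_trans (_ : De S ^+ 2 / a <= _); last by rewrite lerDr ltW.
  by rewrite ler_pdivlMr // -[De S ^+ 2]real_normK ?num_real // expr2 ler_wpM2l // ltW.
have H2 : \sum_(S in Small K D) `|De S| <= a * (n * M) + n / J%:R / a.
  apply: le_trans (ler_sum _ (fun S _ => H1 S)) _.
  rewrite big_split /=; apply: lerD.
    rewrite sumr_const -[X in X <= _]mulr_natr; apply: (ler_wpM2l (ltW a0)); rewrite /n /M -natrM ler_nat.
    exact: card_Small.
  by rewrite -mulr_suml; apply: ler_wpM2r => //; rewrite invr_ge0 ltW.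
apply: le_trans (ler_wpM2l (ltW Bd0) H2) _.
have E1 : Bd * (a * (n * M)) = eta / 2 * n.
  by rewrite -aE; ring.
have E2 : Bd * (n / J%:R / a) <= eta / 2 * n.
  have -> : Bd * (n / J%:R / a) = n * (Bd / (J%:R * a)).
    by field; rewrite gt_eqF //= pnatr_eq0 -lt0n.
  rewrite [X in _ <= X]mulrC ler_wpM2l // ler_pdivrMr ?mulr_gt0 ?ltr0n //.
  move: HJ; rewrite ltr_pdivrMr ?mulr_gt0 // => /ltW; nra.
rewrite mulrDr E1; move: E2; lra.
Qed.

(** The bound 1 lets a single error term serve all statistics. Normalised boundary sizes and
    indicators of codes are the instances needed. *)
Definition invariant_stat r K (X : forall D, {set 'I_(dn D)} -> F) :=
  (forall D D' (S : {set 'I_(dn D)}) (S' : {set 'I_(dn D')}), S != set0 ->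
     canon r S = canon r S' -> X D S = X D' S') /\
  (forall D (S : {set 'I_(dn D)}), degree_le D d -> S \in Small K D -> `|X D S| <= 1).

(** The stage [i] at which the weights of [D] stabilise depends on [D] but stays below [J], so
    closeness of histograms at the one radius [radius K J] serves all [D]. *)
Lemma local_fractional K (eta : F) : 0 < eta -> exists r, exists2 lam : F, 0 < lam &
  forall D D' (SS : {set {set 'I_(dn D)}}), degree_le D d -> degree_le D' d ->
  partition SS setT -> SS \subset Small K D -> hclose r (lam * (dn D')%:R) D D' ->
  exists b : {set 'I_(dn D')} -> F, [/\ forall S, 0 <= b S,
    forall S, S \notin Small K D' -> b S = 0,
    \sum_v `|\sum_(S : {set 'I_(dn D')} | v \in S) b S - 1| <= eta * (dn D')%:R &
    forall X, invariant_stat K.+1 K X ->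
      `|\sum_S b S * X D' S - \sum_(S in SS) X D S| <= eta * (dn D')%:R].
Proof.
move=> eta0.
pose M : F := (small_bound ar d K)%:R.
have M0 : 0 < M by rewrite ltr0n expn_gt0.
have eta4 : 0 < eta / 4 by rewrite divr_gt0.
have [J HJ] := coverage_small K eta4.
exists (radius K J).
(* The bound 1 keeps [dn D] within twice [dn D']; the other bound pays for [transfer], whose local
   quantities are at most [M + 1]. *)
pose lam := Num.min 1 (eta / (2 * (M + 1))).
have lam0 : 0 < lam by rewrite lt_min ltr01 divr_gt0 // mulr_gt0 // addr_gt0.
have lam1 : lam <= 1 by rewrite ge_min lexx.
have lamE : (M + 1) * lam <= eta / 2.
  have : lam <= eta / (2 * (M + 1)) by rewrite ge_min lexx orbT.
  by rewrite ler_pdivlMr ?mulr_gt0 ?addr_gt0 //; lra.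
exists lam => // D D' SS Hd Hd' HP HS Hc.
have [i iJ Hi] := HJ D SS Hd HP HS.
set n' := (dn D')%:R; set n := (dn D)%:R in Hi.
have n'0 : 0 <= n' :> F by rewrite ler0n.
have nn : n <= 2 * n'.
  have := hclose_size Hc; rewrite -/n -/n' ler_norml => /andP[_].
  by have := ler_wpM2r n'0 lam1; lra.
set R := radius K i in Hi.
have KR : (K < R)%N by exact: rad_gt.
have RJ : (K + R <= radius K J)%N.
  by rewrite -radS rad_le.
have vcan v v' : @canon _ _ (radius K J) D [set v] = @canon _ _ (radius K J) D' [set v'] ->
   @canon _ _ (K + R) D [set v] = @canon _ _ (K + R) D' [set v'].
  by apply: canon_le => //; apply/set0Pn; exists v; rewrite inE.
have vcan' D1 D2 S1 S2 : S1 \in Small K D1 -> @canon _ _ R D1 S1 = @canon _ _ R D2 S2 ->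
   canon K.+1 S1 = canon K.+1 S2.
  by case/SmallP=> S10 _; apply: canon_le.
pose b (S : {set 'I_(dn D')}) := if S \in Small K D' then pweight SS K R (canon R S) else 0.
have bcov v : \sum_(S : {set 'I_(dn D')} | v \in S) b S = coverage SS K R v.
  by rewrite -big_mkcondr; apply: eq_bigl => S; rewrite andbC.
exists b; split.
- by move=> S; rewrite /b; case: ifP => // _; exact: pweight_ge0.
- by move=> S; rewrite /b => /negbTE ->.
- under eq_bigr do rewrite bcov.
  have bnd D2 (v : 'I_(dn D2)) : degree_le D2 d -> `| `|coverage SS K R v - 1| | <= M + 1.
    move=> Hd2; rewrite normr_id; have := @coverage_le D SS K R _ v Hd2; rewrite -/M => /andP[h1 h2].
    by rewrite ler_norml; apply/andP; split; lra.
  have inv1 (v : 'I_(dn D)) (v' : 'I_(dn D')) : canon (radius K J) [set v] = canon (radius K J) [set v'] ->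
      `|coverage SS K R v - 1| = `|coverage SS K R v' - 1|.
    move=> E0; have E := vcan _ _ E0; congr (`|_ - 1|).
    by apply: (local_sum (ltnW KR) _ E) => S1 S2 _ _ ->.
  have M10 : 0 <= M + 1 by rewrite addr_ge0 // ltW.
  have := transfer inv1 (fun v => bnd D v Hd) (fun v => bnd D' v Hd') M10 Hc.
  rewrite -/n' ler_norml => /andP[h _].
  have := ler_wpM2r n'0 lamE; have := ler_wpM2l (ltW eta0) nn.
  by move: Hi h; lra.
move=> X [X1 X2].
have -> : \sum_(S in SS) X D S = \sum_(S in Small K D) pweight SS K R (canon R S) * X D S.
  rewrite pweight_sum // => S T SF TF E; apply: X1 (vcan' _ _ _ _ SF E).
  by case/SmallP: SF.
have -> : \sum_S b S * X D' S = \sum_(S in Small K D') pweight SS K R (canon R S) * X D' S.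
  rewrite [RHS]big_mkcond; apply: eq_bigr => S _; rewrite /b; case: ifP => // _.
  by rewrite mul0r.
(* Each set shares its value equally among its elements, which turns a sum over sets into a sum of
   local quantities over elements. *)
have spread D2 : \sum_(S in Small K D2) pweight SS K R (canon R S) * X D2 S =
   \sum_v \sum_(S in Small K D2 | v \in S) pweight SS K R (canon R S) * X D2 S / #|S|%:R.
  rewrite (eq_bigr (fun v => 1 * \sum_(S in Small K D2 | v \in S)
     pweight SS K R (canon R S) * X D2 S / #|S|%:R)); last by move=> v _; rewrite mul1r.
  rewrite exchange_sets; apply: eq_bigr => S SF.
  rewrite sumr_const divfK // pnatr_eq0 cards_eq0; by case/SmallP: SF.
rewrite !spread distrC.
have bnd D2 (v : 'I_(dn D2)) : degree_le D2 d ->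
   `|\sum_(S in Small K D2 | v \in S) pweight SS K R (canon R S) * X D2 S / #|S|%:R| <= M.
  move=> Hd2; apply: le_trans (ler_norm_sum _ _ _) _.
  apply: le_trans (_ : \sum_(S in [set S in Small K D2 | v \in S]) 1 <= _).
    rewrite [X in _ <= X](eq_bigl (fun S => (S \in Small K D2) && (v \in S))).
      apply: ler_sum => S /andP[SF vS]; rewrite normrM [X in X * _]normrM.
      have p1 : `|pweight SS K R (canon R S)| <= 1 by rewrite ger0_norm ?pweight_ge0 // pweight_le1.
      have i1 : `|#|S|%:R^-1 : F| <= 1.
        by rewrite normfV normr_nat invf_le1 ?ler1n ?ltr0n lt0n cards_eq0; case/SmallP: SF.
      apply: le_trans (ler_piMr _ i1) _; first by rewrite mulr_ge0 ?normr_ge0.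
      exact: le_trans (ler_piMr (normr_ge0 _) (X2 _ _ Hd2 SF)) p1.
    by move=> S; rewrite inE.
  by rewrite sumr_const ler_nat card_Small_at.
have inv2 (v : 'I_(dn D)) (v' : 'I_(dn D')) : canon (radius K J) [set v] = canon (radius K J) [set v'] ->
    \sum_(S in Small K D | v \in S) pweight SS K R (canon R S) * X D S / #|S|%:R =
    \sum_(S in Small K D' | v' \in S) pweight SS K R (canon R S) * X D' S / #|S|%:R.
  move=> E0; have E := vcan _ _ E0; apply: (local_sum (ltnW KR) _ E) => S1 S2 SF1 SF2 {}E.
  have S10 : S1 != set0 by case/SmallP: SF1.
  by rewrite E (X1 _ _ _ _ S10 (vcan' _ _ _ _ SF1 E)) (canon_card S10 E).
have := transfer inv2 (fun v => bnd D v Hd) (fun v => bnd D' v Hd') (ltW M0) Hc.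
move=> h; apply: le_trans h _; rewrite -/n' mulrA ler_wpM2r //.
by move: lamE; rewrite mulrDl mul1r; move: lam0 eta0; lra.
Qed.

End Fractional.

Local Close Scope ring_scope.

(** * Transfer of hyperfiniteness *)

Section Comps.
Variables (k : nat) (ar : 'I_k -> nat).
Hypothesis ar_gt0 : forall Q, 0 < ar Q.
Variable d : nat.
Implicit Types D : db ar.

Definition subdb D (E : {set tupT ar (dn D)}) : db ar :=
  DB (fun Q => [set t | Tagged (fun Q => {ffun 'I_(ar Q) -> 'I_(dn D)}) t \in E]).

Lemma tups_subdb D E : tups (@subdb D E) = E.
Proof. by apply/setP=> -[Q t]; rewrite !inE. Qed.

Definition comps D : {set {set 'I_(dn D)}} :=
  equivalence_partition (connect (@gadj k ar D)) setT.

Lemma conn_equiv D : {in setT & &, equivalence_rel (connect (@gadj k ar D))}.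
Proof.
have sym := sym_connect_sym (@gadj_sym k ar D).
move=> x y z _ _ _; split; first exact: connect0.
move=> xy; apply/idP/idP => [xz|]; last exact: connect_trans.
by apply: connect_trans xz; rewrite sym.
Qed.

Lemma comps_partition D : partition (comps D) setT.
Proof. exact: equivalence_partitionP (@conn_equiv D). Qed.

Lemma compsP D S : S \in comps D -> exists x, S = [set y | connect (@gadj k ar D) x y].
Proof. by move=> /imsetP[x _ ->]; exists x; apply/setP=> y; rewrite !inE. Qed.

Lemma mem_comps D x : [set y | connect (@gadj k ar D) x y] \in comps D.
Proof. by apply/imsetP; exists x => //; apply/setP=> y; rewrite !inE. Qed.

Lemma tup_connect D t x y : t \in tups D -> x \in ent t -> y \in ent t ->
  connect (@gadj k ar D) x y.
Proof.
move=> H1 H2 H3; case: (x =P y) => [->|ne]; first exact: connect0.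
by apply: connect1; apply/gadjP; split=> //; exists t.
Qed.

Lemma comps_tup D t : t \in tups D -> exists2 S, S \in comps D & ent t \subset S.
Proof.
move=> Ht; case/set0Pn: (ent_neq0 ar_gt0 t) => x xt.
exists [set y | connect (@gadj k ar D) x y]; first exact: mem_comps.
by apply/subsetP=> y yt; rewrite inE; exact: tup_connect Ht xt yt.
Qed.

Lemma connect_leave (T : finType) (e : rel T) (W : {set T}) x y :
  connect e x y -> x \in W -> y \notin W ->
  exists u v, [/\ connect e x u, e u v, u \in W & v \notin W].
Proof.
case/connectP=> p; elim: p x => [|z p IH] x /=; first by move=> _ -> ->.
case/andP=> xz Hp Ey xW yW; have [zW|zW] := boolP (z \in W); last first.
  by exists x, z; split.
have [u [v [H1 H2 H3 H4]]] := IH z Hp Ey zW yW; exists u, v; split=> //.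
exact: connect_trans (connect1 xz) H1.
Qed.

(** Some edge of a path in the component leaves [W]; the tuple behind this edge crosses [W] and
    stays in the component. *)
Lemma comps_cut D S W : S \in comps D -> S :&: W != set0 -> ~~ (S \subset W) ->
  exists t, [/\ t \in tups D, ent t \subset S & crosses (@ent k ar (dn D)) W t].
Proof.
move=> /compsP[x0 ES] /set0Pn[x]; rewrite inE => /andP[xS xW] /subsetPn[y yS yW].
have E3 z1 z2 z3 := @conn_equiv D z1 z2 z3 (in_setT _) (in_setT _) (in_setT _).
have xy : connect (@gadj k ar D) x y.
  move: xS yS; rewrite ES !inE => H1 H2.
  by rewrite -((E3 x0 x y).2 H1).
have [u [v [H1 H2 H3 H4]]] := connect_leave xy xW yW.
case/gadjP: H2 => _ [t [Ht ut vt]]; exists t; split=> //.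
  apply/subsetP=> z zt; move: xS; rewrite ES !inE => H.
  apply: connect_trans H (connect_trans H1 _); exact: tup_connect Ht ut zt.
apply/andP; split; first by apply/set0Pn; exists u; rewrite inE ut.
by apply/subsetPn; exists v.
Qed.

Lemma path_ball D x p : path (@gadj k ar D) x p -> last x p \in ball (size p) x.
Proof.
elim: p x => [|z p IH] x; first by rewrite inE.
case/andP=> xz /IH H; rewrite [size _]/= -add1n; apply: ball_trans H; exact: ball_adj.
Qed.

Lemma gadj_sub D (E : {set tupT ar (dn D)}) : E \subset tups D -> subrel (@gadj k ar (subdb E)) (@gadj k ar D).
Proof.
move=> /subsetP sub x y /gadjP[xy [t [H1 H2 H3]]]; apply/gadjP; split=> //.
by exists t; split=> //; apply: sub; move: H1; rewrite tups_subdb.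
Qed.

(** A path without repetitions in a component has fewer than [m] edges, and it is also a path of
    [D]. *)
Lemma comps_Small D (E : {set tupT ar (dn D)}) m : E \subset tups D ->
  (forall a, #|@component k ar (subdb E) a| <= m) -> comps (subdb E) \subset Small m D.
Proof.
move=> sub Hm; apply/subsetP=> S /compsP[x0 ES]; apply/SmallP; split.
  by apply/set0Pn; exists x0; rewrite ES inE connect0.
move=> x y; rewrite ES !inE => H1 H2.
have E3 := @conn_equiv (subdb E) x0 x y (in_setT _) (in_setT _) (in_setT _).
have : connect (@gadj k ar (subdb E)) x y by rewrite -(E3.2 H1).
case/connectP=> p /shortenP[p' Hp' Up' _] ->.
apply: (subsetP (@ball_mono _ _ D (size p') m x _)).
  apply: ltnW; apply: leq_trans (Hm x).
  rewrite -[(size p').+1]/(size (x :: p')) -(card_uniqP Up'); apply: subset_leq_card.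
  apply/subsetP=> z zp; rewrite /component inE; exact: path_connect Hp' z zp.
by apply: path_ball; apply: sub_path Hp'; exact: gadj_sub.
Qed.

Lemma comps_sub D (TT : {set {set 'I_(dn D)}}) : partition TT setT ->
  (forall t, t \in tups D -> exists2 T, T \in TT & ent t \subset T) ->
  forall S, S \in comps D -> exists2 T, T \in TT & S \subset T.
Proof.
move=> /and3P[/eqP cov triv _] HT S /compsP[x ES].
have xc : x \in cover TT by rewrite cov inE.
exists (pblock TT x); first exact: pblock_mem.
apply/subsetP=> y yS; apply: contraT => Hy.
have xy : connect (@gadj k ar D) x y by move: yS; rewrite ES inE.
have xb : x \in pblock TT x by rewrite mem_pblock.
have [u [v [_ /gadjP[_ [t [H1 H2 H3]]] uW vW]]] := connect_leave xy xb Hy.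
have [T TTT tT] := HT t H1.
have E : pblock TT x = T.
  by rewrite -(def_pblock triv TTT (subsetP tT _ H2)) (same_pblock triv uW).
by move: vW; rewrite E (subsetP tT).
Qed.

Lemma card_meeting (T : finType) (SS : {set {set T}}) (e : {set T}) :
  partition SS setT -> #|[set S in SS | e :&: S != set0]| <= #|e|.
Proof.
move=> /and3P[_ triv _]; apply: leq_trans (leq_imset_card (pblock SS) e).
apply: subset_leq_card; apply/subsetP=> S; rewrite inE => /andP[SSS /set0Pn[x]].
by rewrite inE => /andP[xe xS]; apply/imsetP; exists x; rewrite // (def_pblock triv SSS).
Qed.

(** A kept tuple lies inside one component and crosses none; a removed one meets at most as many
    components as it has entries. *)
Lemma bdry_sum D (E : {set tupT ar (dn D)}) : E \subset tups D ->
  \sum_(S in comps (subdb E)) @bdry k ar D S <= maxar ar * #|tups D :\: E|.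
Proof.
move=> sub; have P := comps_partition (subdb E).
have -> : \sum_(S in comps (subdb E)) @bdry k ar D S =
   \sum_(t in tups D) #|[set S in comps (subdb E) | crosses (@ent k ar (dn D)) S t]|.
  rewrite (eq_bigr (fun S => \sum_(t in tups D | crosses (@ent k ar (dn D)) S t) 1)).
    rewrite (exchange_big_dep (mem (tups D))) /=; last by move=> S t _ /andP[].
    apply: eq_bigr => t Ht; rewrite -sum1dep_card; apply: eq_bigl => S; by rewrite Ht.
  by move=> S _; rewrite /bdry -sum1dep_card.
rewrite (big_setID E) /= big1 ?add0n.
  rewrite mulnC -sum_nat_const; apply: leq_sum => t _.
  apply: leq_trans (card_ent t); apply: leq_trans (card_meeting (ent t) P).
  apply: subset_leq_card; apply/subsetP=> S; rewrite !inE => /andP[-> /andP[-> _]] //.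
move=> t; rewrite inE => /andP[_ tE]; apply/eqP; rewrite cards_eq0; apply/eqP/setP=> S.
rewrite !inE; apply/negbTE; apply/negP => /andP[HS /andP[/set0Pn[x] /[!inE] /andP[xt xS]]].
have [|S0 HS0 tS0] := @comps_tup (subdb E) t; first by rewrite tups_subdb.
have {}xt : x \in ent t by rewrite inE.
case/and3P: P => _ triv _.
by rewrite -(def_pblock triv HS xS) (def_pblock triv HS0 (subsetP tS0 _ xt)) tS0.
Qed.

Variable F : archiRealFieldType.
Local Open Scope ring_scope.

Lemma bdry_stat K : invariant_stat d K.+1 K
  (fun D S => (@bdry k ar D S)%:R / (d * ball_bound ar d K).+1%:R : F).
Proof.
split=> [D D' S S' S0 E|D S Hd SF]; first by rewrite (bdry_canon (r := K.+1) _ S0 E).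
rewrite ger0_norm ?divr_ge0 ?ler0n // ler_pdivrMr ?ltr0n // mul1r ler_nat.
apply: leqW; apply: leq_trans (bdry_le S Hd) _.
by rewrite leq_mul2l (card_Small_set Hd SF) orbT.
Qed.

Lemma weighted_bdry K (eta : F) D D' (SS : {set {set 'I_(dn D)}}) (b : {set 'I_(dn D')} -> F) :
  (forall X, invariant_stat d K.+1 K X ->
     `|\sum_S b S * X D' S - \sum_(S in SS) X D S| <= eta) ->
  \sum_S b S * (bdry S)%:R <= (\sum_(S in SS) bdry S)%:R + (d * ball_bound ar d K).+1%:R * eta.
Proof.
move=> /(_ _ (bdry_stat K)); set c : F := (_.+1)%:R.
have c0 : 0 < c by rewrite ltr0n.
move: c c0 => c c0 /=.
under eq_bigr do rewrite mulrA.
rewrite -!mulr_suml -mulrBl normrM [`|c^-1|]ger0_norm ?invr_ge0 ?(ltW c0) //.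
rewrite ler_pdivrMr // ler_norml => /andP[_ H].
by rewrite natr_sum; move: H; lra.
Qed.

(** The tuples kept are those inside a block of the rounding, so components refine blocks, and every
    block lies in a small set of positive weight. *)
Lemma rounding_comps K D (w : {set 'I_(dn D)} -> F) :
  (forall S, 0 <= w S) -> (forall v, 1 <= \sum_(S : {set 'I_(dn D)} | v \in S) w S) ->
  (forall S, 0 < w S -> S \in Small K D) ->
  exists E : {set tupT ar (dn D)}, [/\ E \subset tups D, comps (subdb E) \subset Small K D &
    #|tups D :\: E|%:R <= \sum_S w S * (bdry S)%:R].
Proof.
move=> w0 wcov wF.
have [TT [TP Tw Tc]] := rounding (tups D) w0 wcov (@ent_neq0 k ar ar_gt0 (dn D)) setT.
pose E := [set t in tups D | [exists T in TT, ent t \subset T]].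
exists E; split.
- by apply/subsetP=> t; rewrite inE => /andP[].
- apply/subsetP=> S SC.
  have [|T TTT ST] := @comps_sub (subdb E) TT TP _ S SC.
    by move=> t; rewrite tups_subdb inE => /andP[_ /existsP[T /andP[H1 H2]]]; exists T.
  have [S1 [wS1 TS1]] := Tw T TTT.
  apply: Small_sub (wF _ wS1) _ (subset_trans ST TS1).
  by case/compsP: SC => x ->; apply/set0Pn; exists x; rewrite inE connect0.
- apply: le_trans (le_trans _ Tc) _.
    rewrite ler_nat; apply: subset_leq_card; apply/subsetP=> t.
    by rewrite !in_set => /andP[]; rewrite subsetT /= => H1 H2; rewrite H2 in H1 *.
  apply: ler_sum => S _; apply: ler_wpM2l => //; rewrite ler_nat.
  apply: subset_leq_card; apply/subsetP=> t.
  by rewrite !in_set => /and3P[-> _ ->].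
Qed.

(** [rounding] requires every element to be covered at least once, but [b] ensures this only on
    average. Singletons weighted by the defect make up for it; each has at most [d] boundary tuples,
    so they cost at most [d] times the total defect. *)
Lemma transfer_hyperfinite K (eta : F) : 0 < eta -> exists r, exists2 lam : F, 0 < lam &
  forall D D' (E : {set tupT ar (dn D)}), degree_le D d -> degree_le D' d ->
  E \subset tups D -> comps (subdb E) \subset Small K D -> hclose r (lam * (dn D')%:R) D D' ->
  exists E' : {set tupT ar (dn D')}, [/\ E' \subset tups D', comps (subdb E') \subset Small K D' &
    #|tups D' :\: E'|%:R <= (maxar ar * #|tups D :\: E|)%:R + eta * (dn D')%:R].
Proof.
move=> eta0; set c : F := (d * ball_bound ar d K).+1%:R.
have c0 : 0 < c by rewrite ltr0n.
(* The share [c] is for the transferred boundary statistic, the share [d] for the added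
   singletons. *)
pose eta' := eta / (c + d%:R).
have cd0 : 0 < c + d%:R by rewrite ltr_wpDr // ler0n.
have eta'0 : 0 < eta' by rewrite divr_gt0.
have etaE : c * eta' + d%:R * eta' = eta by rewrite -mulrDl mulrC divfK // gt_eqF.
clearbody eta'.
have [r [lam lam0 H]] := local_fractional ar d K eta'0.
exists r; exists lam => // D D' E Hd Hd' sub CF Hc.
have [b [b0 bF bcov bst]] := H D D' _ Hd Hd' (comps_partition (subdb E)) CF Hc.
set n' : F := (dn D')%:R in bcov bst Hc *.
pose e (v : 'I_(dn D')) : F := `|\sum_(S : {set 'I_(dn D')} | v \in S) b S - 1|.
have e0 v : 0 <= e v by exact: normr_ge0.
pose w (S : {set 'I_(dn D')}) := b S + \sum_(v | S == [set v]) e v.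
have w0 S : 0 <= w S by rewrite addr_ge0 // sumr_ge0.
have [||E' [E1 E2 E3]] := @rounding_comps K D' w w0.
- move=> v; rewrite /w big_split /=.
  apply: le_trans (_ : \sum_(S : {set 'I_(dn D')} | v \in S) b S + e v <= _).
    by rewrite /e; set z := \sum_(_ | _) _; have := ler_norm (1 - z); rewrite distrC; lra.
  rewrite lerD2l (bigD1 [set v]) ?inE //= (bigD1 v) //= -addrA lerDl addr_ge0 //.
    by rewrite sumr_ge0.
  by rewrite sumr_ge0 // => S _; rewrite sumr_ge0.
- move=> S wS; have [//|SF] := boolP (S \in Small K D').
  move: wS; rewrite /w bF // add0r => /gt_eqF/negbT/eqP wS.
  have [v /eqP Ev|Hn] := pickP (fun v => S == [set v]).
    by move: SF; rewrite Ev Small1.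
  by case: wS; rewrite big_pred0.
exists E'; split=> //; apply: le_trans E3 _; rewrite /w.
under eq_bigr do rewrite mulrDl.
rewrite big_split /=; have := weighted_bdry bst; rewrite -/c => H1.
have H2 : \sum_(S : {set 'I_(dn D')}) (\sum_(v | S == [set v]) e v) * (bdry S)%:R <=
    d%:R * (eta' * n').
  apply: le_trans (_ : \sum_v e v * d%:R <= _).
    under eq_bigr do rewrite mulr_suml.
    rewrite (exchange_big_dep xpredT) //=; apply: ler_sum => v _.
    rewrite (big_pred1 [set v]); last by move=> S; rewrite eq_sym.
    apply: ler_wpM2l => //; rewrite ler_nat; apply: leq_trans (bdry_le _ Hd') _.
    by rewrite cards1 muln1.
  by rewrite -mulr_suml mulrC; apply: ler_wpM2l.
have H3 : (\sum_(S in comps (subdb E)) @bdry k ar D S)%:R <= (maxar ar * #|tups D :\: E|)%:R :> F.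
  by rewrite ler_nat; exact: bdry_sum.
rewrite -etaE; move: H1 H2 H3; set x1 := \sum_(_ in _) _; lra.
Qed.

End Comps.

(** * Edit distance *)

Section Edit.
Variables (k : nat) (ar : 'I_k -> nat).
Implicit Types D : db ar.

Lemma db_iso_sym D D' : db_iso D D' -> db_iso D' D.
Proof.
case=> f [[g fK gK] H]; exists g; split; first by exists f.
move=> R t; rewrite H; suff -> : tmap f (tmap g t) = t by [].
by apply/ffunP=> i; rewrite !ffunE gK.
Qed.

Lemma db_iso_trans D1 D2 D3 : db_iso D1 D2 -> db_iso D2 D3 -> db_iso D1 D3.
Proof.
case=> f [bf H] [g [bg H']]; exists (g \o f); split; first exact: bij_comp.
move=> R t; rewrite H H'; suff -> : tmap g (tmap f t) = tmap (g \o f) t by [].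
by apply/ffunP=> i; rewrite !ffunE.
Qed.

Lemma modifs_trans m1 m2 D1 D2 D3 :
  modifs m1 D1 D2 -> modifs m2 D2 D3 -> modifs (m1 + m2) D1 D3.
Proof.
elim: m1 D1 => [|m IH] D1 /=; first by move=> ->.
by case=> D [H1 H2] H3; exists D; split=> //; exact: IH.
Qed.

Lemma subdb_tups D : subdb (tups D) = D.
Proof.
case: D => n r; congr DB; apply: functional_extensionality_dep => Q.
by apply/setP=> t; rewrite !inE.
Qed.

Lemma tseq_inj m n : injective (@tseq m n).
Proof.
move=> t t' /eq_in_map E; apply/ffunP=> i; apply: val_inj; apply: E.
by rewrite mem_enum.
Qed.

Lemma tmapT_inj n n' (th : 'I_n -> 'I_n') (U : {set 'I_n}) (t1 t2 : tupT ar n) :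
  {in U &, injective th} -> ent t1 \subset U -> ent t2 \subset U ->
  tmapT th t1 = tmapT th t2 -> t1 = t2.
Proof.
move=> thinj; case: t1 => [Q1 t1] /subsetP U1; case: t2 => [Q2 t2] /subsetP U2 E.
have EQ : Q1 = Q2 by move/(congr1 tag): E.
subst Q2; congr existT; apply/ffunP=> i.
move/eqP: E; rewrite eq_Tagged /= => /eqP/ffunP/(_ i); rewrite !ffunE; apply: thinj.
  by apply: U1; apply/entP; exists i.
by apply: U2; apply/entP; exists i.
Qed.

Lemma modifs_del_tuples D (E0 E : {set tupT ar (dn D)}) : E \subset E0 ->
  modifs #|E0 :\: E| (subdb E0) (subdb E).
Proof.
have [n En] := ubnP #|E0 :\: E|; elim: n E0 En => // n IH E0 En sub.
case: (set_0Vmem (E0 :\: E)) => [E1|[t0 /setDP[t00 t0E]]].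
  rewrite E1 cards0 /=; congr subdb; apply/eqP; rewrite eqEsubset sub andbT.
  by rewrite -setD_eq0 E1.
have sub' : E \subset E0 :\ t0 by rewrite subsetD1 sub.
have cE : #|E0 :\: E| = #|(E0 :\ t0) :\: E|.+1.
  rewrite (cardsD1 t0) inE t0E t00 add1n; congr (#|pred_of_set _|.+1).
  by apply/setP=> t; rewrite !inE; case: (t == t0); rewrite ?andbF.
rewrite cE; exists (subdb (E0 :\ t0)); split; last by apply: IH sub'; rewrite cE in En.
right; left; exists id; split; first exact: inv_bij.
exists (tag t0), (tagged t0); split; first by rewrite inE; case: (t0) t00.
move=> R t; rewrite !inE.
have -> : tmap id t = t by apply/ffunP=> i; rewrite ffunE.
rewrite andbC; congr (_ && ~~ _); apply/eqP/andP => [<- //=|[/eqP ER]].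
case: t0 ER {t00 t0E sub' cE} => Q t0 /= ER; subst R => /eqP/tseq_inj -> //.
Qed.

Definition pullback D m (e : 'I_m -> 'I_(dn D)) : db ar :=
  DB (fun Q => [set t | tmap e t \in drel D Q]).

(** Induction on the number of elements missed by [e]: [e'] adjoins one of them as the last index,
    and deleting it leads back to [e]. *)
Lemma modifs_del_elems D m (e : 'I_m -> 'I_(dn D)) : injective e ->
  exists D1, modifs (dn D - m) D D1 /\ db_iso D1 (pullback e).
Proof.
have [j Hj] : exists j, (dn D - m)%N = j by exists (dn D - m)%N.
rewrite Hj; elim: j m e Hj => [|j IH] m e Hj einj.
  exists D; split=> //.
  have cE : #|'I_m| >= #|'I_(dn D)| by rewrite !card_ord -subn_eq0 Hj.
  apply: db_iso_sym; exists e; split; first exact: inj_card_bij.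
  by move=> R t; rewrite inE.
have mlt : m < dn D by rewrite -subn_gt0 Hj.
have [v Hv] : exists v, v \notin codom e.
  apply/existsP; apply: contraTT mlt; rewrite negb_exists => /forallP H.
  rewrite -leqNgt -(card_ord (dn D)) -[X in _ <= X](card_ord m) -(card_codom einj).
  by apply: subset_leq_card; apply/subsetP=> x _; move: (H x); rewrite negbK.
pose e' (i : 'I_m.+1) := if unlift ord_max i is Some j then e j else v.
have e'l i : e' (lift ord_max i) = e i by rewrite /e' liftK.
have e'inj : injective e'.
  move=> a b; rewrite /e'; case: unliftP => [a' ->|->]; case: unliftP => [b' ->|->] //.
  - by move=> /einj ->.
  - by move=> E; rewrite -E codom_f in Hv.
  - by move=> E; rewrite E codom_f in Hv.
have [] := IH m.+1 e' _ e'inj; first by lia.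
move=> D1 [H1 [h [[h' hK h'K] Hh]]]; exists (pullback e); split; last first.
  exists id; split; first exact: inv_bij.
  move=> R t; suff -> : tmap id t = t by [].
  by apply/ffunP=> i; rewrite ffunE.
rewrite -addn1; apply: modifs_trans H1 _; exists (pullback e); split=> //.
left; split.
  by have := bij_eq_card (Bijective hK h'K); rewrite !card_ord.
exists (fun i => h' (lift ord_max i)); split.
  by move=> a b /(can_inj h'K); exact: lift_inj.
move=> R t; rewrite Hh !inE.
suff -> : tmap e' (tmap h (tmap (fun i => h' (lift ord_max i)) t)) = tmap e t by [].
by apply/ffunP=> i; rewrite !ffunE h'K e'l.
Qed.

(** Deletions cut both databases down to the common part given by [U] and [E0]. The tuples outside
    [E0] go first, so that deleting the elements outside [U] destroys nothing more. *)
Lemma dist_le_partial_iso D D' (U : {set 'I_(dn D)}) (th : 'I_(dn D) -> 'I_(dn D'))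
    (E0 : {set tupT ar (dn D)}) :
  {in U &, injective th} -> E0 \subset tups D ->
  (forall t, t \in E0 -> ent t \subset U /\ tmapT th t \in tups D') ->
  dist_le ((dn D - #|U|) + (dn D' - #|U|) + (#|tups D| - #|E0|) + (#|tups D'| - #|E0|)) D D'.
Proof.
move=> thinj E0sub HE0.
pose E0' := [set tmapT th t | t in E0].
have thE : {in E0 &, injective (tmapT (ar := ar) th)}.
  by move=> t1 t2 H1 H2; apply: tmapT_inj thinj _ _; [case: (HE0 _ H1)|case: (HE0 _ H2)].
have E0'sub : E0' \subset tups D' by apply/subsetP=> t /imsetP[t0 /HE0[_ H] ->].
have cE0' : #|E0'| = #|E0| by rewrite card_in_imset.
pose e (i : 'I_#|U|) := enum_val i : 'I_(dn D).
have einj : injective e by exact: enum_val_inj.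
have eU i : e i \in U by exact: enum_valP.
have [D1 [M1 I1]] := @modifs_del_elems (subdb E0) _ e einj.
have e'inj : injective (th \o e) by move=> i j /= /thinj H; apply: einj; apply: H.
have [D2 [M2 I2]] := @modifs_del_elems (subdb E0') _ (th \o e) e'inj.
have N1 := modifs_trans (modifs_del_tuples E0sub) M1.
have N2 := modifs_trans (modifs_del_tuples E0'sub) M2.
rewrite subdb_tups in N1; rewrite subdb_tups in N2.
eexists _, _, D1, D2; split; last split; [|exact: N1|split; first exact: N2]; last first.
  apply: db_iso_trans I1 (db_iso_trans _ (db_iso_sym I2)).
  exists id; split; first exact: inv_bij.
  move=> R t; have -> : tmap id t = t by apply/ffunP=> i; rewrite ffunE.
  rewrite !inE.
  have Et : Tagged (fun Q => {ffun 'I_(ar Q) -> 'I_(dn D')}) (tmap (th \o e) t) =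
     tmapT th (Tagged (fun Q => {ffun 'I_(ar Q) -> 'I_(dn D)}) (tmap e t)).
    by rewrite /tmapT /=; congr existT; apply/ffunP=> i; rewrite !ffunE.
  rewrite Et; apply/idP/imsetP => [H|[t2 Ht2 E2]]; first by exists (Tagged (fun Q => {ffun 'I_(ar Q) -> 'I_(dn D)}) (tmap e t)).
  suff -> : Tagged (fun Q => {ffun 'I_(ar Q) -> 'I_(dn D)}) (tmap e t) = t2 by [].
  apply: tmapT_inj thinj _ (HE0 _ Ht2).1 E2.
  by apply/subsetP=> y /entP[i ->]; rewrite ffunE.
rewrite !cardsDS // cE0' -[dn (subdb E0)]/(dn D) -[dn (subdb E0')]/(dn D') addnACA addnC addnA; exact: leqnn.
Qed.

(** Codes at radius 0 record the tuples inside a set, so equal codes give isomorphisms of single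
    pieces, and disjointness allows gluing them. Tuples between different pieces are left out of
    [E0]. *)
Lemma glue_pieces D D' (X : finType) (M : {set X}) (A : X -> {set 'I_(dn D)}) (T : X -> {set 'I_(dn D')}) :
  0 < dn D' ->
  (forall x, x \in M -> A x != set0) ->
  {in M &, forall x y, x != y -> [disjoint A x & A y]} ->
  {in M &, forall x y, x != y -> [disjoint T x & T y]} ->
  (forall x, x \in M -> canon 0 (A x) = canon 0 (T x)) ->
  exists (U : {set 'I_(dn D)}) (th : 'I_(dn D) -> 'I_(dn D')) (E0 : {set tupT ar (dn D)}),
  [/\ {in U &, injective th}, E0 \subset tups D,
      (forall t, t \in E0 -> ent t \subset U /\ tmapT th t \in tups D'),
      #|U| = \sum_(x in M) #|T x| &
      #|E0| = #|[set t in tups D' | [exists x in M, ent t \subset T x]]| ].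
Proof.
move=> n'0 A0 dA dT cAT; pose y0 : 'I_(dn D') := Ordinal n'0.
have /choice[f Hf] : forall x, exists f : 'I_(dn D) -> 'I_(dn D'),
    x \in M -> exists g, nbhd_iso 0 (A x) (T x) f g.
  move=> x; have [xM|xM] := boolP (x \in M); last by exists (fun=> y0).
  by have [f Hf] := canon_nbhd_iso (cAT x xM) (A0 x xM); exists f.
pose th v := if [pick x in M | v \in A x] is Some x then f x v else y0.
have uniqA x y v : x \in M -> y \in M -> v \in A x -> v \in A y -> x = y.
  move=> xM yM vx vy; apply/eqP; apply: contraT => /(dA x y xM yM)/pred0P/(_ v).
  by rewrite /= vx vy.
have thE x v : x \in M -> v \in A x -> th v = f x v.
  move=> xM vx; rewrite /th; case: pickP => [y /andP[yM vy]|/(_ x)].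
    by rewrite (uniqA x y v).
  by rewrite xM vx.
pose U := \bigcup_(x in M) A x.
pose E0 := [set t in tups D | [exists x in M, ent t \subset A x]].
have fT x v : x \in M -> v \in A x -> f x v \in T x.
  move=> xM vx; have [g L] := Hf x xM; by rewrite (nbhd_iso_set L) // nb0.
have thinj : {in U &, injective th}.
  move=> v v' /bigcupP[x xM vx] /bigcupP[y yM vy]; rewrite (thE x) // (thE y) // => E.
  have [Exy|/dT] := eqVneq x y.
    subst y; have [g L] := Hf x xM.
    by apply: (nbhd_iso_inj L) E; rewrite nb0.
  move/(_ xM yM)/pred0P/(_ (f x v)); rewrite /= fT //= E fT //.
have thA x : x \in M -> th @: A x = T x.
  move=> xM; have [g L] := Hf x xM; rewrite -(nbhd_iso_image L).
  by apply: eq_in_imset => v vx; rewrite (thE x).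
have sumU (V : finType) (Z : X -> {set V}) : {in M &, forall x y, x != y -> [disjoint Z x & Z y]} ->
    #|\bigcup_(x in M) Z x| = \sum_(x in M) #|Z x|.
  move=> dZ; rewrite -sum1_card.
  under [RHS]eq_bigr do rewrite -sum1_card.
  rewrite (exchange_big_dep xpredT) //= big_mkcond; apply: eq_bigr => v _.
  case: bigcupP => [[x xM vx]|H].
    rewrite (bigD1 x) ?xM //= big1 // => y /andP[/andP[yM vy] yx].
    by move: (dZ y x yM xM yx) => /pred0P/(_ v); rewrite /= vx vy.
  by rewrite big1 // => x /andP[xM vx]; case: H; exists x.
exists U, th, E0; split=> //.
- by apply/subsetP=> t; rewrite inE => /andP[].
- move=> t; rewrite in_set => /andP[Ht /existsP[x /andP[xM tx]]]; split.
    by apply: subset_trans tx (bigcup_sup _ _).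
  have [g L] := Hf x xM; rewrite (@tmapT_eq _ _ _ _ th (f x)).
    by rewrite -(nbhd_iso_tup L) // nb0.
  by move=> v /(subsetP tx); exact: thE.
- rewrite sumU //; apply: eq_bigr => x xM; rewrite -(thA x xM) card_in_imset //.
  by move=> v v' vx vx'; apply: thinj; apply/bigcupP; exists x.
- rewrite -(card_in_imset (f := tmapT th) (D := E0)).
    congr (#|pred_of_set _|); apply/setP=> t; apply/imsetP/idP.
      case=> t0; rewrite in_set => /andP[Ht /existsP[x /andP[xM tx]]] ->.
      have [g L] := Hf x xM; rewrite (@tmapT_eq _ _ _ _ th (f x)); last first.
        by move=> v /(subsetP tx); exact: thE.
      rewrite in_set -(nbhd_iso_tup L) ?nb0 // Ht; apply/existsP; exists x; rewrite xM ent_map.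
      by apply/subsetP=> y /imsetP[v /(subsetP tx) vx ->]; apply: fT.
    rewrite in_set => /andP[Ht /existsP[x /andP[xM tx]]].
    have [g L] := Hf x xM; have L' := nbhd_iso_sym L.
    have gA y : y \in T x -> g y \in A x by move=> yT; rewrite (nbhd_iso_set L') // nb0.
    exists (tmapT g t).
      rewrite in_set -(nbhd_iso_tup L') ?nb0 // Ht; apply/existsP; exists x; rewrite xM ent_map.
      by apply/subsetP=> y /imsetP[v /(subsetP tx) vx ->]; apply: gA.
    rewrite tmapT_comp -[LHS](@tmapT_id _ _ _ _ id id) // tmapT_comp; apply: tmapT_eq => v /(subsetP tx) vx /=.
    rewrite (thE x) ?gA //; by rewrite (nbhd_iso_bwd L _).2 // nb0.
  move=> t1 t2 /setIdP[_ /existsP[x1 /andP[xM1 tx1]]] /setIdP[_ /existsP[x2 /andP[xM2 tx2]]].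
  by apply: (tmapT_inj thinj); [apply: subset_trans tx1 _|apply: subset_trans tx2 _]; exact: bigcup_sup.
Qed.

End Edit.

Local Open Scope ring_scope.

Lemma sum_assigned (X L : finType) (a : X -> option L) (c : L -> nat) :
  (\sum_l #|[set x | a x == Some l]| * c l = \sum_x (if a x is Some l then c l else 0))%N.
Proof.
rewrite (eq_bigr (fun l => \sum_(x | a x == Some l) c l)%N); last first.
  by move=> l _; rewrite sum_nat_const; congr (_ * _)%N; apply: eq_card => x; rewrite inE.
rewrite (exchange_big_dep xpredT) //=; apply: eq_bigr => x _.
case: (a x) => [l|]; last by rewrite big_pred0.
by rewrite (big_pred1 l) // => l'; rewrite eq_sym.
Qed.

(** By maximality each type either has all its elements assigned, so that its deficit is its total
    capacity minus their number, or each of its labels lacks less than one unit. *)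
Lemma assignment_deficit (F : realFieldType) (X L : finType) (T : eqType) (A : {set X})
    (cX : X -> T) (cL : L -> T) (y : L -> F) (sl : seq T) :
  (forall l, 0 <= y l) -> uniq sl -> (forall l, cL l \in sl) ->
  exists a : X -> option L,
  [/\ forall x l, a x = Some l -> x \in A /\ cX x = cL l,
      forall l, #|[set x | a x == Some l]|%:R <= y l &
      \sum_l (y l - #|[set x | a x == Some l]|%:R) <=
        #|L|%:R + \sum_(s <- sl) `|\sum_(l | cL l == s) y l - #|[set x in A | cX x == s]|%:R| ].
Proof.
move=> y0 U Hsl; have [a [a1 a2 a3]] := maximal_assignment A cX cL y0.
exists a; split=> //; pose al l : F := #|[set x | a x == Some l]|%:R.
have -> : #|L|%:R = \sum_(s <- sl) \sum_(l | cL l == s) 1 :> F.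
  by rewrite -(sum_by_type (fun=> 1) U Hsl) sumr_const.
rewrite (sum_by_type _ U Hsl) -big_split /=; apply: ler_sum => s _.
case: (a3 s) => Hs; last first.
  apply: le_trans (_ : \sum_(l | cL l == s) 1 <= _); last by rewrite lerDl.
  by apply: ler_sum => l /eqP/Hs; rewrite -/(al l); lra.
apply: le_trans (_ : `|\sum_(l | cL l == s) y l - #|[set x in A | cX x == s]|%:R| <= _).
  2: by rewrite lerDr sumr_ge0 // => l _; exact: ler01.
rewrite sumrB; apply: le_trans (ler_norm _) _.
suff -> : \sum_(l | cL l == s) #|[set x | a x == Some l]|%:R = #|[set x in A | cX x == s]|%:R :> F by [].
rewrite -natr_sum; congr (_%:R).
rewrite (eq_bigr (fun l => #|[set x | a x == Some l]| * (cL l == s)))%N; last first.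
  by move=> l ->; rewrite muln1.
rewrite big_mkcond /= (eq_bigr (fun l => #|[set x | a x == Some l]| * (cL l == s)))%N; last first.
  by move=> l _; case: (cL l == s); rewrite ?muln0.
rewrite sum_assigned -sum1dep_card [RHS]big_mkcond; apply: eq_bigr => x _ /=.
case E: (a x) => [l|].
  by have [xA <-] := a1 _ _ E; rewrite xA /=; case: (cX x == s).
case: ifP => // /andP[xA /eqP xs]; by move: (Hs x xA xs); rewrite E.
Qed.

(** * Locality *)

Section Transport.
Variables (k : nat) (ar : 'I_k -> nat).
Hypothesis ar_gt0 : forall Q, (0 < ar Q)%N.
Variable d : nat.
Implicit Types D : db ar.
Variable F : archiRealFieldType.

Lemma codes_upto B : exists cl : seq (Code ar), uniq cl /\ forall c : Code ar, (tag c <= B)%N -> c \in cl.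
Proof.
have gen (T : eqType) (f : nat -> seq T) c m : (m <= B)%N -> c \in f m ->
    c \in undup (flatten [seq f m | m <- iota 0 B.+1]).
  by move=> mB cf; rewrite mem_undup; apply/flatten_mapP; exists m; rewrite // mem_iota.
pose f m : seq (Code ar) := [seq existT _ m x | x <- enum {: {set tupT ar m} * {set 'I_m}}].
exists (undup (flatten [seq f m | m <- iota 0 B.+1])); split; first exact: undup_uniq.
case=> m x /= mB; apply: (gen (Code ar : eqType)) mB _.
by apply: map_f; rewrite mem_enum.
Qed.

Lemma tag_canon r D (S : {set 'I_(dn D)}) : tag (canon r S) = #|nb r S|.
Proof.
have /is_codeP[f [finj fim _ _]] := canonP r S.
by rewrite -[LHS]card_ord -(card_codom finj); apply: eq_card => x; rewrite fim.
Qed.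

(** A component cut by [S] contains a tuple crossing [S], and a tuple determines the component that
    contains it. *)
Lemma comps_cut_card D (E : {set tupT ar (dn D)}) (S : {set 'I_(dn D)}) : E \subset tups D ->
  (#|[set T in comps (subdb E) | (T :&: S != set0) && ~~ (T \subset S)]| <= bdry S)%N.
Proof.
move=> sub; set P := comps_partition (subdb E).
pose pl (t : tupT ar (dn D)) : {set 'I_(dn D)} :=
  if [pick T in comps (subdb E) | ent t \subset T] is Some T then T else set0.
rewrite /bdry; apply: leq_trans (leq_imset_card pl _); apply: subset_leq_card.
apply/subsetP=> T /setIdP[TC /andP[TS nTS]].
have [t [Ht tT tS]] := comps_cut TC TS nTS.
rewrite tups_subdb in Ht; apply/imsetP; exists t.
  by rewrite in_set (subsetP sub _ Ht).
have [x xt] := set0Pn _ (ent_neq0 ar_gt0 t).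
rewrite /pl; case: pickP => [T' /andP[T'C tT']|/(_ T)]; last by rewrite TC tT.
have /and3P[_ triv _] := P.
by rewrite -(def_pblock triv TC (subsetP tT _ xt)) -(def_pblock triv T'C (subsetP tT' _ xt)).
Qed.

(** Capacity 1 for each component of [E'] makes a maximal assignment injective, and for each code it
    exhausts the pieces or the components; hence the truncated differences. An unmatched component
    loses at most [ball_bound ar d K] elements and [d] times as many tuples. *)
Lemma match_pieces K D D' (E' : {set tupT ar (dn D')}) (X : finType) (A : {set X})
    (pc : X -> {set 'I_(dn D)}) (gl : seq (Code ar)) :
  degree_le D' d -> (0 < dn D')%N -> E' \subset tups D' -> comps (subdb E') \subset Small K D' ->
  uniq gl -> (forall T, T \in comps (subdb E') -> @canon _ _ 0 D' T \in gl) ->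
  (forall x, x \in A -> pc x != set0) ->
  {in A &, forall x y, x != y -> [disjoint pc x & pc y]} ->
  exists (U : {set 'I_(dn D)}) (th : 'I_(dn D) -> 'I_(dn D')) (E0 : {set tupT ar (dn D)}),
  [/\ {in U &, injective th}, E0 \subset tups D,
      (forall t, t \in E0 -> ent t \subset U /\ tmapT th t \in tups D') &
  exists u : nat,
  [/\ (dn D' <= #|U| + ball_bound ar d K * u)%N,
      (#|tups D'| <= #|E0| + #|tups D' :\: E'| + d * (ball_bound ar d K * u))%N &
      (u <= \sum_(c <- gl) (#|[set T in comps (subdb E') | @canon _ _ 0 D' T == c]|
                 - #|[set x in A | canon 0 (pc x) == c]|))%N]].
Proof.
move=> Hd' n'0 sub' CF' Ugl Hgl pc0 dpc; set SS' := comps (subdb E').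
have P' : partition SS' setT := comps_partition (subdb E').
have /and3P[_ triv _] := P'.
have y0 (T : {set 'I_(dn D')}) : 0 <= (T \in SS')%:R :> rat by rewrite ler0n.
have [m [m1 m2 m3]] := maximal_assignment A (fun x => canon 0 (pc x)) (fun T => @canon _ _ 0 D' T) y0.
pose M := [set x | m x != None]; pose Tm x := odflt set0 (m x).
have MA x : x \in M -> m x = Some (Tm x) by rewrite inE /Tm; case: (m x).
have TS x : x \in M -> Tm x \in SS'.
  move=> /MA E; have := m2 (Tm x); rewrite ler_nat.
  case: (Tm x \in SS') => //; rewrite leqn0 cards_eq0 => /eqP H.
  by have : x \in set0; [rewrite -H inE E | rewrite inE].
have Tinj : {in M &, injective Tm}.
  move=> x y xM yM E; apply/eqP; apply: contraT => xy.
  have := m2 (Tm x); rewrite TS // ler_nat leqNgt => /negP[].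
  apply: leq_trans (_ : #|[set x; y]| <= _)%N; first by rewrite cards2 xy.
  apply: subset_leq_card; apply/subsetP=> z; rewrite !inE => /orP[] /eqP ->.
    by rewrite (MA x).
  by rewrite (MA y) // E.
have dSS T1 T2 : T1 \in SS' -> T2 \in SS' -> T1 != T2 -> [disjoint T1 & T2].
  by move=> H1 H2; apply: (trivIsetP triv).
have [||||U [th [E0 [g1 g2 g3 g4 g5]]]] := @glue_pieces k ar D D' X M pc Tm n'0.
- by move=> x /MA/m1[xA _]; apply: pc0.
- by move=> x y /MA/m1[xA _] /MA/m1[yA _]; apply: dpc.
- by move=> x y xM yM xy; apply: dSS; rewrite ?TS //; apply: contra xy => /eqP/Tinj->.
- by move=> x /MA/m1[].
exists U, th, E0; split=> //.
pose Un := [set T in SS' | [forall x, m x != Some T]].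
have UnB : (\sum_(T in Un) #|T| <= ball_bound ar d K * #|Un|)%N.
  rewrite mulnC -sum_nat_const; apply: leq_sum => T /setIdP[TC _].
  exact: card_Small_set Hd' (subsetP CF' _ TC).
have notUn T : T \in SS' -> T \notin Un -> exists2 x, x \in M & T = Tm x.
  move=> TC; rewrite inE TC /= negb_forall => /existsP[x]; rewrite negbK => /eqP E.
  have xM : x \in M by rewrite inE E.
  by exists x => //; move: (MA x xM); rewrite E => -[].
exists #|Un|; split.
- rewrite g4 -{1}(card_ord (dn D')) -cardsT (card_partition P') (big_setID Un) /=.
  rewrite addnC; apply: leq_add; last first.
    by apply: leq_trans UnB; rewrite (setIidPr _) //; apply/subsetP=> T /setIdP[].
  have -> : (\sum_(x in M) #|Tm x| = \sum_(T in Tm @: M) #|T|)%N by rewrite big_imset.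
  apply: leq_trans (_ : \sum_(T in Tm @: M) #|T| <= _)%N => //.
  rewrite [X in (_ <= X)%N](bigID (fun T => T \in SS' :\: Un)) /=.
  apply: leq_trans (leq_addr _ _); rewrite leq_eqVlt; apply/orP; left; apply/eqP.
  apply: eq_bigl => T; apply/idP/andP => [H|[_ //]]; split=> //.
  case/setDP: H => TC TU; have [x xM ->] := notUn _ TC TU; exact: imset_f.
- rewrite g5; set E0' := [set t in tups D' | _].
  pose bad := \bigcup_(T in Un) \bigcup_(v in T) [set t in tups D' | v \in ent t].
  have Hbad : (#|bad| <= d * (ball_bound ar d K * #|Un|))%N.
    apply: leq_trans (_ : d * \sum_(T in Un) #|T| <= _)%N; last by rewrite leq_mul2l UnB orbT.
    rewrite big_distrr /= /bad; elim/big_rec2: _ => [|T c V _ H]; first by rewrite cards0.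
    apply: leq_trans (leq_card_setU _ _) _; apply: leq_add => //.
    rewrite mulnC -sum_nat_const; elim/big_rec2: _ => [|v c' V' _ H']; first by rewrite cards0.
    apply: leq_trans (leq_card_setU _ _) _; apply: leq_add => //.
    by rewrite -elem_degE.
  apply: leq_trans (_ : #|E0' :|: (tups D' :\: E') :|: bad| <= _)%N; last first.
    apply: leq_trans (leq_card_setU _ _) _; apply: leq_add => //; exact: leq_card_setU.
  apply: subset_leq_card; apply/subsetP=> t Ht.
  rewrite in_setU in_setU in_setD Ht andbT.
  have [tE|//] := boolP (t \in E'); last by rewrite orbT.
  rewrite orbF.
  have [|T TC tT] := @comps_tup k ar ar_gt0 (subdb E') t; first by rewrite tups_subdb.
  have [TU|TU] := boolP (T \in Un).
    have [v vt] := set0Pn _ (ent_neq0 ar_gt0 t).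
    apply/orP; right; apply/bigcupP; exists T => //; apply/bigcupP; exists v.
      exact: (subsetP tT).
    by rewrite in_set Ht.
  have [x xM ET] := notUn _ TC TU.
  by apply/orP; left; rewrite in_set Ht; apply/existsP; exists x; rewrite xM -ET.
- have -> : #|Un| = (\sum_(c <- gl) #|[set T in Un | @canon _ _ 0 D' T == c]|)%N.
    rewrite -sum1_card big_seq_cond; under [RHS]eq_bigr do rewrite -sum1dep_card.
    rewrite -big_seq_cond (exchange_big_dep xpredT) //= big_mkcond; apply: eq_bigr => T _.
    case: ifP => TU; last by rewrite big_pred0.
    rewrite (big_rem (@canon _ _ 0 D' T)) /=; last by apply: Hgl; case/setIdP: TU.
    rewrite eqxx /= big1_seq ?addn0 // => c /andP[/eqP <-].
    by rewrite mem_rem_uniq // inE eqxx.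
  apply: leq_sum => c _; set N := [set T in SS' | _]; set Ac := [set x in A | _].
  case: (m3 c) => Hc; last first.
    rewrite (_ : [set T in Un | _] = set0) ?cards0 //; apply/setP=> T; rewrite !in_set0.
    apply/negbTE; apply/negP=> /setIdP[/setIdP[TC /forallP HT] /eqP Tc].
    have := Hc T Tc; rewrite TC.
    rewrite (_ : [set x | m x == Some T] = set0) ?cards0 ?add0r ?ltxx //.
    by apply/setP=> x; rewrite !inE; apply/negbTE/HT.
  have AcM : Ac \subset M by apply/subsetP=> x /setIdP[xA /eqP xc]; rewrite inE; apply: Hc.
  rewrite leq_subRL.
    rewrite -(card_in_imset (f := Tm) (D := Ac)); last by move=> x y /(subsetP AcM) ? /(subsetP AcM) ?; exact: Tinj.
    rewrite -cardsUI (_ : _ :&: _ = set0) ?cards0 ?addn0.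
      apply: subset_leq_card; apply/subsetP=> T; rewrite in_setU => /orP[].
        move=> /imsetP[x xAc ->]; have xM := subsetP AcM _ xAc.
        by rewrite in_set TS //=; have [_ <-] := m1 _ _ (MA _ xM); case/setIdP: xAc.
      by move=> /setIdP[/setIdP[TC _] Tc]; rewrite in_set TC.
    apply/setP=> T; rewrite in_set0 in_setI; apply/negbTE; apply/negP => /andP[/imsetP[x xAc ->]].
    move=> /setIdP[/setIdP[_ /forallP/(_ x)]]; by rewrite MA ?eqxx // (subsetP AcM).
  rewrite -(card_in_imset (f := Tm) (D := Ac)); last by move=> x y /(subsetP AcM) ? /(subsetP AcM) ?; exact: Tinj.
  apply: subset_leq_card; apply/subsetP=> T /imsetP[x xAc ->]; have xM := subsetP AcM _ xAc.
  by rewrite in_set TS //=; have [_ <-] := m1 _ _ (MA _ xM); case/setIdP: xAc.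
Qed.

End Transport.

Lemma ler_sum_sub (F : realFieldType) (I : finType) (P Q : pred I) (f : I -> F) :
  (forall i, P i -> Q i) -> (forall i, 0 <= f i) -> \sum_(i | P i) f i <= \sum_(i | Q i) f i.
Proof.
move=> PQ f0; rewrite big_mkcond [X in _ <= X]big_mkcond; apply: ler_sum => i _.
by case: ifP => [/PQ ->//|_]; case: ifP.
Qed.

Lemma sum_by_type_in (F : realFieldType) (V : finType) (T : eqType) (A : {set V}) (c : V -> T)
    (gl : seq T) (G : V -> F) : uniq gl -> (forall v, v \in A -> c v \in gl) ->
  \sum_(y <- gl) \sum_(v in A | c v == y) G v = \sum_(v in A) G v.
Proof.
move=> U H; rewrite (exchange_big_dep (mem A)) /=; last by move=> y v _ /andP[].
apply: eq_bigr => v vA; rewrite vA /= big_mkcond (bigD1_seq (c v)) ?H //= eqxx big1 ?addr0 //.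
by move=> y /negbTE; rewrite eq_sym => ->.
Qed.

(** * Copying the pieces of one database into the other *)

Section Pieces.
Variables (k : nat) (ar : 'I_k -> nat).
Hypothesis ar_gt0 : forall Q, (0 < ar Q)%N.
Variable d : nat.
Implicit Types D : db ar.
Variable F : archiRealFieldType.

Lemma comps_neq0 D S : S \in comps D -> S != set0.
Proof. by case/compsP=> x ->; apply/set0Pn; exists x; rewrite inE connect0. Qed.

Lemma canon0_stat K (s : Code ar) : invariant_stat d K.+1 K (fun D S => (@canon _ _ 0 D S == s)%:R : F).
Proof.
split=> [D D' S S' S0 E|D S _ _]; last by case: (_ == s); rewrite ?normr1 ?normr0.
by rewrite (canon_le (r := 0) _ S0 E).
Qed.

(* Lower bound on the weight of the sets containing [T], in terms of the covering defect and of
   the sets that cut [T]. *)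
Lemma containing_weight D (E : {set tupT ar (dn D)}) (b : {set 'I_(dn D)} -> F) T :
  (forall S, 0 <= b S) -> T \in comps (subdb E) ->
  1 - \sum_(S : {set 'I_(dn D)} | T \subset S) b S <=
    \sum_(v in T) `|\sum_(S : {set 'I_(dn D)} | v \in S) b S - 1| +
    \sum_(S : {set 'I_(dn D)} | (T :&: S != set0) && ~~ (T \subset S)) b S.
Proof.
move=> b0 TC; have [v vT] : exists v, v \in T by case/compsP: TC => x ->; exists x; rewrite inE connect0.
rewrite (bigD1 v) //=.
set c := \sum_(S : {set 'I_(dn D)} | v \in S) b S.
have H1 : c <= \sum_(S : {set 'I_(dn D)} | T \subset S) b S +
    \sum_(S : {set 'I_(dn D)} | (T :&: S != set0) && ~~ (T \subset S)) b S.
  rewrite /c (bigID (fun S : {set 'I_(dn D)} => T \subset S)) /=; apply: lerD.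
    by apply: ler_sum_sub => [S /andP[_]|S].
  apply: ler_sum_sub => [S /andP[vS ->]|S] //; rewrite andbT.
  by apply/set0Pn; exists v; rewrite inE vT.
have H2 : 0 <= \sum_(i in T | i != v) `|\sum_(S : {set 'I_(dn D)} | i \in S) b S - 1|.
  exact: sumr_ge0.
have H3 : 1 - c <= `|c - 1| by rewrite distrC ler_norm.
by move: H1 H2 H3; set x1 := \sum_(_ | _) _; set x2 := \sum_(_ | _) _; set x3 := \sum_(_ | _) _; lra.
Qed.

(* A set of [D'] is coloured by its own code and by the number of components of [E'] of each type
   that it contains. The components of [E] are assigned colours in the proportions given by [b], and
   each of them inherits copies of the components contained in a set of [D'] of the same colour. *)
Lemma pieces K2 (gl : seq (Code ar)) : exists L : nat, forall D D' (E : {set tupT ar (dn D)})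
    (E' : {set tupT ar (dn D')})
    (SS : {set {set 'I_(dn D)}}) (SS' : {set {set 'I_(dn D')}}) (b : {set 'I_(dn D')} -> F) (e : F),
  SS = comps (subdb E) -> SS' = comps (subdb E') ->
  degree_le D d -> degree_le D' d ->
  E \subset tups D -> SS \subset Small K2 D ->
  E' \subset tups D' ->
  uniq gl -> (forall T, T \in SS' -> @canon _ _ 0 D' T \in gl) ->
  (forall S, 0 <= b S) -> (forall S, S \notin Small K2 D' -> b S = 0) ->
  \sum_v `|\sum_(S : {set 'I_(dn D')} | v \in S) b S - 1| <= e ->
  (forall X, invariant_stat d K2.+1 K2 X ->
      `|\sum_S b S * X D' S - \sum_(S in SS) X D S| <= e) ->
  exists (X : finType) (A : {set X}) (pc : X -> {set 'I_(dn D)}),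
  [/\ forall x, x \in A -> pc x != set0,
      {in A &, forall x y, x != y -> [disjoint pc x & pc y]} &
      (\sum_(c <- gl) (#|[set T in SS' | @canon _ _ 0 D' T == c]|
                 - #|[set x in A | canon 0 (pc x) == c]|))%N%:R
        <= (maxar ar * #|tups D :\: E|)%:R + L%:R * e + L%:R].
Proof.
have [B BE] : exists B, ball_bound ar d K2 = B by exists (ball_bound ar d K2).
have FB D (S : {set 'I_(dn D)}) : degree_le D d -> S \in Small K2 D -> (#|S| <= B)%N.
  by rewrite -BE; exact: card_Small_set.
have [sl [Usl Hsl]] := codes_upto ar B.
pose c0 : Code ar := existT _ 0%N (set0, set0).
(* A colour is a position in [sl] together with a count for each position in [gl]. Counts are at
   most [B] since the components contained are disjoint and non-empty; the successors leave room for
   codes not listed. *)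
pose La : finType := ('I_(size sl).+1 * {ffun 'I_(size gl).+1 -> 'I_B.+1})%type.
pose col (l : La) := nth c0 sl l.1.
pose tl := undup (c0 :: sl).
(* In order: covering defect, transferred boundary, mismatch of the radius-0 codes, and one unit of
   rounding per colour. A coloured component accounts for at most [size gl * B] pieces. *)
pose L := (1 + (d * B).+1 + size gl * B * size tl + size gl * B * #|La|)%N.
exists L => D D' E E' SS SS' b e ESS ESS' Hd Hd' sub CF sub' Ugl Hgl b0 bF bcov bst.
have PS : partition SS setT by rewrite ESS; exact: (comps_partition (subdb E)).
have PS' : partition SS' setT by rewrite ESS'; exact: (comps_partition (subdb E')).
have /and3P[_ triv _] := PS.
have /and3P[_ triv' _] := PS'.
have e0 : 0 <= e by apply: le_trans bcov; apply: sumr_ge0 => v _; exact: normr_ge0.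
pose cnt (S : {set 'I_(dn D')}) (c : Code ar) :=
  #|[set T in SS' | (T \subset S) && (@canon _ _ 0 D' T == c)]|.
pose lam (S : {set 'I_(dn D')}) : La :=
  (inord (index (@canon _ _ 0 D' S) sl), [ffun i : 'I_(size gl).+1 => (inord (cnt S (nth c0 gl i)) : 'I_B.+1)]).
pose cntl (l : La) (c : Code ar) : nat := l.2 (inord (index c gl)).
have T0 T : T \in SS' -> T != set0 by rewrite ESS'; exact: (@comps_neq0 (subdb E') T).
have cnt_le S c : S \in Small K2 D' -> (cnt S c <= B)%N.
  move=> SF; apply: leq_trans (FB _ _ Hd' SF); apply: leq_trans (card_meeting S PS').
  apply: subset_leq_card; apply/subsetP=> T /setIdP[TC /andP[TS _]].
  rewrite inE TC; have [x xT] := set0Pn _ (T0 T TC).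
  by apply/set0Pn; exists x; rewrite inE xT (subsetP TS).
have cntlE S c : S \in Small K2 D' -> c \in gl -> cntl (lam S) c = cnt S c.
  move=> SF cg; have ig : (index c gl < (size gl).+1)%N by rewrite ltnS ltnW // index_mem.
  by rewrite /cntl /lam /= ffunE inordK inordK ?nth_index // ltnS cnt_le.
have cntlB l c : (cntl l c <= B)%N by rewrite -ltnS ltn_ord.
have colE S : S \in Small K2 D' -> col (lam S) = canon 0 S.
  move=> SF; have H : @canon _ _ 0 D' S \in sl.
    by apply: Hsl; rewrite tag_canon nb0 (FB _ _ Hd' SF).
  by rewrite /col /lam /= inordK ?nth_index // ltnS ltnW // index_mem.
pose y l : F := \sum_(S | lam S == l) b S.
have y0 l : 0 <= y l by apply: sumr_ge0 => S _.
have coltl l : col l \in tl.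
  rewrite mem_undup inE /col; case: (ltnP l.1 (size sl)) => H; first by rewrite mem_nth ?orbT.
  by rewrite nth_default ?eqxx.
have [a [a1 a2 a3]] := assignment_deficit SS (fun S => @canon _ _ 0 D S) y0 (undup_uniq _) coltl.
set al := fun l => #|[set x | a x == Some l]|.
(* A colour in use has positive weight, so some small set of [D'] carries it; that set is the model
   for all components of this colour. *)
pose wit l := odflt set0 [pick S in Small K2 D' | lam S == l].
have witP S l : a S = Some l -> [/\ S \in SS, wit l \in Small K2 D', lam (wit l) = l &
    @canon _ _ 0 D S = canon 0 (wit l)].
  move=> ES; have [SC Sc] := a1 _ _ ES.
  have : 0 < y l.
    apply: lt_le_trans (a2 l); rewrite ltr0n; apply/card_gt0P; exists S; by rewrite inE ES.
  have [W /andP[WF /eqP Wl]|Hn] := pickP (fun W => (W \in Small K2 D') && (lam W == l)); last first.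
    rewrite /y big1 ?ltxx // => W /eqP Wl; apply: bF; apply/negP=> WF.
    by have := Hn W; rewrite WF Wl eqxx.
  move=> _; rewrite /wit; case: pickP => [W' /andP[WF' /eqP Wl']|/(_ W)]; last by rewrite WF Wl eqxx.
  by split=> //=; rewrite Sc -[in LHS]Wl' colE.
have S0 S : S \in SS -> S != set0 by move=> /(subsetP CF)/SmallP[].
have /choice[h Hh] : forall S, exists h : {set 'I_(dn D')} -> {set 'I_(dn D)}, forall l,
    a S = Some l -> exists f g, nbhd_iso 0 S (wit l) f g /\ forall T : {set 'I_(dn D')}, h T = g @: T.
  move=> S; case ES: (a S) => [l|]; last by exists (fun=> set0).
  have [SC _ _ Ec] := witP _ _ ES.
  have [f [g Lf]] := canon_nbhd_iso Ec (S0 S SC).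
  by exists (fun T : {set 'I_(dn D')} => g @: T) => l' [<-]; exists f, g; split.
(* A piece is named by a component of [E] and a component of [E'] inside the model of its colour;
   [pc] pulls the latter back into the former. *)
pose X := ({set 'I_(dn D)} * {set 'I_(dn D')})%type.
pose inA (x : X) := if a x.1 is Some l then (x.2 \in SS') && (x.2 \subset wit l) else false.
pose A := [set x : X | inA x].
pose pc (x : X) := h x.1 x.2.
have AP x : x \in A -> exists l f g, [/\ a x.1 = Some l, x.2 \in SS', x.2 \subset wit l,
    nbhd_iso 0 x.1 (wit l) f g & pc x = g @: x.2].
  rewrite inE /inA; case Ea: (a x.1) => [l|] // /andP[H1 H2].
  by have [f [g [Lf Hg]]] := Hh _ _ Ea; exists l, f, g; split=> //; exact: Hg.
have pcsub x : x \in A -> pc x \subset x.1.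
  move=> /AP[l [f [g [_ _ Tw Lf ->]]]]; apply/subsetP=> v /imsetP[v' vT ->].
  by rewrite (nbhd_iso_set (nbhd_iso_sym Lf)) ?nb0 (subsetP Tw).
have pccan x : x \in A -> canon 0 (pc x) = canon 0 x.2.
  move=> /AP[l [f [g [_ _ Tw Lf ->]]]]; apply/esym.
  by apply: nbhd_iso_canon (@nbhd_iso_sub _ _ 0 0 _ _ _ _ _ _ x.2 (nbhd_iso_sym Lf) _); rewrite nb0.
exists (X : finType), A, pc; split.
- move=> x /AP[l [f [g [_ TC _ _ ->]]]]; have [v vT] := set0Pn _ (T0 _ TC).
  by apply/set0Pn; exists (g v); exact: imset_f.
- move=> x1 x2 xA1 xA2 nx.
  have [ES|nS] := eqVneq x1.1 x2.1; last first.
    have d12 : [disjoint x1.1 & x2.1].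
      have [l1 [f1 [g1 [E1 _ _ _ _]]]] := AP _ xA1.
      have [l2 [f2 [g2 [E2 _ _ _ _]]]] := AP _ xA2.
      by apply: (trivIsetP triv) nS; [case: (witP _ _ E1)|case: (witP _ _ E2)].
    exact: disjointWl (pcsub _ xA1) (disjointWr (pcsub _ xA2) d12).
  case: x1 x2 xA1 xA2 nx ES => [S1 T1] [S2 T2] /= xA1 xA2 nx ES; subst S2.
  have nT : T1 != T2 by apply: contra nx => /eqP ->.
  move: xA1 xA2; rewrite !inE /inA /pc /=; case Ea: (a S1) => [l|] // /andP[C1 W1] /andP[C2 W2].
  have [f [g [Lf Hg]]] := Hh _ _ Ea; rewrite !Hg.
  have d12 := trivIsetP triv' _ _ C1 C2 nT.
  apply/pred0P => v /=; apply/negbTE/negP => /andP[/imsetP[v1 vT1 ->] /imsetP[v2 vT2 Ev]].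
  have : v1 = v2 by apply: (nbhd_iso_inj (nbhd_iso_sym Lf)) Ev; rewrite nb0;
    [exact: (subsetP W1)|exact: (subsetP W2)].
  by move=> E12; move: d12 => /pred0P/(_ v1); rewrite /= vT1 E12 vT2.
have cardA c : c \in gl -> #|[set x in A | canon 0 (pc x) == c]| = (\sum_l al l * cntl l c)%N.
  move=> cg; rewrite sum_assigned.
  have -> : #|[set x in A | canon 0 (pc x) == c]| = #|[set x in A | canon 0 x.2 == c]|.
    apply: eq_card => x; rewrite !in_set -/(inA x); apply: andb_id2l => xA.
    by rewrite pccan // inE.
  rewrite -sum1_card (eq_bigl (fun x : X => inA x && (canon 0 x.2 == c))); last first.
    by move=> x; rewrite in_set /A in_set.
  rewrite -(pair_big_dep xpredT (fun S T => inA (S, T) && (@canon _ _ 0 D' T == c)) (fun _ _ => 1%N)) /=.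
  apply: eq_bigr => S _; rewrite /inA /=; case Ea: (a S) => [l|]; last by rewrite big_pred0.
  have [_ WF El _] := witP _ _ Ea.
  rewrite sum1dep_card -[in RHS]El cntlE // /cnt; apply: eq_card => T.
  by rewrite !inE andbA.
pose err (T : {set 'I_(dn D')}) := \sum_(v in T) `|\sum_(S : {set 'I_(dn D')} | v \in S) b S - 1| +
    \sum_(S : {set 'I_(dn D')} | (T :&: S != set0) && ~~ (T \subset S)) b S.
have err0 T : 0 <= err T.
  by rewrite addr_ge0 ?sumr_ge0 // => *; exact: normr_ge0.
have dl0 l : 0 <= y l - (al l)%:R by rewrite subr_ge0; exact: a2.
have ysum c : c \in gl -> \sum_l y l * (cntl l c)%:R =
    \sum_(T in SS' | canon 0 T == c) \sum_(S : {set 'I_(dn D')} | T \subset S) b S.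
  move=> cg; have -> : \sum_l y l * (cntl l c)%:R = \sum_S b S * (cnt S c)%:R.
    under eq_bigr do rewrite mulr_suml.
    rewrite (exchange_big_dep xpredT) //=; apply: eq_bigr => S _.
    rewrite (big_pred1 (lam S)); last by move=> l; rewrite eq_sym.
    by have [SF|SF] := boolP (S \in Small K2 D'); [rewrite cntlE | rewrite bF // !mul0r].
  rewrite (exchange_big_dep xpredT) //=; apply: eq_bigr => S _.
  rewrite sumr_const mulr_natr; congr (_ *+ _); apply: eq_card => T.
  rewrite in_set [RHS]unfold_in /=.
  by case: (T \in SS'); case: (T \subset S); case: (_ == c).
(* The sets containing [T] have total weight at least [1 - err T], and the assigned components
   realise these weights up to the deficits of the colours. *)
have percode c : c \in gl ->
   (#|[set T in SS' | canon 0 T == c]| - #|[set x in A | canon 0 (pc x) == c]|)%N%:R <=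
   \sum_(T in SS' | canon 0 T == c) err T + \sum_l (y l - (al l)%:R) * (cntl l c)%:R.
  move=> cg; set N := #|_|; set M := #|_|.
  have R0 : 0 <= \sum_(T in SS' | canon 0 T == c) err T + \sum_l (y l - (al l)%:R) * (cntl l c)%:R.
    by rewrite addr_ge0 ?sumr_ge0 // => l _; rewrite mulr_ge0.
  have [NM|NM] := leqP N M; first by rewrite (eqP NM : (N - M)%N = 0%N).
  rewrite natrB ?(ltnW NM) //.
  have -> : M%:R = \sum_l (al l)%:R * (cntl l c)%:R :> F.
    by rewrite /M cardA // natr_sum; apply: eq_bigr => l _; rewrite natrM.
  have -> : \sum_l (y l - (al l)%:R) * (cntl l c)%:R =
     \sum_l y l * (cntl l c)%:R - \sum_l (al l)%:R * (cntl l c)%:R.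
    by rewrite -sumrB; apply: eq_bigr => l _; rewrite mulrBl.
  rewrite ysum // addrA lerD2r -lerBlDr.
  have -> : N%:R = \sum_(T in SS' | canon 0 T == c) 1 :> F.
    by rewrite sumr_const; congr (_%:R); apply: eq_card => T; rewrite !inE.
  rewrite -sumrB; apply: ler_sum => T /andP[TC _]; by apply: (@containing_weight D' E' b T b0); rewrite -ESS'.
have Hw : \sum_S b S * (bdry S)%:R <= (maxar ar * #|tups D :\: E|)%:R + (d * B).+1%:R * e.
  have H1 := weighted_bdry bst.
  by apply: le_trans H1 _; rewrite BE lerD2r ler_nat ESS; exact: (@bdry_sum k ar ar_gt0 D E sub).
(* With the sums exchanged, [b S] is charged once for each component that [S] cuts, and
   [comps_cut_card] bounds their number by the boundary of [S]. *)
have Herr : \sum_(T in SS') err T <= e + \sum_S b S * (bdry S)%:R.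
  rewrite /err big_split /=; apply: lerD; first by rewrite sum_partition.
  rewrite (exchange_big_dep xpredT) //=; apply: ler_sum => S _.
  rewrite sumr_const -[X in X <= _]mulr_natr ler_wpM2l // ler_nat.
  apply: leq_trans (comps_cut_card ar_gt0 S sub'); rewrite -ESS'.
  by rewrite leq_eqVlt; apply/orP; left; apply/eqP/eq_card => T; rewrite [RHS]inE.
have Hdl : \sum_l (y l - (al l)%:R) <= #|La|%:R + (size tl)%:R * e.
  apply: le_trans a3 _; rewrite lerD2l.
  apply: le_trans (_ : \sum_(s <- tl) e <= _); last first.
    by rewrite big_const_seq count_predT iter_addr_0 mulr_natl.
  apply: ler_sum => s _.
  have -> : \sum_(l | col l == s) y l = \sum_S b S * (canon 0 S == s)%:R.
    rewrite (exchange_big_dep xpredT) //=; apply: eq_bigr => S _.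
    have [SF|SF] := boolP (S \in Small K2 D'); last by rewrite bF // mul0r big1.
    rewrite -(colE _ SF); case: eqP => Hs; rewrite ?mulr1 ?mulr0.
      rewrite (big_pred1 (lam S)) // => l /=.
      by apply/andP/eqP => [[_ /eqP ->]//|->]; rewrite Hs !eqxx.
    by rewrite big1 // => l /andP[/eqP Hl /eqP El]; case: Hs; rewrite El.
  have := bst _ (canon0_stat K2 s).
  suff -> : #|[set x in SS | canon 0 x == s]|%:R = \sum_(S in SS) (canon 0 S == s)%:R :> F by [].
  rewrite -natr_sum; congr (_%:R); rewrite -sum1_card big_mkcond [RHS]big_mkcond.
  by apply: eq_bigr => S _; rewrite inE; case: (S \in SS); case: (_ == s).
apply: le_trans (_ : \sum_(T in SS') err T + (size gl * B)%:R * \sum_l (y l - (al l)%:R) <= _).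
  rewrite natr_sum big_seq.
  apply: le_trans (ler_sum _ percode) _; rewrite -big_seq big_split /= sum_by_type_in // lerD2l.
  rewrite exchange_big mulr_sumr; apply: ler_sum => l _ /=.
  rewrite -mulr_sumr mulrC; apply: ler_wpM2r => //.
  rewrite -natr_sum ler_nat -sum1_size big_distrl /=; apply: leq_sum => c _.
  by rewrite mul1n.
have H2 := ler_wpM2l (ler0n F (size gl * B)) Hdl.
have P1 : 0 <= (size gl * B * #|La|)%:R * e by rewrite mulr_ge0.
have P2 := ler0n F (1 + (d * B).+1 + size gl * B * size tl).
have P3 := ler0n F (size gl * B * #|La|).
move: H2 P1 P2 P3 Herr Hw; rewrite /L !natrD ![(_ * _ * _)%:R]natrM.
move: (\sum_(T in SS') err T) (\sum_S b S * (bdry S)%:R) (\sum_l (y l - (al l)%:R)) => z1 z2 z3.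
move: ((size gl * B)%:R) (#|La|%:R) ((size tl)%:R) ((d * B).+1%:R) ((maxar ar * #|tups D :\: E|)%:R).
by move=> z4 z5 z6 z7 z8; lra.
Qed.
End Pieces.

Section Locality.
Variables (k : nat) (ar : 'I_k -> nat).
Hypothesis ar_gt0 : forall Q, (0 < ar Q)%N.
Variable d : nat.
Implicit Types D : db ar.
Variable R : realType.

Lemma hcount_refine r r' D (tl : seq (Code ar)) (phi : Code ar -> Code ar) c :
  uniq tl -> (forall v, @canon _ _ r' D [set v] \in tl) ->
  (forall v, canon r [set v] = phi (@canon _ _ r' D [set v])) ->
  (hcount r D c)%:R = \sum_(c' <- tl | phi c' == c) (hcount r' D c')%:R :> R.
Proof.
move=> U H Hphi.
have E0 : (hcount r D c)%:R = \sum_(v : 'I_(dn D)) (canon r [set v] == c)%:R :> R.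
  rewrite -natr_sum; congr (_%:R); rewrite /hcount -sum1dep_card big_mkcond.
  by apply: eq_bigr => v _; case: (_ == c).
apply: (etrans E0); rewrite (sum_by_type _ U H) [RHS]big_mkcond; apply: eq_bigr => c' _.
rewrite (eq_bigr (fun=> (phi c' == c)%:R)); last by move=> v /eqP E; rewrite Hphi E.
rewrite sumr_const -[LHS]mulr_natr /hcount.
have -> : #|[pred v | @canon _ _ r' D [set v] == c']| = #|[set v | @canon _ _ r' D [set v] == c']|.
  by apply: eq_card => v; rewrite !inE.
by case: (phi c' == c); rewrite ?mul1r ?mul0r.
Qed.

Lemma hclose_le r r' (m : R) D D' : (r <= r')%N -> hclose r' m D D' -> hclose r m D D'.
Proof.
move=> rr [tl [U H1 H2 Hm]].
pose c0 : Code ar := existT _ 0%N (set0, set0).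
(* The type at radius [r'] determines the one at radius [r]; [phi] reads it off from any element of
   either database that has the finer type. *)
pose phi c := if [pick v | @canon _ _ r' D [set v] == c] is Some v then canon r [set v] else
  if [pick v | @canon _ _ r' D' [set v] == c] is Some v then canon r [set v] else c0.
have P1 v : canon r [set v] = phi (@canon _ _ r' D [set v]).
  rewrite /phi; case: pickP => [v' /eqP E|/(_ v)]; last by rewrite eqxx.
  by apply/esym; apply: canon_le rr _ E; apply/set0Pn; exists v'; rewrite inE.
have P2 v : canon r [set v] = phi (@canon _ _ r' D' [set v]).
  rewrite /phi; case: pickP => [v' /eqP E|_].
    by apply/esym; apply: canon_le rr _ E; apply/set0Pn; exists v'; rewrite inE.
  case: pickP => [v' /eqP E|/(_ v)]; last by rewrite eqxx.
  by apply/esym; apply: canon_le rr _ E; apply/set0Pn; exists v'; rewrite inE.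
exists (undup (map phi tl)); split; first exact: undup_uniq.
- by move=> v; rewrite mem_undup P1 map_f.
- by move=> v; rewrite mem_undup P2 map_f.
apply: le_trans Hm; apply: le_trans (_ : \sum_(c <- undup (map phi tl)) \sum_(c' <- tl | phi c' == c)
   `|(hcount r' D c')%:R - (hcount r' D' c')%:R| <= _).
  apply: ler_sum => c _.
  have E := congr2 (fun x y => `|x - y|) (hcount_refine c U H1 P1) (hcount_refine c U H2 P2).
  apply: eq_ind_r (fun z => z <= _) _ _ E; rewrite -sumrB; exact: ler_norm_sum.
rewrite (exchange_big_dep xpredT) //= big_seq [X in _ <= X]big_seq; apply: ler_sum => c' cl.
rewrite big_mkcond (bigD1_seq (phi c')) ?undup_uniq ?mem_undup ?map_f //= eqxx big1 ?addr0 //.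
by move=> c /negbTE; rewrite eq_sym => ->.
Qed.

Lemma hclose_mono r (m m' : R) D D' : m <= m' -> hclose r m D D' -> hclose r m' D D'.
Proof. by move=> mm [tl [? ? ? H]]; exists tl; split=> //; exact: le_trans mm. Qed.

(** Each tuple is shared equally among its entries: the number of tuples becomes a sum of quantities
    bounded by [d] and visible at radius 1. *)
Lemma tups_close (m : R) D D' : degree_le D d -> degree_le D' d -> hclose 1 m D D' ->
  `|#|tups D|%:R - #|tups D'|%:R| <= d%:R * m.
Proof.
move=> Hd Hd' Hc.
pose G D (v : 'I_(dn D)) : R := \sum_(t in tups D | ent t :&: [set v] != set0) (#|ent t|%:R)^-1.
have vP D0 (t : tupT ar (dn D0)) v : (ent t :&: [set v] != set0) = (v \in ent t).
  apply/set0Pn/idP => [[x]|H]; first by rewrite !inE => /andP[H /eqP <-].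
  by exists v; rewrite in_setI in_set1 H eqxx.
have tot D0 : \sum_v G D0 v = #|tups D0|%:R.
  rewrite /G (exchange_big_dep (mem (tups D0))) /=; last by move=> v t _ /andP[].
  rewrite -sum1_card natr_sum; apply: eq_bigr => t tD.
  rewrite (eq_bigl (mem (ent t))); last by move=> v; rewrite tD vP.
  rewrite sumr_const -[LHS]mulr_natr mulVf // pnatr_eq0 cards_eq0.
  exact: ent_neq0.
have bnd D0 v : degree_le D0 d -> `|G D0 v| <= d%:R.
  move=> H; rewrite ger0_norm; last by apply: sumr_ge0 => t _; rewrite invr_ge0.
  apply: le_trans (_ : #|[set t in tups D0 | v \in ent t]|%:R <= _).
    2: by rewrite ler_nat -elem_degE.
  rewrite -sum1_card natr_sum (eq_bigl (fun t => (t \in tups D0) && (ent t :&: [set v] != set0))).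
    apply: ler_sum => t _; rewrite invf_le1 ?ler1n ?ltr0n lt0n cards_eq0; exact: ent_neq0.
  by move=> t; rewrite in_set vP.
rewrite -!tot; apply: (transfer (r := 1)) Hc; rewrite ?ler0n //; last 2 first.
- by move=> v; exact: bnd.
- by move=> v; exact: bnd.
move=> v1 v2 E; have v10 : [set v1] != set0 by apply/set0Pn; exists v1; rewrite inE.
have [f [g L]] := canon_nbhd_iso E v10; have L' := L.
apply: (sum_touching (r := 1) (phi := fun e => (#|e|%:R)^-1) (phi' := fun e => (#|e|%:R)^-1)) L' _ => //.
move=> e esub; rewrite card_in_imset // => x y xe ye.
by apply: (nbhd_iso_inj L); apply: (subsetP esub).
Qed.

Lemma dist_le_sym m D D' : dist_le m D D' -> dist_le m D' D.
Proof.
case=> m1 [m2 [D1 [D2 [H1 [H2 [H3 H4]]]]]]; exists m2, m1, D2, D1.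
by rewrite addnC; split=> //; split=> //; split=> //; exact: db_iso_sym.
Qed.

Lemma is_partition_comps D (S : forall Q : 'I_k, {set {ffun 'I_(ar Q) -> 'I_(dn D)}}) (eps : R) m :
  is_partition S eps m -> exists E : {set tupT ar (dn D)},
   [/\ E \subset tups D, comps (subdb E) \subset Small m D & #|tups D :\: E|%:R <= eps * (dn D)%:R].
Proof.
case=> sub [cut comp].
pose E : {set tupT ar (dn D)} := [set t | tagged t \in S (tag t)].
have Esub : E \subset tups D.
  by apply/subsetP=> t; rewrite !inE; exact: (subsetP (sub _)).
have ES : subdb E = DB S.
  congr DB; apply: functional_extensionality_dep => Q.
  by apply/setP=> t; rewrite !inE.
exists E; split=> //.
- by apply: comps_Small => //; rewrite ES.
- apply: le_trans cut; rewrite ler_nat.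
  rewrite -(card_tups (DB (fun Q => drel D Q :\: S Q))) subset_leq_card //.
  by apply/subsetP=> t; rewrite !inE.
Qed.

Lemma small_factor (eps c : R) : 0 < eps -> 0 <= c -> exists x, 0 < x <= 1 /\ c * x <= eps.
Proof.
move=> e0 c0; have c1 : 0 < c + 1 by lra.
exists (Num.min 1 (eps / (c + 1))); split.
  by rewrite lt_min ltr01 divr_gt0 //= ge_min lexx.
apply: le_trans (_ : c * (eps / (c + 1)) <= _).
  by rewrite ler_wpM2l // ge_min lexx orbT.
by rewrite mulrA ler_pdivrMr //; nra.
Qed.

Lemma half_bounds (n n' : R) : 0 <= n' -> `|n - n'| <= 1 / 2 * n' -> n' / 2 <= n <= 2 * n'.
Proof. by move=> n0; rewrite ler_norml => /andP[]; lra. Qed.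

Lemma locality (C P : db ar -> Prop) (eps : R) : (2 <= d)%N -> 0 < eps ->
  (forall D, P D -> degree_le D d) -> hyperfinite_on (R := R) C P ->
  exists r, exists2 lam : R, 0 < lam & exists N, forall D D', P D -> degree_le D' d ->
    (N <= dn D')%N -> hclose r (lam * (dn D')%:R) D D' -> eps_close eps d D' D.
Proof.
move=> d2 eps0 HPd [rho Hrho].
pose A := maxar ar.
have eps20 : 0 < eps / 20 by rewrite divr_gt0.
(* The factor 2 comes from [dn D <= 2 * dn D'], the factor [A] from the loss in transferring
   cuts. *)
have [e1 [e1P He1]] := small_factor eps20 (ler0n R (2 * A)).
pose K1 := rho e1; pose B1 := ball_bound ar d K1.
have [r1 [lam1 lam10 HT]] := transfer_hyperfinite ar_gt0 d K1 eps20.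
have [gl [Ugl Hgl]] := codes_upto ar B1.
(* An unmatched piece has at most [B1] elements and [d * B1] tuples, counted in both databases:
   hence the factor [2 * (d.+1 * B1)] here, in [h2], and in [N], which absorbs the additive constant
   [L]. *)
have [e2 [e2P He2]] := small_factor eps20 (ler0n R (2 * (d.+1 * B1) * (2 * A))).
pose K2 := rho e2.
have [L HL] := pieces ar_gt0 d R K2 gl.
have [h2 [/andP[h20 h21] Hh2]] := small_factor eps20 (ler0n R (2 * (d.+1 * B1) * L)).
have [r2 [lam2 lam20 HF]] := local_fractional ar d K2 h20.
have [l3 [/andP[l30 l31] Hl3]] := small_factor eps20 (ler0n R d.+1).
pose lam := Num.min (Num.min lam1 lam2) (Num.min l3 (1 / 2)).
pose r := maxn (maxn r1 r2) 1.
have lam0 : 0 < lam by rewrite !lt_min lam10 lam20 l30 divr_gt0.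
exists r, lam => //.
pose N := (Num.bound ((2 * (d.+1 * B1) * L)%:R / (eps / 20))).+1.
exists N => D D' PD Hd' ND Hc.
have Hd := HPd D PD.
set n' : R := (dn D')%:R in Hc.
have n'0 : 0 <= n' by rewrite ler0n.
have dD'0 : (0 < dn D')%N by apply: leq_trans ND.
have C1 : hclose r1 (lam1 * n') D D'.
  apply: hclose_mono (hclose_le _ Hc); first by rewrite ler_wpM2r // !ge_min lexx.
  by rewrite /r !leq_max leqnn.
have C2 : hclose r2 (lam2 * n') D D'.
  apply: hclose_mono (hclose_le _ Hc); first by rewrite ler_wpM2r // !ge_min lexx ?orbT.
  by rewrite /r !leq_max leqnn ?orbT.
have C3 : hclose 1 (l3 * n') D D'.
  apply: hclose_mono (hclose_le _ Hc); first by rewrite ler_wpM2r // !ge_min lexx ?orbT.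
  by rewrite /r !leq_max leqnn ?orbT.
have C4 : hclose 1 (1 / 2 * n') D D'.
  apply: hclose_mono (hclose_le _ Hc); first by rewrite ler_wpM2r // !ge_min lexx ?orbT.
  by rewrite /r !leq_max leqnn ?orbT.
have {Hc} nclose := hclose_size C3; have nclose2 := hclose_size C4.
have tclose := tups_close Hd Hd' C3.
set n : R := (dn D)%:R in nclose nclose2.
rewrite -/n' in nclose nclose2.
have [S1 [/is_partition_comps[E1 [E1sub CF1 cut1]] _]] := Hrho e1 e1P D PD.
have [S2 [/is_partition_comps[E2 [E2sub CF2 cut2]] _]] := Hrho e2 e2P D PD.
have [E' [E'sub CF' cut']] := HT D D' E1 Hd Hd' E1sub CF1 C1.
have [b [b0 bF bcov bst]] := HF D D' (comps (subdb E2)) Hd Hd' (comps_partition (subdb E2)) CF2 C2.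
have gl' T : T \in comps (subdb E') -> @canon _ _ 0 D' T \in gl.
  move=> TC; apply: Hgl; rewrite tag_canon nb0; exact: card_Small_set Hd' (subsetP CF' _ TC).
have [X [Ax [pc [p1 p2 p3]]]] := HL D D' E2 E' _ _ b (h2 * n') erefl erefl Hd Hd' E2sub CF2 E'sub
   Ugl gl' b0 bF bcov bst.
have [U [th [E0 [g1 g2 g3 [u [u1 u2 u3]]]]]] := match_pieces ar_gt0 Hd' dD'0 E'sub CF' Ugl gl' p1 p2.
have D1 := dist_le_partial_iso g1 g2 g3.
eexists; split; first exact: dist_le_sym D1.
have mE0 := subset_leq_card g2.
have mU : (#|U| <= dn D)%N by have := max_card (mem U); rewrite card_ord.
have u1' : (dn D' - #|U|)%N%:R <= (B1 * u)%:R :> R by rewrite ler_nat leq_subLR.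
have u2' : (#|tups D'| - #|E0|)%N%:R <= #|tups D' :\: E'|%:R + (d * (B1 * u))%:R :> R.
  by rewrite -natrD ler_nat leq_subLR addnA.
have v1 : n' <= #|U|%:R + (B1 * u)%:R by rewrite -natrD ler_nat.
have v2 : #|tups D'|%:R <= #|E0|%:R + #|tups D' :\: E'|%:R + (d * (B1 * u))%:R :> R.
  by rewrite -!natrD ler_nat.
have {u3 p3} uR : u%:R <= (A * #|tups D :\: E2|)%:R + L%:R * (h2 * n') + L%:R.
  by apply: le_trans p3; rewrite ler_nat.
rewrite !natrD (natrB _ mU) (natrB _ mE0) -/n.
have NL : (2 * (d.+1 * B1) * L)%:R <= eps / 20 * n'.
  rewrite mulrC -ler_pdivrMr //; apply: ltW; apply: lt_le_trans (archi_boundP _) _.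
    by rewrite divr_ge0 // ltW.
  by rewrite ler_nat; apply: leq_trans (leqnSn _) ND.
have nlow : n' / 2 <= (minn (dn D') (dn D))%:R.
  rewrite /minn; case: ifP => _; last by have /andP[] := half_bounds n'0 nclose2.
  by rewrite -/n' ler_pdivrMr // ler_peMr // ler1n.
have d2R : 2 <= d%:R :> R by rewrite ler_nat.
(* The smaller size is only known to be at least [n' / 2]; the factor [d >= 2] in the definition of
   closeness compensates. *)
have RHS1 : eps * n' <= eps * d%:R * (minn (dn D') (dn D))%:R.
  rewrite -mulrA ler_wpM2l ?(ltW eps0) //.
  have n2p : 0 <= n' / 2 by rewrite divr_ge0.
  have h := ler_pM (ler0n R 2) n2p d2R nlow; apply: le_trans h.
  by rewrite mulrC divfK // pnatr_eq0.
apply: le_trans RHS1.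
have n2 : n <= 2 * n' by have /andP[] := half_bounds n'0 nclose2.
have /andP[e10 _] := e1P; have /andP[e20 _] := e2P.
have F1 : #|tups D' :\: E'|%:R <= eps / 10 * n'.
  apply: le_trans cut' _; rewrite natrM.
  have h1 : A%:R * #|tups D :\: E1|%:R <= A%:R * (e1 * (2 * n')).
    apply: ler_wpM2l => //; apply: le_trans cut1 _; rewrite ler_pM2l //.
  have h2' := ler_wpM2r n'0 He1; rewrite natrM in h2'; move: h1 h2'; rewrite -/A -/n'; clear; lra.
have F2 : (2 * (d.+1 * B1))%:R * u%:R <= 3 * (eps / 20 * n').
  apply: le_trans (ler_wpM2l (ler0n _ _) uR) _.
  have h1 : A%:R * #|tups D :\: E2|%:R <= A%:R * (e2 * (2 * n')).
    apply: ler_wpM2l => //; apply: le_trans cut2 _; rewrite ler_pM2l //.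
  have h2' := ler_wpM2r n'0 He2; have h3 := ler_wpM2r n'0 Hh2.
  have h4 := ler_wpM2l (ler0n R (2 * (d.+1 * B1))) h1.
  rewrite natrM in h3; rewrite natrM in h2'; rewrite natrM in NL.
  rewrite [(2 * A)%:R]natrM in h2'; rewrite [(A * _)%:R]natrM.
  move: h2' h3 h4 NL; move: ((2 * (d.+1 * B1))%:R) (A%:R) (L%:R) (#|tups D :\: E2|%:R).
  by move=> q1 q2 q3 q4; clear; lra.
have F3 := ler_wpM2r n'0 Hl3.
have F4 : (2 * (d.+1 * B1))%:R * u%:R = 2 * ((B1 * u)%:R + (d * (B1 * u))%:R) :> R.
  by rewrite -natrD -natrM -natrM; congr (_%:R); clear; lia.
rewrite {}F4 in F2.
have G1 : n - #|U|%:R <= l3 * n' + (B1 * u)%:R.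
  by move: nclose v1; rewrite ler_norml => /andP[_]; clear; lra.
have G2 : #|tups D|%:R - #|E0|%:R <= d%:R * (l3 * n') + #|tups D' :\: E'|%:R + (d * (B1 * u))%:R.
  by move: tclose v2; rewrite ler_norml => /andP[_]; clear; lra.
have F5 : l3 * n' + d%:R * (l3 * n') <= eps / 20 * n'.
  by apply: le_trans F3; rewrite -natr1; clear; lra.
have eps_n : 0 <= eps * n' by rewrite mulr_ge0 // ltW.
move: u1' u2' F1 F2 F5 G1 G2 eps_n.
move: ((B1 * u)%:R) ((d * (B1 * u))%:R) (#|tups D' :\: E'|%:R) (l3 * n') (d%:R * (l3 * n')).
move: ((dn D' - #|U|)%N%:R) ((#|tups D'| - #|E0|)%N%:R) (n - #|U|%:R) (#|tups D|%:R - #|E0|%:R).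
by move=> y2 y3 y4 y5 y6 y7 y8 y9 y10; clear; lra.
Qed.

End Locality.

(** * Semilinear histograms and sampling *)

Section Types.
Variables (k : nat) (ar : 'I_k -> nat).
Variable d : nat.
Implicit Types D : db ar.

Lemma types_ex r : exists tl : seq (Code ar), [/\ uniq tl,
  forall D v, degree_le D d -> @canon _ _ r D [set v] \in tl &
  forall c, c \in tl -> exists D v, @canon _ _ r D [set v] = c].
Proof.
have [cl [U Hcl]] := codes_upto ar (ball_bound ar d r).
exists [seq c <- cl | `[< exists D v, degree_le D d /\ @canon _ _ r D [set v] = c >]]; split.
- exact: filter_uniq.
- move=> D v Hd; rewrite mem_filter; apply/andP; split; first by apply/asboolP; exists D, v.
  by apply: Hcl; rewrite tag_canon nb1 card_ball.
- by move=> c; rewrite mem_filter => /andP[/asboolP[D [v [_ <-]]] _]; exists D, v.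
Qed.

(** Histograms are indexed by rooted databases, types here are codes. A realised code, rooted at the
    index of its centre, is one of these coordinates. *)
Lemma nbhd_is_canon r (c : Code ar) : (exists D v, @canon _ _ r D [set v] = c) ->
  exists X : rdb ar, forall D v, @nbhd_is _ _ r D v X = (@canon _ _ r D [set v] == c).
Proof.
case=> D0 [v0 Ec]; have c0 := canonP r [set v0]; rewrite Ec in c0.
have /is_codeP[f0 [inj0 im0 set0' tup0]] := c0.
have [a Ea] : exists a, f0 a = v0.
  have : v0 \in nb r [set v0] by rewrite (subsetP (sub_nb _ _)) ?inE.
  by rewrite im0 => /codomP[a ->]; exists a.
have Aa i : (i \in code_set c) = (i == a) by rewrite -set0' inE -Ea (inj_eq inj0).
pose X : db ar := DB (fun Q => [set t | Tagged (fun Q => {ffun 'I_(ar Q) -> 'I_(tag c)}) t \in code_tups c]).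
exists (existT _ X a) => D v.
have -> : (@canon _ _ r D [set v] == c) = is_code r [set v] c.
  apply/eqP/idP => [<-|H]; first exact: canonP.
  have v0' : [set v] != set0 by apply/set0Pn; exists v; rewrite inE.
  by have [f [g L]] := is_code_nbhd_iso H c0 v0'; rewrite (nbhd_iso_canon L) Ec.
apply/existsP/existsP => -[f /and4P[H1 /forallP H2 H3 H4]]; exists f; apply/and4P; split=> //.
- by apply/forallP=> b; rewrite nb1.
- apply/forallP=> i; rewrite inE Aa -(eqP H3) /=; apply/eqP.
  by rewrite (inj_eq (injectiveP _ H1)).
- apply/forallP=> -[Q t]; move/forallP: H4 => /(_ Q)/forallP/(_ t).
  by rewrite !inE.
- by apply/forallP=> b; have := H2 b; rewrite nb1.
- by have := forallP H3 a; rewrite inE Aa eqxx => /eqP.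
- apply/forallP=> Q; apply/forallP=> t.
  by move/forallP: H4 => /(_ (Tagged (fun Q => {ffun 'I_(ar Q) -> 'I_(tag c)}) t)); rewrite !inE.
Qed.

Lemma hist_hcount r (X : rdb ar) (c : Code ar) D :
  (forall v, @nbhd_is _ _ r D v X = (canon r [set v] == c)) -> hist r D X = hcount r D c.
Proof. by move=> H; apply: eq_card => v; rewrite !inE H. Qed.

Variable R : realType.

Lemma lin_comb_scale (I : Type) (vs : seq (I -> nat)) (a : seq nat) (g : nat -> nat) (rho : R) x :
  (forall m, `|(g m)%:R - rho * m%:R| <= 1) ->
  `|(\sum_(p <- zip (map g a) vs) p.1 * p.2 x)%N%:R - rho * (\sum_(p <- zip a vs) p.1 * p.2 x)%N%:R|
    <= (\sum_(v <- vs) v x)%N%:R.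
Proof.
move=> Hg; elim: a vs => [|m a IH] vs.
  by case: vs => [|v vs]; rewrite /= !big_nil mulr0 subrr normr0 ler0n.
case: vs => [|v vs] /=; first by rewrite !big_nil mulr0 subrr normr0.
rewrite !big_cons /= !natrD !natrM.
have -> : forall z1 z2 : R, (g m)%:R * (v x)%:R + z1 - rho * (m%:R * (v x)%:R + z2) =
   ((g m)%:R - rho * m%:R) * (v x)%:R + (z1 - rho * z2) by move=> z1 z2; ring.
apply: le_trans (ler_normD _ _) _; apply: lerD (IH vs).
by rewrite normrM normr_nat ler_piMl.
Qed.

Lemma floor_scale (n n1 m : nat) : (0 < n1)%N ->
  `|(m * n %/ n1)%N%:R - n%:R / n1%:R * m%:R| <= 1 :> R.
Proof.
move=> n10; have n1R : 0 < n1%:R :> R by rewrite ltr0n.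
have -> : n%:R / n1%:R * m%:R = (m * n)%:R / n1%:R :> R by rewrite natrM; field; rewrite gt_eqF.
have E : (m * n)%:R = (m * n %/ n1)%N%:R * n1%:R + (m * n %% n1)%N%:R :> R.
  by rewrite -natrM -natrD -divn_eq.
rewrite E mulrDl mulfK ?gt_eqF // opprD addrA subrr sub0r normrN.
rewrite ger0_norm ?divr_ge0 // ler_pdivrMr // mul1r ler_nat ltnW // ltn_mod //.
Qed.

(* Scaling the coefficients of a linear set by [n / n1] and rounding down changes the vector by a
   bounded amount only. *)
Lemma semilinear_scale (I : Type) (M : (I -> nat) -> Prop) (xs : seq I) (lam : R) :
  semilinear_set M -> 0 < lam ->
  exists N, forall (q : I -> R) (n1 n : nat) h1, (N <= n1)%N -> (N <= n)%N -> M h1 ->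
    \sum_(x <- xs) `|(h1 x)%:R - n1%:R * q x| <= lam * n1%:R ->
  exists h, M h /\ \sum_(x <- xs) `|(h x)%:R - n%:R * q x| <= 2 * lam * n%:R.
Proof.
case=> L HL lam0.
(* Rounding moves each coefficient by at most 1 and the offset is not scaled, so the error is
   governed by the offset and the sum of the generators. Summing over [L] makes [N] independent of
   the linear set in use. *)
pose w (p : (I -> nat) * seq (I -> nat)) := (\sum_(x <- xs) (p.1 x + \sum_(v <- p.2) v x))%N.
pose W := (\sum_(p <- L) w p)%N.
exists (Num.bound (2 * W%:R / lam)).+1 => q n1 n h1 Nn1 Nn /HL[i [iL [a [sa h1E]]]] H1.
move: iL sa h1E; set p := nth _ _ _ => iL sa h1E.
have n10 : (0 < n1)%N by apply: leq_trans Nn1.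
have n0 : (0 < n)%N by apply: leq_trans Nn.
have n1R : 0 < n1%:R :> R by rewrite ltr0n.
have nR : 0 < n%:R :> R by rewrite ltr0n.
have wW : (w p <= W)%N.
  by rewrite /W (big_nth (fun _ => 0%N, [::])) (bigD1_seq i) ?mem_index_iota ?iota_uniq //= leq_addr.
have big m : (Num.bound (2 * W%:R / lam) < m)%N -> (w p)%:R <= lam / 2 * m%:R :> R.
  move=> Hm; apply: le_trans (_ : W%:R <= _); first by rewrite ler_nat.
  have : 2 * W%:R / lam <= m%:R.
    apply: ltW; apply: lt_le_trans (archi_boundP _) _; first by rewrite divr_ge0 ?mulr_ge0 // ltW.
    by rewrite ler_nat ltnW.
  by rewrite ler_pdivrMr //; clear; lra.
have B1 := big _ Nn1; have B2 := big _ Nn.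
pose g m := (m * n %/ n1)%N; pose rho : R := n%:R / n1%:R.
have rho0 : 0 <= rho by rewrite divr_ge0 // ltW.
have rhoE : rho * n1%:R = n%:R by rewrite divfK // gt_eqF.
exists (lin_comb p.1 p.2 (map g a)); split.
  by apply/HL; exists i; split=> //; exists (map g a); rewrite size_map.
have step x : `|(lin_comb p.1 p.2 (map g a) x)%:R - n%:R * q x| <=
    (1 + rho) * (p.1 x + \sum_(v <- p.2) v x)%N%:R + rho * `|(h1 x)%:R - n1%:R * q x|.
  have := lin_comb_scale p.2 a x (fun m => floor_scale n m n10).
  rewrite h1E /lin_comb -/rho -/g 3!natrD.
  set z1 := (\sum_(_ <- zip (map _ _) _) _)%N; set z2 := (\sum_(_ <- zip a _) _)%N.
  set z3 := (\sum_(v <- p.2) v x)%N => Hz.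
  have -> : (p.1 x)%:R + z1%:R - n%:R * q x = (1 - rho) * (p.1 x)%:R + (z1%:R - rho * z2%:R)
     + rho * ((p.1 x)%:R + z2%:R - n1%:R * q x).
    by rewrite -rhoE; ring.
  apply: le_trans (ler_normD _ _) _; rewrite normrM (ger0_norm rho0) lerD2r.
  apply: le_trans (ler_normD _ _) _; rewrite normrM normr_nat mulrDr; apply: lerD.
    apply: ler_wpM2r; rewrite ?ler0n //; apply: le_trans (ler_normB _ _) _.
    by rewrite normr1 (ger0_norm rho0).
  by apply: le_trans Hz _; rewrite mulrDl mul1r lerDl mulr_ge0.
apply: le_trans (ler_sum _ (fun x _ => step x)) _.
rewrite big_split /= -!mulr_sumr -natr_sum -/(w p).
have H2 := ler_wpM2l rho0 H1.
have H3 := ler_wpM2l rho0 B1.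
have E1 : rho * (lam / 2 * n1%:R) = lam / 2 * n%:R by rewrite -rhoE; ring.
have E2 : rho * (lam * n1%:R) = lam * n%:R by rewrite -rhoE; ring.
move: H2 H3 B2; rewrite E1 E2; clear; lra.
Qed.

End Types.

(** * Concentration of the sampled type frequencies *)

Section Sampling.
Variable R : realType.

(* The expectation over [s] independent uniform samples, written with the recursion that
   [acc_prob] performs on a sequence of [IRand]. *)
Fixpoint Esamp (n s : nat) (f : seq nat -> R) : R :=
  if s is s'.+1 then (\sum_(x < n) Esamp n s' (fun l => f (val x :: l))) / n%:R else f [::].

Definition sample n s (l : seq nat) := (size l == s) && all (fun x => x < n)%N l.

Lemma Esamp_le n s f g : (forall l, sample n s l -> f l <= g l) -> Esamp n s f <= Esamp n s g.
Proof.
elim: s f g => [|s IH] f g H /=; first exact: H.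
rewrite ler_wpM2r ?invr_ge0 //; apply: ler_sum => x _; apply: IH => l /andP[H1 H2].
by apply: H; rewrite /sample /= eqSS H1 H2 ltn_ord.
Qed.

Lemma Esamp_eq n s f g : (forall l, sample n s l -> f l = g l) -> Esamp n s f = Esamp n s g.
Proof. by move=> H; apply/eqP; rewrite eq_le !Esamp_le // => l /H ->. Qed.

Lemma EsampD n s f g : Esamp n s (fun l => f l + g l) = Esamp n s f + Esamp n s g.
Proof.
elim: s f g => [|s IH] f g //=.
by rewrite -mulrDl -big_split /=; congr (_ / _); apply: eq_bigr => x _; rewrite IH.
Qed.

Lemma EsampZ n s c f : Esamp n s (fun l => c * f l) = c * Esamp n s f.
Proof.
elim: s f => [|s IH] f //=.
by rewrite mulrA mulr_sumr; congr (_ / _); apply: eq_bigr => x _; rewrite IH.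
Qed.

Lemma Esamp_cst n s c : (0 < n)%N -> Esamp n s (fun=> c) = c.
Proof.
move=> n0; elim: s => [|s IH] //=; rewrite IH sumr_const card_ord -[X in X / _]mulr_natr mulfK //.
by rewrite pnatr_eq0 -lt0n.
Qed.

Lemma Esamp_sum n s (T : Type) (r : seq T) (f : T -> seq nat -> R) :
  (0 < n)%N -> Esamp n s (fun l => \sum_(c <- r) f c l) = \sum_(c <- r) Esamp n s (f c).
Proof.
move=> n0; elim: r => [|c r IH].
  by rewrite big_nil -[RHS](Esamp_cst s 0 n0); apply: Esamp_eq => l _; rewrite big_nil.
by rewrite big_cons -IH -EsampD; apply: Esamp_eq => l _; rewrite big_cons.
Qed.

(** The offset [a] absorbs the samples already drawn, so that the induction goes through; the cross
    term vanishes because [g] has mean 0. *)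
Lemma Esamp_variance n s (g : nat -> R) (v a : R) : (0 < n)%N ->
  \sum_(x < n) g x = 0 -> \sum_(x < n) g x ^+ 2 <= v * n%:R ->
  Esamp n s (fun l => (a + \sum_(x <- l) g x) ^+ 2) <= a ^+ 2 + s%:R * v.
Proof.
move=> n0 g0 gv; have nR : 0 < n%:R :> R by rewrite ltr0n.
elim: s a => [|s IH] a /=; first by rewrite big_nil addr0 mul0r addr0.
rewrite ler_pdivrMr //.
apply: le_trans (_ : \sum_(x < n) ((a + g x) ^+ 2 + s%:R * v) <= _).
  apply: ler_sum => x _; apply: le_trans (IH (a + g x)); rewrite le_eqVlt; apply/orP; left.
  by apply/eqP; apply: Esamp_eq => l _; rewrite big_cons addrA.
rewrite big_split /= sumr_const card_ord.
have -> : \sum_(x < n) (a + g x) ^+ 2 = n%:R * a ^+ 2 + \sum_(x < n) g x ^+ 2.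
  rewrite (eq_bigr (fun x : 'I_n => a ^+ 2 + (2 * a) * g x + g x ^+ 2)); last first.
    by move=> x _; ring.
  rewrite !big_split /= sumr_const card_ord -mulr_sumr g0 mulr0 addr0.
  by rewrite -[a ^+ 2 *+ n]mulr_natl.
rewrite -[(s%:R * v) *+ n]mulr_natr -natr1; move: gv; clear; lra.
Qed.

Lemma ler_sum_mem (T : eqType) (r : seq T) (f : T -> R) c :
  c \in r -> (forall c, 0 <= f c) -> f c <= \sum_(c <- r) f c.
Proof. by move=> cr f0; rewrite (big_rem c) //= lerDl sumr_ge0. Qed.

Section Test.
Variables (k : nat) (ar : 'I_k -> nat).
Hypothesis ar_gt0 : forall Q, (0 < ar Q)%N.
Variable d : nat.
Implicit Types D : db ar.

Definition empty_code : Code ar := existT _ 0%N (set0, set0).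

Definition sample_type r D (x : nat) : Code ar :=
  if @insub _ (fun x => x < dn D)%N 'I_(dn D) x is Some v then canon r [set v] else empty_code.

Lemma sample_type_ord r D (v : 'I_(dn D)) : sample_type r D v = canon r [set v].
Proof. by rewrite /sample_type valK. Qed.

Definition freq (s : nat) (tys : seq (Code ar)) (c : Code ar) : R :=
  (count_mem c tys)%:R / s%:R.

(** Chebyshev for each type with tolerance [lam / size tl], then a union bound over the types; this
    is where the cube of [size tl] comes from. *)
Lemma sampling_concentrates r D (s : nat) (tl : seq (Code ar)) (lam : R) : (0 < dn D)%N -> 0 < lam ->
  3 * (size tl)%:R ^+ 3 <= lam ^+ 2 * s%:R -> (0 < s)%N ->
  Esamp (dn D) s (fun l => (~~ (\sum_(c <- tl)
     `|(hcount r D c)%:R - (dn D)%:R * freq s (map (sample_type r D) l) c| <= lam * (dn D)%:R))%:R) <= 1 / 3.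
Proof.
move=> n0 lam0 Hs s0; set n := dn D in n0 *.
have nR : 0 < n%:R :> R by rewrite ltr0n.
have sR : 0 < s%:R :> R by rewrite ltr0n.
pose T : R := (size tl)%:R.
have T0 : 0 <= T by rewrite ler0n.
pose p c : R := (hcount r D c)%:R / n%:R.
pose g c x : R := (sample_type r D x == c)%:R - p c.
have p01 c : 0 <= p c <= 1.
  rewrite divr_ge0 //= ler_pdivrMr // mul1r ler_nat.
  by apply: leq_trans (max_card _) _; rewrite card_ord.
have gsum c : \sum_(x < n) g c x = 0.
  rewrite sumrB sumr_const card_ord -[X in _ - X]mulr_natr divfK ?gt_eqF //.
  apply/eqP; rewrite subr_eq0 -natr_sum; apply/eqP; congr (_%:R).
  rewrite /hcount -sum1dep_card [RHS]big_mkcond.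
  by apply: eq_bigr => x _ /=; rewrite sample_type_ord; case: (_ == c).
have gvar c : \sum_(x < n) g c x ^+ 2 <= 1 * n%:R.
  apply: le_trans (_ : \sum_(x < n) 1 <= _); last by rewrite sumr_const card_ord mul1r.
  apply: ler_sum => x _; rewrite /g; have /andP[] := p01 c.
  by case: (_ == c) => /= h1 h2; rewrite expr2; nra.
have fE c l : size l = s -> n%:R * freq s (map (sample_type r D) l) c - (hcount r D c)%:R =
    n%:R / s%:R * \sum_(x <- l) g c x.
  move=> sl; have -> : \sum_(x <- l) g c x = (count_mem c (map (sample_type r D) l))%:R - s%:R * p c.
    rewrite sumrB big_const_seq count_predT iter_addr_0 sl [s%:R * _]mulr_natl; congr (_ - _).
    rewrite -natr_sum count_map -sum1_count [X in _ = X%:R]big_mkcond /=; congr (_%:R).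
  rewrite /freq /p; field; by rewrite !gt_eqF.
have [tl0|tl0] := posnP (size tl).
  rewrite (size0nil tl0); apply: le_trans (_ : Esamp n s (fun=> 0) <= _).
    have ln : 0 <= lam * n%:R by apply: mulr_ge0; exact: ltW.
    by apply: Esamp_le => l _; rewrite big_nil ln.
  by rewrite Esamp_cst // divr_ge0.
have TR : 0 < T by rewrite ltr0n.
(* Normalised so that [f c l] reaches 1 exactly when the count of [c] is off by [lam * n / T]. *)
pose K : R := (T / (lam * s%:R)) ^+ 2.
pose f c (l : seq nat) : R := K * (0 + \sum_(x <- l) g c x) ^+ 2.
apply: le_trans (_ : Esamp n s (fun l => \sum_(c <- tl) f c l) <= _).
  apply: Esamp_le => l /andP[/eqP sl _].
  have pos c : 0 <= f c l by rewrite mulr_ge0 ?sqr_ge0.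
  set good := (X in (~~ X)%:R); case: (boolP good) => Hg; first by rewrite sumr_ge0.
  rewrite [X in X <= _](_ : _ = 1) // leNgt; apply/negP => Hlt; move/negP: Hg; apply.
  have bnd c : c \in tl -> `|(hcount r D c)%:R - n%:R * freq s (map (sample_type r D) l) c| <= lam * n%:R / T.
    move=> cl; have ns0 : 0 <= n%:R / s%:R :> R by apply: divr_ge0; exact: ltW.
    rewrite distrC fE // normrM (ger0_norm ns0).
    have h1 : f c l <= 1 := le_trans (ler_sum_mem cl pos) (ltW Hlt).
    have KE : f c l = (n%:R / s%:R * `|\sum_(x <- l) g c x| / (lam * n%:R / T)) ^+ 2.
      rewrite /f add0r /K; move: (\sum_(x <- l) g c x) => z.
      rewrite -(real_normK (num_real z)); field.
      by rewrite !gt_eqF // mulr_gt0.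
    have q0 : 0 < lam * n%:R / T by rewrite divr_gt0 // mulr_gt0.
    have z0 : 0 <= n%:R / s%:R * `|\sum_(x <- l) g c x| by rewrite mulr_ge0 // divr_ge0.
    move: h1; rewrite KE; move: z0 (lam * n%:R / T) q0 => {KE}.
    move: (n%:R / s%:R * _) => z z0 q q0 h1.
    suff : z / q <= 1 by rewrite ler_pdivrMr // mul1r.
    by rewrite -ler_sqr ?nnegrE ?ler01 ?expr1n // divr_ge0 // ltW.
  apply: le_trans (_ : \sum_(c <- tl) lam * n%:R / T <= _).
    by rewrite big_seq [X in _ <= X]big_seq; apply: ler_sum.
  rewrite big_const_seq count_predT iter_addr_0 -[X in X <= _]mulr_natr.
  by rewrite divfK // gt_eqF.
rewrite Esamp_sum //.
apply: le_trans (_ : \sum_(c <- tl) K * s%:R <= _).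
  apply: ler_sum => c _; rewrite /f EsampZ ler_wpM2l ?sqr_ge0 //.
  have := Esamp_variance s 0 n0 (gsum c) (gvar c).
  by rewrite expr0n add0r mulr1.
rewrite big_const_seq count_predT iter_addr_0 -[X in X <= _]mulr_natr -/T /K.
have -> : (T / (lam * s%:R)) ^+ 2 * s%:R * T = T ^+ 3 / (lam ^+ 2 * s%:R).
  by field; rewrite !gt_eqF.
rewrite ler_pdivrMr; last by rewrite mulr_gt0 // exprn_gt0.
by move: Hs; rewrite -/T; clear; lra.
Qed.

End Test.
End Sampling.

Lemma ler_sum_in (R : numDomainType) (T : eqType) (tl : seq T) (f g : T -> R) :
  (forall c, c \in tl -> f c <= g c) -> \sum_(c <- tl) f c <= \sum_(c <- tl) g c.
Proof. by move=> H; rewrite big_seq [X in _ <= X]big_seq; apply: ler_sum. Qed.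

Section Decision.
Variables (R : realType) (k : nat) (ar : 'I_k -> nat).
Hypothesis ar_gt0 : forall Q, (0 < ar Q)%N.
Variable d : nat.
Implicit Types D : db ar.
Variables C P : db ar -> Prop.

Lemma sampling_test (eps : R) : (2 <= d)%N -> 0 < eps ->
  (forall D, C D -> degree_le D d) -> (forall D, P D -> C D) ->
  hyperfinite_on (R := R) C P -> (forall r, semilinear_set (hist_set r P)) ->
  exists r N s (G : seq (Code ar) -> bool), (0 < N)%N /\ forall D, C D -> (N <= dn D)%N ->
    (P D -> 2 / 3 <= Esamp (R := R) (dn D) s (fun l => (G (map (sample_type r D) l))%:R)) /\
    (eps_far_from eps d D P ->
       Esamp (R := R) (dn D) s (fun l => (G (map (sample_type r D) l))%:R) <= 1 / 3).
Proof.
move=> d2 eps0 HCd HPC Hhyp Hsl.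
have HPd D : P D -> degree_le D d by move/HPC/HCd.
have [r [lam0 lam00 [N0 Hloc]]] := locality ar_gt0 d2 eps0 HPd Hhyp.
(* One third for the deviation of the sample from [D], two thirds for the rescaled member of [P]. *)
pose lam := lam0 / 3.
have lam_gt0 : 0 < lam by rewrite divr_gt0.
have [tl [Utl Htl Htl']] := types_ex ar d r.
have /choice[X HX] : forall c, exists Xc : rdb ar, c \in tl ->
    forall D v, @nbhd_is _ _ r D v Xc = (@canon _ _ r D [set v] == c).
  move=> c; have [cl|cl] := boolP (c \in tl).
    by have [Xc HXc] := nbhd_is_canon (Htl' c cl); exists Xc.
  by exists (existT (fun X : db ar => 'I_(dn X)) (@DB k ar 1 (fun=> set0)) ord0).
have [N1 HN1] := semilinear_scale (map X tl) (Hsl r) lam_gt0.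
pose s := (Num.bound (3 * (size tl)%:R ^+ 3 / lam ^+ 2)).+1.
have Hs : 3 * (size tl)%:R ^+ 3 <= lam ^+ 2 * s%:R.
  have l2 : 0 < lam ^+ 2 by rewrite exprn_gt0.
  have h0 : 0 <= 3 * (size tl)%:R ^+ 3 / lam ^+ 2.
    by apply: divr_ge0; [apply: mulr_ge0 => //; exact: exprn_ge0 | exact: ltW].
  rewrite [X in _ <= X]mulrC -ler_pdivrMr //; apply: ltW; apply: lt_le_trans (archi_boundP h0) _.
  by rewrite ler_nat leqnSn.
pose N := (maxn N0 N1).+1.
have HN0 : (N0 <= N)%N by rewrite leqW // leq_maxl.
have HN1' : (N1 <= N)%N by rewrite leqW // leq_maxr.
pose near D (n : nat) tys lam := \sum_(c <- tl) `|(hcount r D c)%:R - n%:R * freq R s tys c| <= lam * n%:R.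
pose G tys := `[< exists D, [/\ P D, (N <= dn D)%N & near D (dn D) tys lam] >].
exists r, N, s, G; split=> // D CD ND.
have n0 : (0 < dn D)%N by apply: leq_trans ND.
have nR : 0 < (dn D)%:R :> R by rewrite ltr0n.
have bad := sampling_concentrates r n0 lam_gt0 Hs (isT : (0 < s)%N).
have one : Esamp (dn D) s (fun=> 1) = 1 :> R by rewrite Esamp_cst.
split.
  move=> PD.
  suff : 1 <= Esamp (dn D) s (fun l => (G (map (sample_type r D) l))%:R) + 1 / 3 :> R by lra.
  apply: le_trans (lerD (lexx _) bad); rewrite -EsampD.
  apply: le_trans (_ : Esamp (dn D) s (fun=> 1) <= _); first by rewrite one.
  apply: Esamp_le => l _.
  set g := (X in _ + (~~ X)%:R); case: (boolP g) => /= Hg; last by rewrite lerDr ler0n.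
  rewrite addr0; suff -> : G (map (sample_type r D) l) by [].
  by apply/asboolP; exists D.
(* Untypical samples have probability at most 1/3, so a larger acceptance probability yields one
   sample that is both accepted and typical. The rest is deterministic. *)
move=> far; rewrite leNgt; apply/negP => Hacc.
have [l [Hl Gl gl]] : exists l, [/\ sample (dn D) s l, G (map (sample_type r D) l) & near D (dn D) (map (sample_type r D) l) lam].
  apply: contrapT => Hno.
  have : Esamp (dn D) s (fun l => (G (map (sample_type r D) l))%:R) <=
    Esamp (dn D) s (fun l => (~~ (\sum_(c <- tl)
     `|(hcount r D c)%:R - (dn D)%:R * freq R s (map (sample_type r D) l) c| <= lam * (dn D)%:R))%:R) :> R.
    apply: Esamp_le => l Hl; case EG: (G _); last by rewrite ler0n.
    set g := (X in (~~ X)%:R); case Eg: g => //.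
    by case: Hno; exists l.
  by move: bad Hacc; lra.
case/asboolP: Gl => D1 [PD1 ND1 near1].
have histE D2 c : c \in tl -> hist r D2 (X c) = hcount r D2 c.
  by move=> cl; apply: hist_hcount => v; exact: HX.
(* [semilinear_scale] expects frequencies indexed by rooted databases; [q] looks up the code that a
   rooted database represents. *)
pose pr (Y : rdb ar) c := `[< forall D v, @nbhd_is _ _ r D v Y = (@canon _ _ r D [set v] == c) >].
pose q (Y : rdb ar) : R := freq R s (map (sample_type r D) l)
   (odflt (empty_code ar) (ohead (filter (pr Y) tl))).
have qX c : c \in tl -> q (X c) = freq R s (map (sample_type r D) l) c.
  move=> cl; rewrite /q; congr (freq _ _ _ _).
  have : c \in filter (pr (X c)) tl by rewrite mem_filter cl andbT; apply/asboolP; exact: HX.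
  case E: (filter _ _) => [|c' cs] // _ /=.
  have : c' \in c' :: cs by rewrite inE eqxx.
  rewrite -E mem_filter => /andP[/asboolP H _].
  have [D2 [v2 E2]] := Htl' c cl.
  by have := H D2 v2; rewrite HX // E2 eqxx => /esym/eqP.
have h1M : hist_set r P (hist r D1) by exists D1.
have H1 : \sum_(x <- map X tl) `|(hist r D1 x)%:R - (dn D1)%:R * q x| <= lam * (dn D1)%:R.
  rewrite big_map; apply: le_trans (ler_sum_in _) near1 => c cl.
  exact: (eq_ind_r (fun z => z <= _) (lexx _)
    (congr2 (fun (x : nat) y => `|x%:R - (dn D1)%:R * y|) (histE D1 c cl) (qX c cl))).
have [h [[D2 [PD2 hD2]] H2]] := HN1 q (dn D1) (dn D) _ (leq_trans HN1' ND1) (leq_trans HN1' ND) h1M H1.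
apply: (far D2 PD2); apply: Hloc => //.
- exact: HCd.
- exact: leq_trans ND.
exists tl; split=> //.
- by move=> v; apply: Htl; exact: HPd.
- by move=> v; apply: Htl; exact: HCd.
apply: le_trans (_ : \sum_(c <- tl) (`|(hcount r D2 c)%:R - (dn D)%:R * freq R s (map (sample_type r D) l) c|
   + `|(hcount r D c)%:R - (dn D)%:R * freq R s (map (sample_type r D) l) c|) <= _).
  apply: ler_sum => c _; rewrite [X in _ <= _ + X]distrC.
  exact: ler_distD.
rewrite big_split /=.
have H3 : \sum_(c <- tl) `|(hcount r D2 c)%:R - (dn D)%:R * freq R s (map (sample_type r D) l) c| <= 2 * lam * (dn D)%:R.
  rewrite big_map in H2; apply: le_trans (ler_sum_in _) H2 => c cl.
  exact: (eq_ind_r (fun z => _ <= z) (lexx _)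
    (congr2 (fun (x : nat) y => `|x%:R - (dn D)%:R * y|) (etrans (hD2 (X c)) (histE D2 c cl)) (qX c cl))).
apply: le_trans (lerD H3 gl) _; rewrite le_eqVlt; apply/orP; left; apply/eqP.
by rewrite /lam; field.
Qed.

End Decision.

Local Close Scope ring_scope.

(** * The RAM program *)

Lemma write_seqE s b regs x :
  write_seq s b regs x = if b <= x < b + size s then nth 0 s (x - b) else regs x.
Proof.
elim: s b regs => [|v s IH] b regs /=; first by rewrite addn0 ltnNge; case: (b <= x).
rewrite IH /upd addSnnS; have [bx|bx|->] := ltngtP b x.
- by rewrite subnS -[(x - b)%N](prednK (_ : 0 < x - b)) ?subn_gt0.
- by [].
- by rewrite subnn addnS ltnS leq_addr.
Qed.

Section Semantics.
Variables (k : nat) (ar : 'I_k -> nat) (D : db ar) (rep : reprT D).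
Variable R : realType.

Definition straight (i : instr) :=
  match i with IConst _ _ => true | IQuery _ _ _ _ => true | _ => false end.

Definition step (regs : nat -> nat) (i : instr) : nat -> nat :=
  match i with
  | IConst dst c => upd regs dst c
  | IQuery rl i j dst => write_answer (oracle rep (regs rl) (regs i) (regs j)) dst regs
  | _ => regs
  end.

Lemma nth_mid (pre post : seq instr) i : nth IReject (pre ++ i :: post) (size pre) = i.
Proof. by rewrite nth_cat ltnn subnn. Qed.

Lemma acc_straight (pre ins post : seq instr) fuel regs : all straight ins ->
  acc_prob (R := R) (pre ++ ins ++ post) rep (size ins + fuel) (size pre) regs =
  acc_prob (pre ++ ins ++ post) rep fuel (size pre + size ins) (foldl step regs ins).
Proof.
elim: ins pre regs => [|i ins IH] pre regs; first by rewrite /= addn0.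
case/andP=> si sis; rewrite [size _]/= -addSnnS addSn /= nth_mid.
have E : pre ++ i :: ins ++ post = rcons pre i ++ ins ++ post by rewrite cat_rcons.
have := fun regs => IH (rcons pre i) regs sis; rewrite -E size_rcons => IH'.
by case: i si {E IH} IH' => //= *.
Qed.

Lemma halts_straight (pre ins post : seq instr) fuel regs : all straight ins ->
  halts (pre ++ ins ++ post) rep (size ins + fuel) (size pre) regs =
  halts (pre ++ ins ++ post) rep fuel (size pre + size ins) (foldl step regs ins).
Proof.
elim: ins pre regs => [|i ins IH] pre regs; first by rewrite /= addn0.
case/andP=> si sis; rewrite [size _]/= -addSnnS addSn /= nth_mid.
have E : pre ++ i :: ins ++ post = rcons pre i ++ ins ++ post by rewrite cat_rcons.
have := fun regs => IH (rcons pre i) regs sis; rewrite -E size_rcons => IH'.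
by case: i si {E IH} IH' => //= *.
Qed.

Definition rands a s := [seq IRand x 0 | x <- iota a s].

Lemma size_rands a s : size (rands a s) = s.
Proof. by rewrite size_map size_iota. Qed.

Lemma acc_rands (pre post : seq instr) a s fuel regs n : 0 < a -> 0 < n -> regs 0 = n ->
  acc_prob (R := R) (pre ++ rands a s ++ post) rep (s + fuel) (size pre) regs =
  Esamp n s (fun l => acc_prob (pre ++ rands a s ++ post) rep fuel (size pre + s) (write_seq l a regs)).
Proof.
move=> a0 n0; elim: s a a0 pre regs => [|s IH] a a0 pre regs r0; first by rewrite /= addn0.
rewrite -addSnnS addSn /= nth_mid r0; case: n n0 IH r0 => // n n0 IH r0; congr (_ / _)%R.
apply: eq_bigr => x _.
have E : pre ++ IRand a 0 :: rands a.+1 s ++ post = rcons pre (IRand a 0) ++ rands a.+1 s ++ post.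
  by rewrite cat_rcons.
rewrite E -(size_rcons pre (IRand a 0)) IH //; last by rewrite /upd; case: a a0 {IH E}.
Qed.

Lemma acc_rands0 (pre post : seq instr) a s fuel regs : 0 < a -> regs 0 = 0 ->
  acc_prob (R := R) (pre ++ rands a s ++ post) rep (s + fuel) (size pre) regs =
  acc_prob (pre ++ rands a s ++ post) rep fuel (size pre + s) (write_seq (nseq s 0) a regs).
Proof.
move=> a0; elim: s a a0 pre regs => [|s IH] a a0 pre regs r0; first by rewrite /= addn0.
rewrite -addSnnS addSn /= nth_mid r0.
have E : pre ++ IRand a 0 :: rands a.+1 s ++ post = rcons pre (IRand a 0) ++ rands a.+1 s ++ post.
  by rewrite cat_rcons.
rewrite E -(size_rcons pre (IRand a 0)) IH //; last by rewrite /upd; case: a a0 {IH E}.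
Qed.

Lemma halts_rands (pre post : seq instr) a s fuel regs :
  (forall l, size l = s -> halts (pre ++ rands a s ++ post) rep fuel (size pre + s) (write_seq l a regs)) ->
  halts (pre ++ rands a s ++ post) rep (s + fuel) (size pre) regs.
Proof.
elim: s a pre regs => [|s IH] a pre regs H; first by have := H [::]; rewrite /= addn0 => ->.
rewrite addSn /= nth_mid.
have E : pre ++ IRand a 0 :: rands a.+1 s ++ post = rcons pre (IRand a 0) ++ rands a.+1 s ++ post.
  by rewrite cat_rcons.
have H' x : halts (pre ++ IRand a 0 :: rands a.+1 s ++ post) rep (s + fuel) (size pre).+1 (upd regs a x).
  rewrite E -(size_rcons pre (IRand a 0)); apply: IH => l sl.
  by rewrite -E size_rcons addSnnS; apply: (H (x :: l)); rewrite /= sl.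
by case: (regs 0) => [|n]; [exact: H' | apply/forallP=> x; exact: H'].
Qed.

(** Jump targets are absolute, hence the address [off]. The branch for false follows the test
    directly, then comes the branch for true; [chi] is evaluated only at the leaves, while the
    program is being built. *)
Fixpoint decision_tree (off : nat) (ps : seq (nat * nat)) (chi : seq bool -> bool) : seq instr :=
  match ps with
  | [::] => [:: if chi [::] then IAccept else IReject]
  | p :: ps' =>
      let t0 := decision_tree off.+1 ps' (fun bs => chi (false :: bs)) in
      IJle p.1 p.2 (off.+1 + size t0) :: t0 ++
        decision_tree (off.+1 + size t0) ps' (fun bs => chi (true :: bs))
  end.

Definition comparisons (ps : seq (nat * nat)) (regs : nat -> nat) : seq bool :=
  [seq regs p.1 <= regs p.2 | p <- ps].

Lemma acc_jle (prog : seq instr) fuel pc regs a b t : nth IReject prog pc = IJle a b t ->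
  acc_prob (R := R) prog rep fuel.+1 pc regs =
  acc_prob prog rep fuel (if regs a <= regs b then t else pc.+1) regs.
Proof. by move=> /= ->. Qed.

Lemma halts_jle (prog : seq instr) fuel pc regs a b t : nth IReject prog pc = IJle a b t ->
  halts prog rep fuel.+1 pc regs =
  halts prog rep fuel (if regs a <= regs b then t else pc.+1) regs.
Proof. by move=> /= ->. Qed.

Lemma acc_tree (pre post : seq instr) ps chi regs :
  acc_prob (R := R) (pre ++ decision_tree (size pre) ps chi ++ post) rep (size ps).+1 (size pre) regs =
  ((chi (comparisons ps regs))%:R)%R.
Proof.
elim: ps chi pre post => [|p ps IH] chi pre post.
  by rewrite /= nth_mid; case: (chi [::]).
pose t0 := decision_tree (size pre).+1 ps (fun bs => chi (false :: bs)).
pose t1 := decision_tree ((size pre).+1 + size t0) ps (fun bs => chi (true :: bs)).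
pose i0 := IJle p.1 p.2 ((size pre).+1 + size t0).
have -> : decision_tree (size pre) (p :: ps) chi = i0 :: t0 ++ t1 by [].
have E0 : pre ++ (i0 :: t0 ++ t1) ++ post = rcons pre i0 ++ t0 ++ t1 ++ post.
  by rewrite cat_rcons /= -catA.
have E1 : pre ++ (i0 :: t0 ++ t1) ++ post = (rcons pre i0 ++ t0) ++ t1 ++ post.
  by rewrite E0 -catA.
have S0 : (size pre).+1 = size (rcons pre i0) by rewrite size_rcons.
have S1 : (size pre).+1 + size t0 = size (rcons pre i0 ++ t0) by rewrite size_cat size_rcons.
rewrite [size (p :: ps)]/= (acc_jle _ _ (nth_mid pre ((t0 ++ t1) ++ post) i0)) -cat_cons.
rewrite [comparisons _ _]/=; case: (regs p.1 <= regs p.2).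
  by rewrite E1 [X in acc_prob _ _ _ X]S1 /t1 S1 IH.
by rewrite E0 [X in acc_prob _ _ _ X]S0 /t0 S0 IH.
Qed.

Lemma halts_tree (pre post : seq instr) ps chi regs :
  halts (pre ++ decision_tree (size pre) ps chi ++ post) rep (size ps).+1 (size pre) regs.
Proof.
elim: ps chi pre post => [|p ps IH] chi pre post.
  by rewrite /= nth_mid; case: (chi [::]).
pose t0 := decision_tree (size pre).+1 ps (fun bs => chi (false :: bs)).
pose t1 := decision_tree ((size pre).+1 + size t0) ps (fun bs => chi (true :: bs)).
pose i0 := IJle p.1 p.2 ((size pre).+1 + size t0).
have -> : decision_tree (size pre) (p :: ps) chi = i0 :: t0 ++ t1 by [].
have E0 : pre ++ (i0 :: t0 ++ t1) ++ post = rcons pre i0 ++ t0 ++ t1 ++ post.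
  by rewrite cat_rcons /= -catA.
have E1 : pre ++ (i0 :: t0 ++ t1) ++ post = (rcons pre i0 ++ t0) ++ t1 ++ post.
  by rewrite E0 -catA.
have S0 : (size pre).+1 = size (rcons pre i0) by rewrite size_rcons.
have S1 : (size pre).+1 + size t0 = size (rcons pre i0 ++ t0) by rewrite size_cat size_rcons.
rewrite [size (p :: ps)]/= (halts_jle _ _ (nth_mid pre ((t0 ++ t1) ++ post) i0)) -cat_cons.
case: (regs p.1 <= regs p.2).
  by rewrite E1 [X in halts _ _ _ X]S1 /t1 S1 IH.
by rewrite E0 [X in halts _ _ _ X]S0 /t0 S0 IH.
Qed.

End Semantics.

(** * Exploration of neighbourhoods by oracle queries *)

Section Explore.
Variables (k : nat) (ar : 'I_k -> nat) (d N s r : nat).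
Implicit Types D : db ar.

(* Register 0 holds the size, register [i.+1] the constant [i], then come the [s] samples; these are
   the registers of level 0. Every register of a level is taken for an element and queried for all
   relations and positions, and the answers form the next level. Registers that hold no element are
   queried as well, which is harmless. *)
Definition num_const := k + d + N + 2.
Definition query_base := num_const.+1 + s.
Definition block := (maxar ar).+1.
Fixpoint level l := if l is l'.+1 then query_base + level l' * (k * d) * block else query_base.
Definition query_dst i := query_base + i * block.
(** For [i = (e * k + Q) * d + j] this asks for the [j]-th tuple of relation [Q] at the element in
    register [e]; the successors reflect that the constant [c] sits in register [c.+1]. A block
    holds the answer flag and up to [maxar] entries. *)
Definition query i := IQuery ((i %/ d) %% k).+1 (i %/ (k * d)) (i %% d).+1 (query_dst i).
Definition nquery := level r * (k * d).

Definition consts := [seq IConst i.+1 i | i <- iota 0 num_const].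
Definition queries := [seq query i | i <- iota 0 nquery].

Record view D (rep : reprT D) (l : seq nat) (F : nat -> nat) : Prop := View {
  view_size : F 0 = dn D;
  view_const : forall i, i < num_const -> F i.+1 = i;
  view_sample : forall i, i < s -> F (num_const.+1 + i) = nth 0 l i;
  view_query : forall e (Q : 'I_k) j, e < level r -> j < d ->
    let a := query_dst ((e * k + Q) * d + j) in
    match oracle rep Q (F e) j with
    | Some sq => F a = 1 /\ forall i, i < size sq -> F (a.+1 + i) = nth 0 sq i
    | None => F a = 0
    end
}.

Lemma foldl_consts D (rep : reprT D) regs a n x :
  foldl (step rep) regs [seq IConst i.+1 i | i <- iota a n] x = if a < x <= a + n then x.-1 else regs x.
Proof.
elim: n a regs => [|n IH] a regs /=; first by rewrite addn0; case: ltngtP.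
rewrite IH /upd; case: (x =P a.+1) => [->|/eqP ne]; first by rewrite ltnn ltnSn addnS ltnS leq_addr.
rewrite addSnnS; congr (if _ then _ else _); congr (_ && _).
by rewrite [LHS]ltn_neqAle eq_sym ne.
Qed.

Lemma size_oracle D (rep : reprT D) a b c sq : oracle rep a b c = Some sq -> size sq <= maxar ar.
Proof.
rewrite /oracle; case: insubP => // Q _ _; case: insubP => // v _ _.
case: (drop c (rep Q v)) => //= t _ [<-].
by rewrite size_map size_enum_ord; exact: leq_bigmax.
Qed.

Lemma write_answer_lt ans a regs x : x < a -> write_answer ans a regs x = regs x.
Proof.
move=> xa; rewrite /write_answer; case: ans => [sq|]; rewrite /upd (ltn_eqF xa) //.
by rewrite write_seqE leqNgt ltnS (ltnW xa).
Qed.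

Lemma write_answer_spec ans a regs : match ans with
    | Some sq => write_answer ans a regs a = 1 /\
        forall i, i < size sq -> write_answer ans a regs (a.+1 + i) = nth 0 sq i
    | None => write_answer ans a regs a = 0 end.
Proof.
rewrite /write_answer; case: ans => [sq|]; rewrite /upd eqxx //; split=> // i isz.
rewrite gtn_eqF; last by rewrite addSn ltnS leq_addr.
by rewrite write_seqE leq_addr ltn_add2l isz addKn.
Qed.

Lemma query_index e (Q : 'I_k) j : e < level r -> j < d ->
  let i := (e * k + Q) * d + j in
  [/\ i < nquery, (i %/ d) %% k = Q, i %/ (k * d) = e & i %% d = j].
Proof.
move=> el jd i; have d0 : 0 < d by apply: leq_trans jd.
have k0 : 0 < k by apply: leq_trans (ltn_ord Q).
have E1 : i %/ d = e * k + Q by rewrite divnMDl // divn_small // addn0.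
split.
- rewrite /nquery; apply: (@leq_trans ((e * k + Q).+1 * d)).
    by rewrite /i mulSn [X in _ < X]addnC ltn_add2l.
  rewrite mulnA leq_mul2r; apply/orP; right.
  apply: (@leq_trans (e.+1 * k)); last by rewrite leq_mul2r el orbT.
  by rewrite mulSn [X in _ < X]addnC ltn_add2l ltn_ord.
- by rewrite E1 modnMDl modn_small.
- by rewrite [k * d]mulnC divnMA E1 divnMDl // divn_small // addn0.
- by rewrite modnMDl modn_small.
Qed.

Lemma lev_ge l : query_base <= level l.
Proof. by case: l => [|l] //=; exact: leq_addr. Qed.

Lemma dst_gt i : i < query_dst i.
Proof. by rewrite /query_dst /query_base addSn ltnS; apply: leq_trans (leq_addl _ _); rewrite leq_pmulr. Qed.

(** Query [i] writes above the constants, the samples, the blocks of earlier queries and, by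
    [dst_gt], the register it reads. So what holds right after a query still holds at the end. *)
Lemma view_run D (rep : reprT D) l : size l = s ->
  view rep l (foldl (step rep) (write_seq l num_const.+1 (foldl (step rep) (init_regs D) consts)) queries).
Proof.
move=> sl; set R1 := foldl _ _ consts; set R2 := write_seq _ _ _.
pose st n := foldl (step rep) R2 [seq query i | i <- iota 0 n].
pose spec (F : nat -> nat) i :=
  match oracle rep (F ((i %/ d) %% k).+1) (F (i %/ (k * d))) (F (i %% d).+1) with
    | Some sq => F (query_dst i) = 1 /\ forall x, x < size sq -> F ((query_dst i).+1 + x) = nth 0 sq x
    | None => F (query_dst i) = 0
    end.
have R1E x : R1 x = if 0 < x <= num_const then x.-1 else init_regs D x.
  by rewrite /R1 /consts foldl_consts add0n.
have R2E x : R2 x = if num_const < x < query_base then nth 0 l (x - num_const.+1) else R1 x.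
  by rewrite /R2 write_seqE sl.
have dst_base i x : x < query_base -> x < query_dst i by move=> H; apply: leq_trans H (leq_addr _ _).
have inv n : n <= nquery -> (forall x, x < query_base -> st n x = R2 x) /\ (forall i, i < n -> spec (st n) i).
  elim: n => [|n IH] nn; first by split.
  have [IH1 IH2] := IH (ltnW nn).
  have E : st n.+1 = write_answer (oracle rep (st n ((n %/ d) %% k).+1) (st n (n %/ (k * d)))
      (st n (n %% d).+1)) (query_dst n) (st n).
    by rewrite /st -addn1 iotaD map_cat foldl_cat.
  have low x : x < query_dst n -> st n.+1 x = st n x by move=> H; rewrite E write_answer_lt.
  have kd0 : 0 < k * d by move: nn; rewrite /nquery; case: (k * d) => //; rewrite muln0.
  have [k0 d0] : 0 < k /\ 0 < d by move: kd0; rewrite muln_gt0 => /andP[].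
  have cst i : ((i %/ d) %% k).+1 < query_base /\ (i %% d).+1 < query_base.
    have := ltn_pmod (i %/ d) k0; have := ltn_pmod i d0; rewrite /query_base /num_const.
    by move: (i %% d) ((i %/ d) %% k) => a b; lia.
  split; first by move=> x xb; rewrite low ?IH1 // dst_base.
  move=> i; rewrite ltnS leq_eqVlt => /orP[/eqP ->|il].
    have [c1 c2] := cst n.
    have e1 : n %/ (k * d) < query_dst n by apply: leq_ltn_trans (leq_div _ _) (dst_gt n).
    rewrite /spec (low _ (dst_base n _ c1)) (low _ (dst_base n _ c2)) (low _ e1) E.
     exact: write_answer_spec.
  have := IH2 i il; rewrite /spec; have [c1 c2] := cst i.
  have dd : (query_dst i).+1 + maxar ar <= query_dst n.
    by rewrite /query_dst addSnnS -/block -addnA leq_add2l -mulSnr leq_mul2r il orbT.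
  have di : query_dst i < query_dst n by apply: leq_trans dd; rewrite ltnS leq_addr.
  have e1 : i %/ (k * d) < query_dst n by apply: leq_ltn_trans (leq_div _ _) (ltn_trans (dst_gt i) di).
  rewrite (low _ (dst_base n _ c1)) (low _ (dst_base n _ c2)) (low _ e1) (low _ di).
  case Eo: (oracle _ _ _ _) => [sq|] //= [H1 H2]; split=> // x xs.
  rewrite low ?H2 //; apply: leq_trans dd; rewrite ltn_add2l; apply: leq_trans xs _.
  exact: size_oracle Eo.
have [H1 H2] := inv _ (leqnn nquery).
have b0 : num_const < query_base by rewrite /query_base addSn ltnS leq_addr.
split.
- by rewrite -/(st _) H1 ?R2E ?R1E //= (leq_trans _ b0).
- move=> i ic; rewrite -/(st _) H1; last by apply: leq_ltn_trans b0.
  by rewrite R2E R1E /= ltnNge ic /= .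
- move=> i is'; rewrite -/(st _) H1; last by rewrite /query_base ltn_add2l.
  rewrite R2E addKn /query_base ltn_add2l is' addSn ltnS leq_addr //.
move=> e Q j el jd a; have [i1 i2 i3 i4] := query_index Q el jd.
have := H2 _ i1; rewrite /spec i2 i3 i4 -/(st _) -/a.
have -> : st nquery Q.+1 = Q.
  rewrite H1 ?R2E ?R1E; have := ltn_ord Q; rewrite /query_base /num_const; first last.
    by lia.
  move=> Qk; rewrite ltnNge [_ && (_ <= _)]/= (_ : Q < k + d + N + 2) //; lia.
have -> : st nquery j.+1 = j.
  rewrite H1 ?R2E ?R1E; rewrite /query_base /num_const; first last.
    by lia.
  rewrite ltnNge [_ && (_ <= _)]/= (_ : j < k + d + N + 2) //; lia.
by [].
Qed.

End Explore.

Lemma size_tseq m n (t : {ffun 'I_m -> 'I_n}) : size (tseq t) = m.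
Proof. by rewrite size_map size_enum_ord. Qed.

Lemma nth_tseq m n (t : {ffun 'I_m -> 'I_n}) (i : 'I_m) : nth 0 (tseq t) i = t i.
Proof. by rewrite (nth_map i) ?size_enum_ord // nth_ord_enum. Qed.

(** * Isomorphic neighbourhoods from equal comparison patterns *)

Section Pattern.
Variables (k : nat) (ar : 'I_k -> nat).
Hypothesis ar_gt0 : forall Q, 0 < ar Q.
Variables (d N s r : nat).
Implicit Types D : db ar.

Notation lev := (level ar d N s).
Notation dst := (query_dst ar d N s).
Notation base := (query_base k d N s).
Notation view := (view d N s r).

Definition nregs := lev r.+1.

Definition same_pattern (F F' : nat -> nat) :=
  forall a b, a < nregs -> b < nregs -> (F a <= F b) = (F' a <= F' b).

Lemma same_pattern_sym F F' : same_pattern F F' -> same_pattern F' F.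
Proof. by move=> H a b al bl; rewrite H. Qed.

Lemma same_pattern_eq F F' a b : same_pattern F F' -> a < nregs -> b < nregs ->
  F a = F b -> F' a = F' b.
Proof.
move=> H al bl E; apply/eqP; rewrite eqn_leq -(H _ _ al bl) -(H _ _ bl al) E leqnn //.
Qed.

Lemma levS l : lev l <= lev l.+1.
Proof.
elim: l => [|l IH] /=; first exact: leq_addr.
by rewrite leq_add2l leq_mul2r leq_mul2r IH !orbT.
Qed.

Lemma lev_mono l l' : l <= l' -> lev l <= lev l'.
Proof.
move=> /subnKC <-; elim: (l' - l) => [|j IH]; first by rewrite addn0.
by rewrite addnS; apply: leq_trans IH (levS _).
Qed.

Lemma reg_lt l e (Q : 'I_k) j i : e < lev l -> j < d -> i <= ar Q ->
  dst ((e * k + Q) * d + j) + i < lev l.+1.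
Proof.
move=> el jd iQ; rewrite /= /query_dst -addnA ltn_add2l.
have : ((e * k + Q) * d + j).+1 <= lev l * (k * d).
  apply: (@leq_trans ((e * k + Q).+1 * d)).
    by rewrite mulSn [X in _ < X]addnC ltn_add2l.
  rewrite mulnA leq_mul2r; apply/orP; right.
  apply: (@leq_trans (e.+1 * k)); last by rewrite leq_mul2r el orbT.
  by rewrite mulSn [X in _ < X]addnC ltn_add2l ltn_ord.
move=> H; have {}H := leq_mul H (leqnn (block ar)); apply: leq_trans H.
rewrite mulSnr ltn_add2l /block ltnS; apply: leq_trans iQ _; exact: leq_bigmax.
Qed.

Lemma query_fwd D (rep : reprT D) l F e (Q : 'I_k) (v : 'I_(dn D)) (t : {ffun 'I_(ar Q) -> 'I_(dn D)}) :
  view rep l F -> degree_le D d -> valid_repr rep -> e < lev r -> F e = v ->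
  t \in drel D Q -> v \in codom t ->
  exists j, [/\ j < d, F (dst ((e * k + Q) * d + j)) = 1 &
     forall i : 'I_(ar Q), F ((dst ((e * k + Q) * d + j)).+1 + i) = t i].
Proof.
move=> vF Hd vr el Fe tD vt; have [Ur Hr] := vr Q v.
have tr : t \in rep Q v by rewrite Hr tD.
exists (index t (rep Q v)).
have jd : index t (rep Q v) < d.
  apply: leq_trans (Hd v); rewrite /elem_deg (bigD1 Q) //=; apply: leq_trans (leq_addr _ _).
  apply: (@leq_trans (size (rep Q v))); first by rewrite index_mem.
  rewrite -(card_uniqP Ur); apply: subset_leq_card; apply/subsetP=> u ur.
  by rewrite inE -Hr.
have := view_query vF Q el jd; rewrite /oracle Fe !valK.
rewrite (drop_nth t) ?index_mem // nth_index //= => -[H1 H2]; split=> // i.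
by rewrite H2 ?size_tseq // nth_tseq.
Qed.

Lemma query_bwd D (rep : reprT D) l F e (Q : 'I_k) (v : 'I_(dn D)) j :
  view rep l F -> valid_repr rep -> e < lev r -> F e = v -> j < d ->
  F (dst ((e * k + Q) * d + j)) != 0 ->
  exists t : {ffun 'I_(ar Q) -> 'I_(dn D)}, [/\ t \in drel D Q, v \in codom t &
     forall i : 'I_(ar Q), F ((dst ((e * k + Q) * d + j)).+1 + i) = t i].
Proof.
move=> vF vr el Fe jd; have [Ur Hr] := vr Q v.
have := view_query vF Q el jd; rewrite /oracle Fe !valK.
case Ed: (drop j (rep Q v)) => [|t ts] /=; first by move=> ->.
move=> [H1 H2] _; exists t.
have : t \in rep Q v by apply: (mem_drop (n0 := j)); rewrite Ed inE eqxx.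
rewrite Hr => /andP[-> ->]; split=> // i.
by rewrite H2 ?size_tseq // nth_tseq.
Qed.

(* Two registers are equal in one run iff they are equal in the other, so reading off the same
   register in both runs is a well-defined injective partial map. *)
Definition named (F F' : nat -> nat) l x x' := exists e, [/\ e < lev l, F e = x & F' e = x'].

Lemma named_sym F F' l x x' : named F F' l x x' -> named F' F l x' x.
Proof. by case=> e [? ? ?]; exists e. Qed.

Section Two.
Variables (D D' : db ar) (rep : reprT D) (rep' : reprT D') (l l' : seq nat) (F F' : nat -> nat).
Hypotheses (vF : view rep l F) (vF' : view rep' l' F').
Hypotheses (Hd : degree_le D d) (vr : valid_repr rep) (vr' : valid_repr rep').
Hypothesis HP : same_pattern F F'.

(** The query that reveals [t] in one run is made at the same register in the other run, and the
    equal pattern of its flag shows that a tuple is returned there too. *)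
Lemma named_tuple q (Q : 'I_k) (t : {ffun 'I_(ar Q) -> 'I_(dn D)}) (v : 'I_(dn D)) (v' : 'I_(dn D')) :
  q <= r -> t \in drel D Q -> v \in codom t -> named F F' q v v' ->
  exists t' : {ffun 'I_(ar Q) -> 'I_(dn D')}, [/\ t' \in drel D' Q, v' \in codom t' &
    forall i, named F F' q.+1 (t i) (t' i)].
Proof.
move=> qr tD vt [e [eq Fe Fe']].
have el : e < lev r := leq_trans eq (lev_mono qr).
have [j [jd F1 Ft]] := query_fwd vF Hd vr el Fe tD vt.
set a := dst _ in F1 Ft.
have al : a < nregs by have := reg_lt el jd (leq0n (ar Q)); rewrite addn0.
have c1 : 1 < nregs by apply: leq_ltn_trans al; rewrite /a /query_dst /query_base !addSn.
have z : F 1 = 0 by rewrite (view_const vF) // /num_const addn2.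
have z' : F' 1 = 0 by rewrite (view_const vF') // /num_const addn2.
(* The flag is compared with register 1, which holds 0 in both runs. *)
have F'a : F' a != 0 by rewrite -lt0n -z' ltnNge -HP // z F1.
have [t' [t'D vt' Ft']] := query_bwd vF' vr' el Fe' jd F'a.
exists t'; split=> // i; exists (a.+1 + i); split=> //.
by rewrite addSnnS; apply: reg_lt.
Qed.

Lemma named_nb (S : {set 'I_(dn D)}) (S' : {set 'I_(dn D')}) q x :
  (forall x, x \in S -> exists2 x' : 'I_(dn D'), x' \in S' & named F F' 0 x x') ->
  q <= r -> x \in nb q S -> exists2 x' : 'I_(dn D'), x' \in nb q S' & named F F' q x x'.
Proof.
move=> HS; elim: q x => [|q IH] x qr.
  by rewrite nb0 => /HS[x' H1 H2]; exists x'; rewrite ?nb0.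
have up y y' : named F F' q y y' -> named F F' q.+1 y y'.
  by case=> e [? ? ?]; exists e; split=> //; apply: leq_trans (levS _).
case/nbS => [H|[c cS /gadjP[cx [[Q t] [tD ct xt]]]]].
  have [x' H1 H2] := IH x (ltnW qr) H; exists x'; last exact: up.
  exact: (subsetP (nb_mono _ (leqnSn q))).
have [c' H1 H2] := IH c (ltnW qr) cS.
rewrite inE /= in tD; rewrite inE /= in ct.
have [t' [t'D c't' Ht']] := named_tuple (ltnW qr) tD ct H2.
move: xt => /entP[i Ex]; rewrite /= in i Ex; exists (t' i); last by rewrite Ex.
apply: (nb_tup H1 (t := Tagged (fun Q => {ffun 'I_(ar Q) -> 'I_(dn D')}) t')).
- by rewrite inE.
- by rewrite inE.
- by apply/entP; exists i.
Qed.
End Two.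

(** Elements of [nb r S] are named at level [r], but the entries of a tuple among them are matched
    only at level [r.+1]; therefore the maps search all [nregs] registers. [f0] and [g0] are mere
    defaults elsewhere. *)
Lemma pattern_nbhd_iso D D' (rep : reprT D) (rep' : reprT D') (l l' : seq nat) (F F' : nat -> nat)
   (S : {set 'I_(dn D)}) (S' : {set 'I_(dn D')}) (f0 : 'I_(dn D) -> 'I_(dn D')) (g0 : 'I_(dn D') -> 'I_(dn D)) :
  view rep l F -> view rep' l' F' -> degree_le D d -> degree_le D' d ->
  valid_repr rep -> valid_repr rep' -> same_pattern F F' ->
  (forall x, x \in S -> exists2 x' : 'I_(dn D'), x' \in S' & named F F' 0 x x') ->
  (forall x, x \in S' -> exists2 x' : 'I_(dn D), x' \in S & named F' F 0 x x') ->
  exists f g, nbhd_iso r S S' f g.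
Proof.
move=> vF vF' Hd Hd' vr vr' HP HS HS'; have HP' := same_pattern_sym HP.
pose mk D1 D2 (F1 F2 : nat -> nat) (h0 : 'I_(dn D1) -> 'I_(dn D2)) x :=
  odflt (h0 x) [pick x' : 'I_(dn D2) | [exists e : 'I_nregs, (F1 e == x) && (F2 e == x')]].
have mkE D1 D2 F1 F2 h0 (x : 'I_(dn D1)) (x' : 'I_(dn D2)) q : same_pattern F1 F2 -> q <= r.+1 ->
    named F1 F2 q x x' -> @mk D1 D2 F1 F2 h0 x = x'.
  move=> H12 qr Hn; have [e [el E1 E2]] := Hn.
  have en : e < nregs := leq_trans el (lev_mono qr).
  rewrite /mk; case: pickP => [x'' /existsP[e' /andP[/eqP E1' /eqP E2']]|/(_ x')] /=.
    apply: val_inj => /=; rewrite -E2' -E2; apply: (same_pattern_eq H12) => //; by rewrite E1 E1'.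
  by move=> /existsP; case; exists (Ordinal en); rewrite /= E1 E2 !eqxx.
pose f := mk D D' F F' f0; pose g := mk D' D F' F g0.
have fE (x : 'I_(dn D)) (x' : 'I_(dn D')) q : q <= r.+1 -> named F F' q x x' -> f x = x' by move=> *; apply: mkE; eauto.
have gE (x : 'I_(dn D)) (x' : 'I_(dn D')) q : q <= r.+1 -> named F F' q x x' -> g x' = x.
  by move=> qr /named_sym H; apply: mkE; eauto.
have fwd (x : 'I_(dn D)) : x \in nb r S -> [/\ f x \in nb r S', g (f x) = x & named F F' r x (f x)].
  move=> xS; have [x' H1 H2] := named_nb vF vF' Hd vr vr' HP HS (leqnn r) xS.
  by rewrite (fE _ _ _ (leqnSn r) H2) (gE _ _ _ (leqnSn r) H2).
have bwd (x : 'I_(dn D')) : x \in nb r S' -> [/\ g x \in nb r S, f (g x) = x & named F' F r x (g x)].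
  move=> xS; have [x' H1 H2] := named_nb vF' vF Hd' vr' vr HP' HS' (leqnn r) xS.
  have H3 := named_sym H2.
  by rewrite (gE _ _ _ (leqnSn r) H3) (fE _ _ _ (leqnSn r) H3).
have tupf D1 D2 rep1 rep2 l1 l2 F1 F2 (S1 : {set 'I_(dn D1)}) (h : 'I_(dn D1) -> 'I_(dn D2)) t :
   view (D := D1) rep1 l1 F1 -> view (D := D2) rep2 l2 F2 -> degree_le D1 d ->
   valid_repr rep1 -> valid_repr rep2 -> same_pattern F1 F2 ->
   (forall (x : 'I_(dn D1)) (x' : 'I_(dn D2)) q, q <= r.+1 -> named F1 F2 q x x' -> h x = x') ->
   (forall (x : 'I_(dn D1)), x \in nb r S1 -> named F1 F2 r x (h x)) ->
   ent t \subset nb r S1 -> t \in tups D1 -> tmapT h t \in tups D2.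
  move=> v1 v2 Hd1 vr1 vr2 H12 hE hN; case: t => Q t tS tD.
  rewrite inE /= in tD.
  pose i0 := Ordinal (ar_gt0 Q).
  have xt : t i0 \in codom t by exact: codom_f.
  have xS : t i0 \in nb r S1 by apply: (subsetP tS); apply/entP; exists i0.
  have [t' [t'D _ Ht']] := named_tuple v1 v2 Hd1 vr1 vr2 H12 (leqnn r) tD xt (hN _ xS).
  rewrite inE /=; suff -> : tmap h t = t' by [].
  by apply/ffunP=> i; rewrite ffunE; apply: hE (leqnn _) (Ht' i).
exists f, g; split.
- by move=> x /fwd[].
- by move=> x /bwd[].
- move=> x xS; have [fS gf nx] := fwd _ xS; apply/idP/idP => H.
    have [y yS Hy] := HS' _ H; rewrite -gf.
    by rewrite (gE _ _ 0 _ (named_sym Hy)).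
  by have [y yS Hy] := HS _ H; rewrite (fE _ _ 0 _ Hy).
- move=> t tS; apply/idP/idP.
    apply: (tupf D D' rep rep' l l' F F' S) => //.
    by move=> x /fwd[].
  have tS' : ent (tmapT f t) \subset nb r S'.
    by rewrite ent_map; apply/subsetP=> y /imsetP[x xt ->]; case: (fwd _ (subsetP tS _ xt)).
  have gft : tmapT g (tmapT f t) = t.
    by apply: tmapT_id => x xt; case: (fwd _ (subsetP tS _ xt)).
  move=> H; rewrite -gft.
  apply: (tupf D' D rep' rep l' l F' F S') H => //.
    by move=> x x' q qr /named_sym; exact: gE.
  by move=> x /bwd[].
Qed.

End Pattern.

Section Tester.
Variables (k : nat) (ar : 'I_k -> nat).
Hypothesis ar_gt0 : forall Q, 0 < ar Q.
Variables (d N s r : nat) (C P : db ar -> Prop) (G : seq (Code ar) -> bool).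
Hypothesis isoP : iso_closed P.
Hypothesis degC : forall D, C D -> degree_le D d.
Implicit Types D : db ar.

Definition decision D (l : seq nat) : bool :=
  if dn D < N then `[< P D >] else G (map (sample_type r D) l).

Notation nregs := (nregs ar d N s r).
Notation nconst := (num_const k d N).
Notation view := (view d N s r).

Lemma nbhd_iso_setT D D' f g : @nbhd_iso _ ar r D D' setT setT f g -> db_iso D D'.
Proof.
have T D1 (x : 'I_(dn D1)) : x \in nb r [set: 'I_(dn D1)] by apply: (subsetP (sub_nb _ _)); rewrite inE.
case=> H1 H2 H3 H4; exists f; split.
  by exists g => x; [case: (H1 x (T _ x)) | case: (H2 x (T _ x))].
move=> Q t; have /H4 : ent (Tagged (fun Q => {ffun 'I_(ar Q) -> 'I_(dn D)}) t) \subset nb r setT.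
  by apply/subsetP=> x _; exact: T.
by rewrite !inE.
Qed.

(** Comparing register 0 with the constant [N] tells small from large. In the large case
    corresponding samples have the same type. In the small case the size is one of the constants, so
    every element is named at level 0 and the whole databases are isomorphic. *)
Lemma decide_pattern D D' (rep : reprT D) (rep' : reprT D') l l' F F' :
  view rep l F -> view rep' l' F' -> C D -> C D' -> valid_repr rep -> valid_repr rep' ->
  size l = s -> size l' = s -> (0 < dn D -> all (fun x => x < dn D) l) ->
  (0 < dn D' -> all (fun x => x < dn D') l') ->
  same_pattern ar d N s r F F' -> 0 < N -> decision D l = decision D' l'.
Proof.
move=> vF vF' /degC dD /degC dD' vr vr' sl sl' al al' HP N0.
have HP' := same_pattern_sym HP.
have base_regs x : x < query_base k d N s -> x < nregs by move=> H; apply: leq_trans H (lev_ge _ _ _ _ _).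
have c_regs i : i < nconst -> i.+1 < nregs.
  by move=> H; apply: base_regs; rewrite /query_base addSn ltnS; apply: leq_trans H (leq_addr _ _).
have z_regs : 0 < nregs by apply: base_regs.
have cN : N < nconst by rewrite /num_const; lia.
have Nle : (N <= dn D) = (N <= dn D').
  have := HP _ _ (c_regs _ cN) z_regs.
  by rewrite !(view_const vF) ?(view_const vF') // (view_size vF) (view_size vF').
rewrite /decision !ltnNge -Nle; case: leqP => ND /=.
  have ND' : N <= dn D' by rewrite -Nle.
  congr G; apply: (@eq_from_nth _ (empty_code ar)); rewrite !size_map ?sl ?sl' // => i si.
  rewrite !(nth_map 0) ?sl ?sl' //.
  have lD : nth 0 l i < dn D by apply: (allP (al _)); rewrite ?mem_nth ?sl // (leq_trans N0).
  have lD' : nth 0 l' i < dn D' by apply: (allP (al' _)); rewrite ?mem_nth ?sl' // (leq_trans N0).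
  pose v := Ordinal lD; pose v' := Ordinal lD'.
  have [f [g L]] : exists f g, @nbhd_iso _ ar r D D' [set v] [set v'] f g.
    have ib : nconst.+1 + i < query_base k d N s by rewrite /query_base ltn_add2l.
    apply: (pattern_nbhd_iso ar_gt0 (fun=> v') (fun=> v) vF vF') => //.
      move=> x /set1P->; exists v'; first by rewrite inE.
      by exists (nconst.+1 + i); rewrite (view_sample vF) // (view_sample vF').
    move=> x /set1P->; exists v; first by rewrite inE.
    by exists (nconst.+1 + i); rewrite (view_sample vF) // (view_sample vF').
  by rewrite -[nth 0 l i]/(val v) -[nth 0 l' i]/(val v') !sample_type_ord; apply: nbhd_iso_canon L.
have Dc : dn D < nconst by lia.
have En : dn D = dn D'.
  have : F' 0 = F' (dn D).+1.
    by apply: (same_pattern_eq HP) => //; [exact: c_regs | rewrite (view_size vF) (view_const vF)].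
  by rewrite (view_size vF') (view_const vF').
have [f [g L]] : exists f g, @nbhd_iso _ ar r D D' setT setT f g.
  have nm x : x < dn D -> named ar d N s F F' 0 x x.
    move=> xD; have xc : x < nconst by lia.
    exists x.+1; rewrite (view_const vF) // (view_const vF') //; split=> //.
    by rewrite /= /query_base addSn ltnS ltn_addr.
  apply: (pattern_nbhd_iso ar_gt0 (cast_ord En) (cast_ord (esym En)) vF vF') => // x _.
    by exists (cast_ord En x); rewrite ?inE //; apply: nm.
  exists (cast_ord (esym En) x); rewrite ?inE //; apply: named_sym; exact: (nm (cast_ord (esym En) x) (ltn_ord _)).
have I := nbhd_iso_setT L; have I' := db_iso_sym I.
by apply: asbool_equiv_eq; split; apply: isoP.
Qed.

Definition all_pairs := [seq (a, b) | a <- iota 0 nregs, b <- iota 0 nregs].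

Lemma all_pairs_pattern F F' : comparisons all_pairs F = comparisons all_pairs F' ->
  same_pattern ar d N s r F F'.
Proof.
move=> /eq_in_map E a b al bl; apply: (E (a, b)).
by apply/allpairsP; exists (a, b); rewrite !mem_iota.
Qed.

(* A finite table hard-wired into the decision tree, so it need not be computable. *)
Definition chi (pat : seq bool) : bool :=
  `[< exists D (rep : reprT D) l F,
    [/\ C D, valid_repr rep, view rep l F, size l = s & 0 < dn D -> all (fun x => x < dn D) l] /\
    comparisons all_pairs F = pat /\ decision D l >].

Lemma chi_decide D (rep : reprT D) l F : 0 < N -> C D -> valid_repr rep -> view rep l F ->
  size l = s -> (0 < dn D -> all (fun x => x < dn D) l) ->
  chi (comparisons all_pairs F) = decision D l.
Proof.
move=> N0 CD vr vF sl al; apply/asboolP/idP => [|H]; last by exists D, rep, l, F.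
case=> D' [rep' [l' [F' [[CD' vr' vF' sl' al'] [E H]]]]].
by rewrite -(decide_pattern vF' vF) //; exact: all_pairs_pattern.
Qed.

Definition prologue := consts k d N.
Definition probe := prologue ++ rands nconst.+1 s ++ queries ar d N s r.
Definition tester := probe ++ decision_tree (size probe) all_pairs chi.
Definition run_time := nconst + (s + (nquery ar d N s r + (size all_pairs).+1)).

Lemma tester_run (R : realType) D (rep : reprT D) : 0 < N -> C D -> valid_repr rep ->
  halts tester rep run_time 0 (init_regs D) /\
  acc_prob (R := R) tester rep run_time 0 (init_regs D) =
    if dn D == 0 then ((decision D (nseq s 0))%:R)%R else Esamp (dn D) s (fun l => ((decision D l)%:R)%R).
Proof.
move=> N0 CD vr.
pose R1 := foldl (step rep) (init_regs D) prologue.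
pose tr := decision_tree (size probe) all_pairs chi.
have sc : size prologue = nconst by rewrite size_map size_iota.
have sq : size (queries ar d N s r) = nquery ar d N s r by rewrite size_map size_iota.
have stc : all straight prologue by rewrite all_map; apply/allP.
have stq : all straight (queries ar d N s r) by rewrite all_map; apply/allP.
have E1 : tester = [::] ++ prologue ++ (rands nconst.+1 s ++ queries ar d N s r ++ tr).
  by rewrite /tester /probe -!catA.
have E2 : tester = prologue ++ rands nconst.+1 s ++ (queries ar d N s r ++ tr).
  by rewrite /tester /probe -!catA.
have E3 : tester = (prologue ++ rands nconst.+1 s) ++ queries ar d N s r ++ tr.
  by rewrite /tester /probe -!catA.
have E4 : tester = probe ++ decision_tree (size probe) all_pairs chi ++ [::] by rewrite cats0.
have S3 : nconst + s = size (prologue ++ rands nconst.+1 s) by rewrite size_cat sc size_rands.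
have S4 : nconst + s + nquery ar d N s r = size probe.
  by rewrite /probe !size_cat sc size_rands sq addnA.
have R10 : R1 0 = dn D.
  by rewrite /R1 /prologue /consts foldl_consts.
split.
  rewrite /run_time -sc E1 (halts_straight rep [::]) // -E1 E2 add0n.
  apply: halts_rands => l sl; rewrite -E2 E3 sc S3 -sq halts_straight // -E3 sq -S3 S4 E4.
  exact: halts_tree.
have fin l : size l = s -> (0 < dn D -> all (fun x => x < dn D) l) ->
   acc_prob (R := R) tester rep (nquery ar d N s r + (size all_pairs).+1) (size prologue + s)
     (write_seq l nconst.+1 R1) = ((decision D l)%:R)%R.
  move=> sl al; rewrite E3 sc S3 -sq acc_straight // -E3 sq -S3 S4 E4 acc_tree.
  by rewrite (@chi_decide D rep l) //; exact: view_run.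
rewrite /run_time -sc E1 (acc_straight rep R [::]) // -E1 add0n -/R1 E2.
(* On the empty database all samples are 0 and denote no element; since [0 < N], [decision] ignores
   them. *)
case: eqP => [n0|/eqP n0].
  by rewrite acc_rands0 ?R10 // -E2 fin ?size_nseq // n0.
rewrite (@acc_rands _ _ _ rep R _ _ _ _ _ _ (dn D)) ?lt0n //; apply: Esamp_eq => l /andP[/eqP sl al].
by rewrite -E2 fin.
Qed.

End Tester.

(** Consequently a database far from [P] is not in [P], which settles the databases that are read
    completely. *)
Lemma eps_close_refl (R : realType) k (ar : 'I_k -> nat) (eps : R) d (D : db ar) :
  (0 <= eps)%R -> eps_close eps d D D.
Proof.
move=> e0; exists 0; split; last by rewrite !mulr_ge0 ?ler0n.
exists 0, 0, D, D; do 3 split=> //; exists id; split; first by exists id.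
move=> Q t; suff -> : tmap id t = t by [].
by apply/ffunP=> i; rewrite ffunE.
Qed.

Theorem theorem12 (R : realType) (k : nat) (ar : 'I_k -> nat) (d : nat)
    (C P : db ar -> Prop) :
  (forall Q : 'I_k, 0 < ar Q) ->
  2 <= d ->
  iso_closed C -> iso_closed P ->
  (forall D, C D -> degree_le D d) ->
  closed_under_tuple_removal C ->
  (forall D, P D -> C D) ->
  hyperfinite_on (R := R) C P ->
  (forall r : nat, semilinear_set (hist_set r P)) ->
  uniformly_testable_const_time (R := R) d C P.
Proof.
move=> ar_gt0 d2 _ isoP degC _ PC hyp semi eps /andP[eps0 _].
have [r [N [s [G [N0 test]]]]] := sampling_test ar_gt0 d2 eps0 degC PC hyp semi.
exists (tester d N s r C P G), (run_time ar d N s r) => D rep CD vr.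
have [Hh Ha] := tester_run ar_gt0 s r G isoP degC R N0 CD vr.
rewrite Ha; split=> {Ha Hh}//.
have [small|large] := ltnP (dn D) N.
  have -> : (if dn D == 0 then (decision N r P G D (nseq s 0%N))%:R
     else Esamp (dn D) s (fun l => (decision N r P G D l)%:R))%R = (`[< P D >]%:R)%R :> R.
    rewrite /decision small; case: eqP => // /eqP n0; rewrite Esamp_cst ?lt0n //.
  split=> [PD|far]; first by rewrite asboolT //=; lra.
  by rewrite asboolF /=; [lra | move=> PD; apply: (far D PD); apply: eps_close_refl; exact: ltW].
rewrite gtn_eqF ?(leq_trans N0) //.
have E : Esamp (dn D) s (fun l => (decision N r P G D l)%:R)%R =
  Esamp (R := R) (dn D) s (fun l => (G (map (sample_type r D) l))%:R)%R.
  by apply: Esamp_eq => l _; rewrite /decision ltnNge large.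
by rewrite E; exact: test.
Qed.
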